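(* Let $N\ge 1$ and $0\le r\le N$. Suppose $(u_n)_{n\in\mathbb N}$ is a sequence in $L^1(\mathbb R^N,\Lambda^r)$ with $du_n=0$ in the sense of distributions for every $n$, and suppose there exists $L>0$ such that $$\int_{\{y\in\mathbb R^N:\ |u_n(y)|>L\}}|u_n(y)|\,dy\longrightarrow 0\quad\text{as }n\to\infty.$$ Then there exist a constant $C_1=C_1(N,r)>0$ and a sequence $v_n\in L^\infty(\mathbb R^N,\Lambda^r)$ with $dv_n=0$ in the sense of distributions such that (i) $\|v_n\|_{L^\infty(\mathbb R^N,\Lambda^r)}\le C_1L$ for all $n$; (ii) $\|v_n-u_n\|_{L^1(\mathbb R^N,\Lambda^r)}\to 0$ as $n\to\infty$; (iii) $|\{y\in\mathbb R^N: v_n(y)\neq u_n(y)\}|\to 0$ as $n\to\infty$.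
   Context: $\Lambda^r$ denotes the $r$-fold exterior power of $(\mathbb R^N)^*$, with the Euclidean norm $|\cdot|$ with respect to the basis $\theta_{k_1}\wedge\dots\wedge\theta_{k_r}$ ($k_1<\dots<k_r$), where $\theta_1,\dots,\theta_N$ is the dual of the standard basis of $\mathbb R^N$. $d$ is the exterior derivative. For $\omega\in L^1_{loc}(\mathbb R^N,\Lambda^r)$, ''$d\omega=0$ in the sense of distributions'' means $\int_{\mathbb R^N} d\phi\wedge\omega=0$ for all $\phi\in C_c^\infty(\mathbb R^N,\Lambda^{N-r-1})$ (identifying $\Lambda^N\cong\mathbb R$). $|A|$ denotes Lebesgue measure. *)

(* Defs.v *)
From HB Require Import structures.
From mathcomp Require Import all_boot all_order all_algebra.
From mathcomp Require Import all_classical all_reals all_analysis.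
Set Implicit Arguments. Unset Strict Implicit. Unset Printing Implicit Defensive.
Import Order.TTheory GRing.Theory Num.Theory.
Import numFieldNormedType.Exports.
Local Open Scope classical_set_scope.
Local Open Scope ring_scope.

(* Index set of the standard basis of Lambda^r (R^N)^*:
   increasing multi-indices k_1 < ... < k_r, i.e. r-subsets of {0..N-1}. *)
Definition rset (N r : nat) := {I : {set 'I_N} | #|I| == r}.

Definition rform (R : realType) (N r : nat) := rset N r -> R.

Definition fnorm (R : realType) (N r : nat) (w : rform R N r) : R :=
  Num.sqrt (\sum_(I : rset N r) w I ^+ 2).

(* Points of R^N: N-tuples of reals (with the product Borel sigma-algebra). *)
(* Lebesgue measure on R^N, characterised by its value on half-open boxes
   (this determines it uniquely on the Borel sigma-algebra). *)
Definition is_lebesgue (R : realType) (N : nat)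
  (mu : {measure set (N.-tuple R) -> \bar R}) : Prop :=
  forall a b : N.-tuple R, (forall i, tnth a i <= tnth b i) ->
    mu [set x | forall i, tnth a i <= tnth x i < tnth b i]
      = (\prod_(i < N) (tnth b i - tnth a i))%:E.

Definition tuple_of_row (R : realType) (N : nat) (x : 'rV[R]_N) : N.-tuple R :=
  [tuple x ord0 i | i < N].

Definition partial (R : realType) (N : nat) (k : 'I_N) (f : 'rV[R]_N -> R) :
  'rV[R]_N -> R := fun x => 'D_(delta_mx 0 k) f x.

Definition smooth (R : realType) (N : nat) (f : 'rV[R]_N -> R) : Prop :=
  forall s : seq 'I_N,
    continuous (foldr (@partial R N) f s) /\
    forall (k : 'I_N) (x : 'rV[R]_N),
      derivable (foldr (@partial R N) f s) x (delta_mx 0 k).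

Definition test_fun (R : realType) (N : nat) (phi : N.-tuple R -> R) : Prop :=
  smooth (phi \o @tuple_of_row R N) /\
  compact (closure [set x : 'rV[R]_N | (phi \o @tuple_of_row R N) x != 0]).

Definition dpartial (R : realType) (N : nat) (k : 'I_N) (phi : N.-tuple R -> R)
  (y : N.-tuple R) : R :=
  partial k (phi \o @tuple_of_row R N) (\row_i tnth y i).

(* sign of dx_A ^ dx_B = wedge_sign A B dx_(A :|: B) *)
Definition wedge_sign (R : realType) (N : nat) (A B : {set 'I_N}) : R :=
  if [disjoint A & B] then
    (-1) ^+ #|[set p : 'I_N * 'I_N | [&& p.1 \in A, p.2 \in B & (p.2 < p.1)%N]]|
  else 0.

(* coefficient of d phi ^ omega w.r.t. theta_1 ^ ... ^ theta_N, for phi an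
   (N-r-1)-form with coordinates phi J (#|J| = N-r-1) and omega an r-form.
   d(phi_J dx_J) = sum_k d_k phi_J dx_k ^ dx_J.  When r = N there are no
   (N-r-1)-forms and the sum is empty. *)
Definition dwedge (R : realType) (N r : nat)
  (phi : {set 'I_N} -> N.-tuple R -> R) (omega : N.-tuple R -> rform R N r)
  (y : N.-tuple R) : R :=
  \sum_(J : {set 'I_N} | (#|J| + r + 1)%N == N)
   \sum_(k : 'I_N)
    \sum_(I : rset N r)
      wedge_sign R [set k] J * wedge_sign R (k |: J) (val I)
      * dpartial k (phi J) y * omega y I.

Definition dclosed (R : realType) (N r : nat)
  (mu : {measure set (N.-tuple R) -> \bar R}) (omega : N.-tuple R -> rform R N r)
  : Prop :=
  forall phi : {set 'I_N} -> N.-tuple R -> R,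
    (forall J, test_fun (phi J)) ->
    (\int[mu]_y (dwedge phi omega y)%:E = 0)%E.

Definition form_measurable (R : realType) (N r : nat)
  (omega : N.-tuple R -> rform R N r) : Prop :=
  forall I : rset N r, measurable_fun setT (fun y => omega y I).

(* Main.v *)
Require Import Defs.
From HB Require Import structures.
From mathcomp Require Import all_boot all_order all_algebra.
From mathcomp Require Import all_classical all_reals all_analysis.
From mathcomp Require Import measurable_realfun ess_sup_inf.
From mathcomp Require Import ring lra zify.
Set Implicit Arguments. Unset Strict Implicit. Unset Printing Implicit Defensive.
Import Order.TTheory GRing.Theory Num.Theory.
Import numFieldNormedType.Exports.
Local Open Scope classical_set_scope.
Local Open Scope ring_scope.

(* Let f = |u| on {|u| > L} and eps = int f. Dyadic cubes of side 2^-j <= 1 whose f-average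
   exceeds L and which are maximal with this property cover, after inflation, a set of measure
   O(eps / L); bad k is the union of those of side at least 2^-k, inflated by an amount
   increasing with k, so that the 2^(1-k)-neighbourhood of bad k lies in bad k.+1.

   Let eta_k be a product mollifier at scale 2^-k and u_k = eta_k * u / int eta_k. As eta_{k+1} - eta_k
   = sum_i d_i P_{k,i} with explicit products P_{k,i}, Cartan's formula shows that
   u_{k+1} - u_k = d S_k with S_k = sum_i i_{e_i} (P_{k,i} * u) / int eta_k, because du = 0. If
   chi_k is the complement of 1_(bad k) mollified at scale 2^-k, then
     v_K = u_0 + sum_(k < K) d (chi_k S_k)
   is closed. At a given point chi_k is locally 1 before the first scale k0 at which
   bad k comes within 2^-k, and locally 0 after it, so the sum telescopes to u_k0 plus a single term,
   and everything is bounded by averages of |u| over cubes of side ~ 2^-k0, which are O(L). Off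
   the union of the bad k one has v_K = u_K, which tends to u in L^1; on it v_K is eventually
   constant. The limit v is closed, is O(L), and differs from u only on the union of the bad k. *)

(** * Boxes and Lebesgue measure on tuples *)

(** The constant is chosen before [mu], and the integral of the mollifier is never computed. Hence
    the division by [eta_mass mu], which does not depend on the scale and is bounded below uniformly
    over all [mu] satisfying [is_lebesgue]. The mollifiers are products of one-variable functions
    because exchanging the factors one at a time from scale k to scale k+1 gives explicit compactly
    supported P_{k,i}, so that no homotopy operator is needed. Moreover P_{k,i} is smaller than the
    bound for eta_k by a factor 2^-k, exactly what the gradient 2^k of chi_k costs. Smoothness is
    needed only for kernels and test functions. All other differentiation uses first derivatives
    with a uniform quadratic remainder ([C11]): it passes under integrals by estimates, and d d = 0
    is used only in integrated form against a test function. A point outside [bad k] controls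
    averages at radius 2^-(k+1). At scale 0 no previous scale exists, and the bound int f <= L takes
    its place; it holds for large n only, and v_n = 0 is taken for the others. *)

Section tuples.
Context {R : realType} {N : nat}.
Implicit Types x y a b : N.-tuple R.

Definition tadd x y : N.-tuple R := [tuple tnth x i + tnth y i | i < N].
Definition tsub x y : N.-tuple R := [tuple tnth x i - tnth y i | i < N].
Definition tdir (l : 'I_N) (h : R) : N.-tuple R :=
  [tuple if i == l then h else 0 | i < N].

Lemma tnth_tadd x y i : tnth (tadd x y) i = tnth x i + tnth y i.
Proof. by rewrite tnth_mktuple. Qed.

Lemma tnth_tsub x y i : tnth (tsub x y) i = tnth x i - tnth y i.
Proof. by rewrite tnth_mktuple. Qed.

Lemma tnth_tdir l h i : tnth (tdir l h) i = if i == l then h else 0.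
Proof. by rewrite tnth_mktuple. Qed.

Lemma tsub_taddl x y a : tsub (tadd x a) y = tadd (tsub x y) a.
Proof.
by apply: eq_from_tnth => i; rewrite !(tnth_tadd, tnth_tsub) addrAC.
Qed.

Lemma tadd_dir_opp x l (h : R) : tadd (tadd x (tdir l h)) (tdir l (- h)) = x.
Proof.
apply: eq_from_tnth => i; rewrite !tnth_tadd !tnth_tdir.
by case: ifP => _; rewrite ?addrK ?addr0.
Qed.

Lemma tadd_dir0 x l : tadd x (tdir l 0) = x.
Proof.
by apply: eq_from_tnth => i; rewrite tnth_tadd tnth_tdir if_same addr0.
Qed.

Definition hbox a b : set (N.-tuple R) :=
  [set x | forall i, tnth a i <= tnth x i < tnth b i].

(** Half-open, so that [is_lebesgue] gives its measure directly; the radius is [t], the side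
    [2 * t]. *)
Definition cube x (t : R) : set (N.-tuple R) :=
  hbox [tuple tnth x i - t | i < N] [tuple tnth x i + t | i < N].

Lemma cubeE x t y :
  cube x t y <-> forall i, tnth x i - t <= tnth y i < tnth x i + t.
Proof.
by split=> H i; move: (H i); rewrite !tnth_mktuple.
Qed.

Lemma measurable_hbox a b : measurable (hbox a b).
Proof.
have -> : hbox a b = \big[setI/setT]_(i < N)
    ((fun x => tnth x i) @^-1` `[tnth a i, tnth b i[%classic).
  apply/seteqP; split=> x.
    move=> H; rewrite -bigcap_seq => i _ /=; rewrite in_itv /=; exact: H.
  rewrite -bigcap_seq => H i; have := H i.
  by rewrite /= mem_index_enum in_itv /=; exact.
apply: bigsetI_measurable => i _; rewrite -[X in measurable X]setTI.
exact: measurable_tnth.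
Qed.

Definition hboxes : set (set (N.-tuple R)) :=
  [set A | exists a b, A = hbox a b].

Lemma hboxes_setI : setI_closed hboxes.
Proof.
move=> _ _ [a [b ->]] [a' [b' ->]].
exists [tuple Num.max (tnth a i) (tnth a' i) | i < N].
exists [tuple Num.min (tnth b i) (tnth b' i) | i < N].
apply/seteqP; split=> x.
  move=> [H1 H2] i; rewrite !tnth_mktuple ge_max lt_min.
  by move: (H1 i) (H2 i) => /andP[-> ->] /andP[-> ->].
move=> H; split=> i; move: (H i); rewrite !tnth_mktuple ge_max lt_min.
  by move=> /andP[/andP[-> _] /andP[-> _]].
by move=> /andP[/andP[_ ->] /andP[_ ->]].
Qed.

Definition tcst (t : R) : N.-tuple R := [tuple t | i < N].

Definition bigbox (n : nat) := hbox (tcst (- n%:R)) (tcst n%:R).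

Lemma bigboxP n x : bigbox n x <-> forall i, - n%:R <= tnth x i < n%:R.
Proof. by split=> H i; move: (H i); rewrite !tnth_mktuple. Qed.

Lemma bigbox_cover : \bigcup_k bigbox k = setT.
Proof.
apply/seteqP; split=> // x _.
pose m := \sum_(i < N) (Num.Def.archi_bound `|tnth x i|)%R.
exists m => //; apply/bigboxP => i.
have : `|tnth x i| < m%:R.
  apply: lt_le_trans (archi_boundP (normr_ge0 _)) _.
  by rewrite ler_nat /m (bigD1 i) //= leq_addr.
by rewrite ltr_norml => /andP[/ltW -> ->].
Qed.

(** Makes the boxes a generating pi-system on which measures can be compared. The nontrivial
    inclusion reduces to preimages of half-lines under one coordinate, since half-lines generate the
    Borel sets of the line. *)
Lemma measurable_tupleE : measurable = <<s hboxes >>.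
Proof.
apply/seteqP; split; last first.
  apply: smallest_sub; first exact: sigma_algebra_measurable.
  by move=> _ [a [b ->]]; exact: measurable_hbox.
apply: smallest_sub; first exact: smallest_sigma_algebra.
move=> A; rewrite -bigcup_seq /= => -[i _] [B mB <-]; rewrite setTI.
have {}mB : (RGenCInfty.G (R:=R)).-sigma.-measurable B.
  by rewrite -RGenCInfty.measurableE.
pose K := [set B : set R | <<s hboxes >> ((fun x => tnth x i) @^-1` B)].
suff : <<s RGenCInfty.G (R:=R) >> `<=` K by apply.
have sH := smallest_sigma_algebra [set: N.-tuple R] hboxes.
apply: smallest_sub.
  split.
  - by rewrite /K /= preimage_set0; exact: (sigma_algebra0 _).
  - by move=> C KC; rewrite setTD /K /= preimage_setC -setTD; case: sH => _ + _; apply.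
  - move=> C KC; rewrite /K /= preimage_bigcup.
    by case: sH => _ _; apply.
move=> _ [r ->]; rewrite /K /=.
(* Truncating the other coordinates to [-k, k) turns the half-space into a countable union of
   boxes. *)
have -> : (fun x : N.-tuple R => tnth x i) @^-1` `[r, +oo[%classic =
  \bigcup_k hbox [tuple if j == i then r else - k%:R | j < N] (tcst k%:R).
  apply/seteqP; split=> x /=.
    rewrite in_itv /= andbT => rx.
    have : setT x by [].
    rewrite -bigbox_cover => -[k _ /bigboxP Hk]; exists k => // j.
    rewrite !tnth_mktuple; case: eqP => [->|_]; last exact: Hk.
    by rewrite rx /=; case/andP: (Hk i).
  move=> [k _ /(_ i)]; rewrite !tnth_mktuple eqxx in_itv /= andbT.
  by move=> /andP[].
case: sH => _ _; apply => k; apply: sub_sigma_algebra.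
by eexists; eexists; reflexivity.
Qed.

Lemma measurable_tadd a : measurable_fun [set: N.-tuple R] (tadd ^~ a).
Proof.
apply/measurable_fun_tnthP => i.
rewrite (_ : _ \o _ = fun x => tnth x i + tnth a i); last first.
  by apply/funext => x /=; rewrite tnth_tadd.
by apply: measurable_funD => //; exact: measurable_tnth.
Qed.

Lemma measurable_tsub :
  measurable_fun setT (fun z : N.-tuple R * N.-tuple R => tsub z.1 z.2).
Proof.
apply/measurable_fun_tnthP => i.
rewrite (_ : _ \o _ = fun x : N.-tuple R * N.-tuple R => tnth x.1 i - tnth x.2 i); last first.
  by apply/funext => x /=; rewrite tnth_tsub.
by apply: measurable_funB;
  apply: (measurableT_comp (measurable_tnth i)).
Qed.

Lemma measurable_tsubl x : measurable_fun [set: N.-tuple R] (tsub x).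
Proof.
apply/measurable_fun_tnthP => i.
rewrite (_ : _ \o _ = fun y => tnth x i - tnth y i); last first.
  by apply/funext => y /=; rewrite tnth_tsub.
by apply: measurable_funB => //; exact: measurable_tnth.
Qed.

End tuples.

Section lebesgue_tuple.
Context {R : realType} {N : nat} {mu : {measure set (N.-tuple R) -> \bar R}}.
Hypothesis leb : is_lebesgue mu.
Implicit Types x y a b : N.-tuple R.

Lemma mu_hbox a b : (forall i, tnth a i <= tnth b i) ->
  mu (hbox a b) = (\prod_(i < N) (tnth b i - tnth a i))%:E.
Proof. exact: leb. Qed.

Lemma mu_cube x (t : R) : 0 <= t -> mu (cube x t) = ((2 * t) ^+ N)%:E.
Proof.
move=> t0; rewrite mu_hbox; last by move=> i; rewrite !tnth_mktuple; lra.
congr EFin; under eq_bigr do rewrite !tnth_mktuple.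
rewrite (eq_bigr (fun=> 2 * t)); last by move=> i _; ring.
by rewrite prodr_const card_ord.
Qed.

Lemma mu_bigbox n : (mu (bigbox n) < +oo)%E.
Proof.
rewrite mu_hbox ?ltry// => i; rewrite !tnth_mktuple.
by have := ler0n R n; lra.
Qed.

Lemma lebesgue_sigma_finite : sigma_finite setT mu.
Proof.
exists bigbox; first by rewrite bigbox_cover.
by move=> n; split; [exact: measurable_hbox|exact: mu_bigbox].
Qed.

(** Translation preserves side lengths, so both measures agree on boxes; uniqueness on a generating
    pi-system with an exhaustion of finite measure does the rest. *)
Lemma mu_tadd a (A : set (N.-tuple R)) : measurable A ->
  pushforward mu (tadd ^~ a) A = mu A.
Proof.
move=> mA.
pose mf := measurable_tadd a.
pose m1 := @pushforward _ _ _ _ R mu (tadd ^~ a).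
pose m1m : {measure set (N.-tuple R) -> \bar R} :=
  measure_function_pushforward__canonical__measure_function_Measure mu mf.
apply/esym.
apply: (measure_unique hboxes bigbox measurable_tupleE hboxes_setI _ bigbox_cover
  mu m1m) => //.
- by move=> i; eexists; eexists; reflexivity.
- move=> _ [c [d ->]] /=; rewrite /pushforward.
  have -> : (tadd ^~ a) @^-1` hbox c d = hbox (tsub c a) (tsub d a).
    apply/seteqP; split=> x H i; move: (H i);
      rewrite /= ?tnth_tsub ?tnth_tadd; lra.
  (* [is_lebesgue] is silent about boxes with a reversed side; those are empty, before and after
     translation. *)
  have [/forallP cd|] := boolP [forall i, tnth c i <= tnth d i].
    rewrite !mu_hbox //; last first.
      by move=> i; rewrite !tnth_tsub; have := cd i; lra.
    congr EFin; apply: eq_bigr => i _; rewrite !tnth_tsub; ring.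
  rewrite negb_forall => /existsP[i]; rewrite -ltNge => dc.
  have -> : hbox c d = set0.
    by apply/seteqP; split=> // x /(_ i); lra.
  have -> : hbox (tsub c a) (tsub d a) = set0.
    by apply/seteqP; split=> // x /(_ i); rewrite !tnth_tsub; lra.
  by rewrite !measure0.
- by move=> k; exact: mu_bigbox.
Qed.

End lebesgue_tuple.

(** * Real-valued integrals *)

Section real_integral.
Context d (T : measurableType d) (R : realType) (mu : {measure set T -> \bar R}).
Implicit Types (f g : T -> R) (A : set T).

Definition intg f := mu.-integrable setT (EFin \o f).

Lemma intg_measurable f : intg f -> measurable_fun setT f.
Proof. by move=> /measurable_int /measurable_EFinP. Qed.

Lemma intg_le f g : measurable_fun setT f -> intg g ->
  (forall x, `|f x| <= g x) -> intg f.
Proof.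
move=> mf ig fg; apply: le_integrable ig => //.
  exact/measurable_EFinP.
by move=> x _ /=; rewrite lee_fin (le_trans (fg x))// ler_norm.
Qed.

Lemma intgD f g : intg f -> intg g -> intg (fun x => f x + g x).
Proof.
move=> If Ig; rewrite /intg (_ : _ \o _ = (EFin \o f) \+ (EFin \o g))%E//.
exact: integrableD.
Qed.

Lemma intgB f g : intg f -> intg g -> intg (fun x => f x - g x).
Proof.
move=> If Ig; rewrite /intg (_ : _ \o _ = (EFin \o f) \- (EFin \o g))%E//.
exact: integrableB.
Qed.

Lemma intgZ (r : R) f : intg f -> intg (fun x => r * f x).
Proof.
move=> If; rewrite /intg (_ : _ \o _ = (fun x => r%:E * (EFin \o f) x))%E//.
exact: integrableZl.
Qed.

Lemma intgN f : intg f -> intg (fun x => - f x).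
Proof.
move=> /(intgZ (-1)); rewrite (_ : (fun x => _) = (fun x => - f x))//.
by apply/funext => x; rewrite mulN1r.
Qed.

Lemma intg0 : intg (fun=> 0).
Proof. exact: integrable0. Qed.

Lemma intg_sum (I : Type) (s : seq I) (P : pred I) (F : I -> T -> R) :
  (forall i, P i -> intg (F i)) -> intg (fun x => \sum_(i <- s | P i) F i x).
Proof.
move=> H; elim: s => [|i s IH].
  rewrite (_ : (fun=> _) = fun=> 0); first exact: intg0.
  by apply/funext => x; rewrite big_nil.
have [Pi|Pi] := boolP (P i).
  rewrite (_ : (fun=> _) = fun x => F i x + \sum_(j <- s | P j) F j x).
    by apply: intgD => //; exact: H.
  by apply/funext => x; rewrite big_cons Pi.
rewrite (_ : (fun=> _) = fun x => \sum_(j <- s | P j) F j x)//.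
by apply/funext => x; rewrite big_cons (negbTE Pi).
Qed.

Lemma intg_norm f : intg f -> intg (fun x => `|f x|).
Proof. by move=> /integrable_abse. Qed.

Lemma intgM f g (C : R) : measurable_fun setT f -> (forall x, `|f x| <= C) ->
  intg g -> intg (fun x => f x * g x).
Proof.
move=> mf fC ig; apply: (@intg_le _ (fun x => C * `|g x|)).
- by apply: measurable_funM => //; exact: intg_measurable.
- exact/intgZ/intg_norm.
- by move=> x; rewrite normrM ler_wpM2r.
Qed.

Lemma intg_indic A : measurable A -> (mu A < +oo)%E -> intg (\1_A : T -> R).
Proof.
move=> mA Aoo; apply/integrableP; split.
  by apply/measurable_EFinP; exact: measurable_indic.
rewrite (eq_integral (fun x => (\1_A x : R)%:E)).
  by rewrite integral_indic// setIT.
by move=> x _ /=; rewrite ger0_norm.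
Qed.

Lemma RintD f g : intg f -> intg g ->
  \int[mu]_x (f x + g x) = \int[mu]_x f x + \int[mu]_x g x.
Proof. by move=> If Ig; exact: RintegralD. Qed.

Lemma RintB f g : intg f -> intg g ->
  \int[mu]_x (f x - g x) = \int[mu]_x f x - \int[mu]_x g x.
Proof. by move=> If Ig; exact: RintegralB. Qed.

Lemma RintZ (r : R) f : intg f -> \int[mu]_x (r * f x) = r * \int[mu]_x f x.
Proof. by move=> If; exact: RintegralZl. Qed.

Lemma Rint0 : \int[mu]_x (0 : R) = 0.
Proof. by rewrite /Rintegral integral0. Qed.

Lemma RintN f : intg f -> \int[mu]_x (- f x) = - \int[mu]_x f x.
Proof.
move=> If; rewrite -mulN1r -RintZ//.
by apply: eq_Rintegral => x _; rewrite mulN1r.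
Qed.

Lemma Rint_sum (I : Type) (s : seq I) (P : pred I) (F : I -> T -> R) :
  (forall i, P i -> intg (F i)) ->
  \int[mu]_x (\sum_(i <- s | P i) F i x) = \sum_(i <- s | P i) \int[mu]_x F i x.
Proof.
move=> H; elim: s => [|i s IH].
  by under eq_Rintegral do rewrite big_nil; rewrite Rint0 big_nil.
under eq_Rintegral do rewrite big_cons.
rewrite big_cons; case: ifP => Pi //; rewrite RintD ?IH//; first exact: H.
exact: intg_sum.
Qed.

Lemma le_Rint f g : intg f -> intg g -> (forall x, f x <= g x) ->
  \int[mu]_x f x <= \int[mu]_x g x.
Proof. by move=> If Ig fg; exact: le_Rintegral. Qed.

Lemma normr_Rint f : intg f -> `|\int[mu]_x f x| <= \int[mu]_x `|f x|.
Proof. by move=> If; exact: le_normr_Rintegral. Qed.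

Lemma normr_Rint_le f g : intg f -> intg g -> (forall x, `|f x| <= g x) ->
  `|\int[mu]_x f x| <= \int[mu]_x g x.
Proof.
move=> If Ig fg; apply: le_trans (normr_Rint If) _.
by apply: le_Rint => //; exact: intg_norm.
Qed.

Lemma EFin_Rint f : intg f -> (\int[mu]_x f x)%:E = (\int[mu]_x (f x)%:E)%E.
Proof. by move=> If; rewrite /Rintegral fineK//; exact: integrable_fin_num. Qed.

Lemma Rint_indic A : measurable A -> \int[mu]_x (\1_A x : R) = fine (mu A).
Proof. by move=> mA; rewrite /Rintegral integral_indic// setIT. Qed.

End real_integral.

Section translation.
Context {R : realType} {N : nat} {mu : {measure set (N.-tuple R) -> \bar R}}.
Hypothesis leb : is_lebesgue mu.
Implicit Types (f : N.-tuple R -> R) (a : N.-tuple R).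

Lemma ge0_integral_tadd a (f : N.-tuple R -> \bar R) :
  measurable_fun setT f -> (forall x, (0 <= f x)%E) ->
  (\int[mu]_x f (tadd x a) = \int[mu]_x f x)%E.
Proof.
move=> mf f0.
rewrite -(@ge0_integral_pushforward _ _ _ _ R _ (measurable_tadd a) mu setT f)//=.
apply: eq_measure_integral; first exact: measurable_tadd.
  by move=> mt A mA _; exact: (mu_tadd leb).
Qed.

Lemma intg_tadd a f : intg mu f -> intg mu (fun x => f (tadd x a)).
Proof.
move=> If; have mf := intg_measurable If; apply/integrableP; split.
  apply/measurable_EFinP; exact: measurableT_comp (measurable_tadd a).
rewrite (ge0_integral_tadd a (f := fun x => `|(f x)%:E|%E))//.
  by case/integrableP : If.
exact/measurableT_comp/measurable_EFinP.
Qed.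

Lemma Rint_tadd a f : intg mu f ->
  \int[mu]_x f (tadd x a) = \int[mu]_x f x.
Proof.
move=> If; rewrite /Rintegral; congr fine.
have mf := intg_measurable If.
rewrite -(@integral_pushforward _ _ _ _ R _ (measurable_tadd a) mu setT (EFin \o f))//=.
- apply: eq_measure_integral; first exact: measurable_tadd.
  by move=> mt A mA _; exact: (mu_tadd leb).
- exact/measurable_EFinP.
- exact: intg_tadd.
Qed.

Definition csupp f := exists b : R, forall x, f x != 0 -> forall i, `|tnth x i| <= b.

Lemma mem_csupp_bigbox f : csupp f -> exists n, forall x, ~ bigbox n x -> f x = 0.
Proof.
move=> [b fb]; exists (Num.Def.archi_bound b) => x nx; apply/eqP.
apply: contra_notT nx => /fb xb; apply/bigboxP => i.
have [b0|b0] := leP 0 b; last by have := normr_ge0 (tnth x i); have := xb i; lra.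
have : `|tnth x i| < (Num.Def.archi_bound b)%:R.
  by apply: le_lt_trans (xb i) _; exact: archi_boundP.
by rewrite ltr_norml => /andP[/ltW -> ->].
Qed.

Lemma intg_csupp f (C : R) : measurable_fun setT f -> (forall x, `|f x| <= C) ->
  csupp f -> intg mu f.
Proof.
move=> mf fC /mem_csupp_bigbox[n fn].
apply: (@intg_le _ _ _ _ _ (fun x => C * \1_(bigbox n) x)) => //.
  by apply/intgZ/intg_indic; [exact: measurable_hbox|exact: mu_bigbox].
move=> x; have [xn|xn] := pselect (bigbox n x).
  by rewrite indicE mem_set// mulr1.
by rewrite fn// indicE memNset// mulr0 normr0.
Qed.

Lemma csuppMl f g : csupp f -> csupp (fun x => f x * g x).
Proof.
move=> [b fb]; exists b => x; rewrite mulf_eq0 negb_or => /andP[fx _].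
exact: fb.
Qed.

End translation.

(** * Calculus with quadratic remainders *)

Section calculus.
Context {R : realType} {N : nat}.
Local Notation T := (N.-tuple R).

(* Bounded functions with bounded partial derivatives and a uniformly quadratic
   Taylor remainder; F' l plays the role of the l-th partial derivative. *)
Definition C11 (F : T -> R) (F' : 'I_N -> T -> R) := [/\ measurable_fun setT F,
  forall l, measurable_fun setT (F' l) &
  exists C : R, [/\ 0 <= C, forall x, `|F x| <= C, forall l x, `|F' l x| <= C &
    forall l x h, `|h| <= 1 ->
      `|F (tadd x (tdir l h)) - F x - h * F' l x| <= C * h ^+ 2]].

Lemma C11_cst (c : R) : C11 (fun=> c) (fun _ _ => 0).
Proof.
split=> //; exists `|c|; split=> // [l x|l x h _]; first by rewrite normr0.
by rewrite subrr mulr0 subr0 normr0 mulr_ge0// sqr_ge0.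
Qed.

Lemma C11Z (c : R) F F' : C11 F F' -> C11 (fun x => c * F x) (fun l x => c * F' l x).
Proof.
move=> [mF mF' [C [C0 FC FC' H]]]; split.
- exact: measurable_funM.
- by move=> l; exact: measurable_funM.
exists (`|c| * C); split=> [|x|l x|l x h h1].
- exact: mulr_ge0.
- by rewrite normrM ler_wpM2l.
- by rewrite normrM ler_wpM2l.
- rewrite (_ : _ - _ = c * (F (tadd x (tdir l h)) - F x - h * F' l x)); last ring.
  by rewrite normrM -mulrA ler_wpM2l// H.
Qed.

Lemma C11D F F' G G' : C11 F F' -> C11 G G' ->
  C11 (fun x => F x + G x) (fun l x => F' l x + G' l x).
Proof.
move=> [mF mF' [C [C0 FC FC' H]]] [mG mG' [D [D0 GD GD' HG]]]; split.
- exact: measurable_funD.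
- by move=> l; exact: measurable_funD.
exists (C + D); split=> [|x|l x|l x h h1].
- exact: addr_ge0.
- by rewrite (le_trans (ler_normD _ _))// lerD.
- by rewrite (le_trans (ler_normD _ _))// lerD.
- rewrite (_ : _ - _ = (F (tadd x (tdir l h)) - F x - h * F' l x) +
    (G (tadd x (tdir l h)) - G x - h * G' l x)); last ring.
  by rewrite (le_trans (ler_normD _ _))// mulrDl lerD// ?H ?HG.
Qed.

Lemma C11M F F' G G' : C11 F F' -> C11 G G' ->
  C11 (fun x => F x * G x) (fun l x => F' l x * G x + F x * G' l x).
Proof.
move=> [mF mF' [C [C0 FC FC' H]]] [mG mG' [D [D0 GD GD' HG]]]; split.
- exact: measurable_funM.
- by move=> l; apply: measurable_funD; exact: measurable_funM.
have CD : 0 <= C * D by exact: mulr_ge0.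
exists (4 * (C * D)); split=> [|x|l x|l x h h1].
- by apply: mulr_ge0.
- rewrite normrM; apply: (@le_trans _ _ (C * D)); last lra.
  exact: ler_pM.
- rewrite (le_trans (ler_normD _ _))// !normrM.
  apply: (@le_trans _ _ (C * D + C * D)); last lra.
  by apply: lerD; exact: ler_pM.
set x' := tadd x (tdir l h).
(* The last bracket is [G x' - G x], split so that four terms arise, each at most C D h^2; this is
   the origin of the factor 4. The term h F' times a remainder uses |h| <= 1. *)
rewrite (_ : _ - _ = (F x' - F x - h * F' l x) * G x' +
  F x * (G x' - G x - h * G' l x) +
  h * F' l x * ((G x' - G x - h * G' l x) + h * G' l x)); last ring.
rewrite (_ : 4 * (C * D) * h ^+ 2 = C * h ^+ 2 * D + C * (D * h ^+ 2) +
  (C * D * h ^+ 2 + C * D * h ^+ 2)); last ring.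
have h20 : 0 <= h ^+ 2 by exact: sqr_ge0.
apply: le_trans (ler_normD _ _) _; apply: lerD.
  apply: le_trans (ler_normD _ _) _; apply: lerD; rewrite normrM ler_pM//.
    exact: H.
  exact: HG.
rewrite mulrDr; apply: le_trans (ler_normD _ _) _.
have hh : `|h| * `|h| = h ^+ 2 by rewrite -normrM -expr2 ger0_norm.
apply: lerD.
  rewrite !normrM -!mulrA; apply: le_trans (ler_piMl _ h1) _; first exact: mulr_ge0.
  by rewrite ler_pM// HG.
rewrite !normrM (_ : _ * _ * _ = `|F' l x| * `|G' l x| * (`|h| * `|h|)); last ring.
by rewrite hh ler_wpM2r// ler_pM.
Qed.

Lemma C11_tadd (a : T) F F' : C11 F F' ->
  C11 (fun x => F (tadd x a)) (fun l x => F' l (tadd x a)).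
Proof.
move=> [mF mF' [C [C0 FC FC' H]]]; split.
- exact: measurableT_comp (measurable_tadd a).
- by move=> l; exact: measurableT_comp (measurable_tadd a).
exists C; split=> // l x h h1.
rewrite (_ : tadd (tadd x _) a = tadd (tadd x a) (tdir l h)); first exact: H.
by apply: eq_from_tnth => i; rewrite !tnth_tadd addrAC.
Qed.

Lemma csupp_tdir (F : T -> R) l (h : R) : csupp F -> csupp (fun x => F (tadd x (tdir l h))).
Proof.
move=> [b Fb]; exists (b + `|h|) => x /Fb Fx i; have := Fx i.
rewrite tnth_tadd tnth_tdir => H.
have -> : tnth x i = tnth x i + (if i == l then h else 0) - (if i == l then h else 0).
  by rewrite addrK.
apply: le_trans (ler_normB _ _) _; apply: lerD => //.
by case: ifP => _ //; rewrite normr0.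
Qed.

(** Stands in for limits h -> 0 below: a quantity is shown to vanish by bounding it by K h for every
    small h. *)
Lemma norm_small_eq0 (a K : R) :
  (forall h : R, 0 < h -> h <= 1 -> `|a| <= K * h) -> a = 0.
Proof.
move=> H; apply/eqP; rewrite -normr_le0 leNgt; apply/negP => a0.
have K0 : 0 < K by have := H 1 ltr01 (lexx _); rewrite mulr1; exact: lt_le_trans.
pose h := Num.min 1 (`|a| / (2 * K)).
have h0 : 0 < h by rewrite lt_min ltr01 divr_gt0// mulr_gt0.
have h1 : h <= 1 by rewrite ge_min lexx.
have := H h h0 h1; apply/negP; rewrite -ltNge.
apply: (@le_lt_trans _ _ (`|a| / 2)); last lra.
have : K * h <= K * (`|a| / (2 * K)) by rewrite ler_wpM2l ?(ltW K0)// ge_min lexx orbT.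
by move=> /le_trans; apply; rewrite invfM mulrCA [K * _]mulrC divfK ?gt_eqF//.
Qed.

Lemma tadd_out (F : T -> R) (b h : R) x i l :
  (forall y, F y != 0 -> forall j, `|tnth y j| <= b) -> b + 1 < `|tnth x i| ->
  `|h| <= 1 -> F (tadd x (tdir l h)) = 0.
Proof.
move=> Fb xi h1; apply/eqP; apply/negPn/negP => /Fb /(_ i).
rewrite tnth_tadd tnth_tdir => Hb.
suff : `|tnth x i| <= b + 1 by rewrite leNgt xi.
have -> : tnth x i = tnth x i + (if i == l then h else 0) - (if i == l then h else 0).
  by rewrite addrK.
apply: le_trans (ler_normB _ _) _; apply: lerD => //.
by case: ifP => _ //; rewrite normr0.
Qed.

(** For |h| <= 1 both values of [F] in the difference quotient vanish, so the remainder estimate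
    reads |h F'| <= C h^2. *)
Lemma C11'_out F F' (b : R) x i l : C11 F F' ->
  (forall y, F y != 0 -> forall j, `|tnth y j| <= b) -> b + 1 < `|tnth x i| ->
  F' l x = 0.
Proof.
move=> [_ _ [C [C0 _ _ H]]] Fb xi; apply: (@norm_small_eq0 _ C) => h h0 h1.
have h1' : `|h| <= 1 by rewrite gtr0_norm.
have := H l x h h1'; rewrite (tadd_out _ Fb xi h1').
rewrite -[in X in 0 - X](tadd_dir0 x l) (tadd_out _ Fb xi) ?normr0//.
rewrite subr0 sub0r normrN normrM gtr0_norm// expr2 mulrCA.
by rewrite ler_pM2l.
Qed.

Lemma csupp_C11' F F' l : C11 F F' -> csupp F -> csupp (F' l).
Proof.
move=> FF' [b Fb]; exists (b + 1) => x F'x i.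
by rewrite leNgt; apply: contra_neqN F'x => xi; exact: C11'_out FF' Fb xi.
Qed.

Section measure.
Context {mu : {measure set T -> \bar R}}.
Hypothesis leb : is_lebesgue mu.

Lemma C11_remainder F F' : C11 F F' -> csupp F -> exists K : R, 0 <= K /\
  forall l h, `|h| <= 1 ->
  intg mu (fun x => F (tadd x (tdir l h)) - F x - h * F' l x) /\
  \int[mu]_x `|F (tadd x (tdir l h)) - F x - h * F' l x| <= K * h ^+ 2.
Proof.
move=> FF' sF; have [mF mF' [C [C0 FC FC' H]]] := FF'.
have iF : intg mu F by apply: (intg_csupp leb) sF.
have iF' l : intg mu (F' l) by apply: (intg_csupp leb) (csupp_C11' l FF' sF).
have irem l h : intg mu (fun x => F (tadd x (tdir l h)) - F x - h * F' l x).
  by apply: intgB; [apply: intgB => //; exact: (intg_tadd leb)|exact: intgZ].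
have [b Fb] := sF.
(* Indicator of the cube of radius b + 1; it serves only to extract an integer box outside which the
   remainder vanishes. *)
pose G := (fun x : T => if [forall i, `|tnth x i| <= b + 1] then 1 else 0 : R).
have [n Gn] : exists n, forall x, ~ bigbox n x -> G x = 0.
  apply: mem_csupp_bigbox; exists (b + 1) => x; rewrite /G.
  by case: ifP; rewrite ?eqxx// => /forallP.
have remn l h x : `|h| <= 1 -> ~ bigbox n x ->
    F (tadd x (tdir l h)) - F x - h * F' l x = 0.
  move=> h1 /Gn; rewrite /G; case: ifP => [_ /eqP|/negbT]; first by rewrite oner_eq0.
  rewrite negb_forall => /existsP[i]; rewrite -ltNge => xi _.
  rewrite (C11'_out l FF' Fb xi) (tadd_out l Fb xi h1).
  by rewrite -[in X in 0 - X](tadd_dir0 x l) (tadd_out l Fb xi) ?normr0// mulr0 !subrr.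
have mb : measurable (bigbox n : set T) by exact: measurable_hbox.
exists (C * fine (mu (bigbox n))); split; first exact/mulr_ge0/fine_ge0.
move=> l h h1; split; first exact: irem.
rewrite mulrAC -(Rint_indic mu mb) -RintZ; last first.
  by apply: intg_indic => //; exact: mu_bigbox.
apply: le_Rint.
- exact/intg_norm/irem.
- by apply/intgZ/intg_indic => //; exact: mu_bigbox.
move=> x; have [xn|xn] := pselect (bigbox n x).
  by rewrite indicE mem_set// mulr1 H.
by rewrite remn// indicE memNset// mulr0 normr0.
Qed.

(** By translation invariance the first difference of [F] has integral zero, so h times the integral
    of [F' l] is an O(h^2) remainder. *)
Lemma Rint_partial0 F F' l : C11 F F' -> csupp F -> \int[mu]_x F' l x = 0.
Proof.
move=> FF' sF; have [K [K0 HK]] := C11_remainder FF' sF.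
have [mF mF' [C [C0 FC FC' H]]] := FF'.
have iF : intg mu F by apply: (intg_csupp leb) sF.
have iF' : intg mu (F' l) by apply: (intg_csupp leb) (csupp_C11' l FF' sF).
apply: (@norm_small_eq0 _ K) => h h0 h1.
have h1' : `|h| <= 1 by rewrite gtr0_norm.
have [irem remK] := HK l h h1'.
have : \int[mu]_x (F (tadd x (tdir l h)) - F x - h * F' l x) =
    - (h * \int[mu]_x F' l x).
  rewrite RintB; [|by apply: intgB => //; exact: (intg_tadd leb)|exact: intgZ].
  rewrite RintB; [|exact: (intg_tadd leb)|by []].
  by rewrite (Rint_tadd leb)// subrr sub0r RintZ.
have := le_trans (normr_Rint irem) remK.
move=> + E; rewrite E normrN normrM gtr0_norm// expr2 mulrCA.
by rewrite ler_pM2l.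
Qed.

Lemma Rint_by_parts phi phi' F F' l : C11 phi phi' -> csupp phi -> C11 F F' ->
  \int[mu]_x (phi' l x * F x) = - \int[mu]_x (phi x * F' l x).
Proof.
move=> cphi sphi cF.
have := Rint_partial0 l (C11M cphi cF) (csuppMl _ sphi).
have [mp mp' [C [C0 pC pC' _]]] := cphi; have [mF mF' [D [D0 FD FD' _]]] := cF.
rewrite RintD.
- by move/eqP; rewrite addr_eq0 => /eqP.
- apply: (@intg_csupp _ _ _ leb _ (C * D)).
  + exact: measurable_funM.
  + by move=> x; rewrite normrM ler_pM.
  + exact/csuppMl/(csupp_C11' _ cphi).
- apply: (@intg_csupp _ _ _ leb _ (C * D)).
  + exact: measurable_funM.
  + by move=> x; rewrite normrM ler_pM.
  + exact/csuppMl.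
Qed.

(* Difference quotients commute, so no symmetry of second derivatives is needed. *)
Lemma Rint_partial_sym phi phi' F F' k l : C11 phi phi' -> csupp phi -> C11 F F' ->
  \int[mu]_x (phi' k x * F' l x) = \int[mu]_x (phi' l x * F' k x).
Proof.
move=> cphi sphi cF; apply/eqP; rewrite -subr_eq0; apply/eqP.
have [K [K0 HK]] := C11_remainder cphi sphi.
have [mp mp' [C [C0 pC pC' _]]] := cphi; have [mF mF' [D [D0 FD FD' HF]]] := cF.
have sphi' m := csupp_C11' m cphi sphi.
have ip : intg mu phi by apply: (intg_csupp leb) sphi.
have ip' m : intg mu (phi' m) by apply: (intg_csupp leb) (sphi' m).
have iM (f g : T -> R) (B : R) : intg mu f -> measurable_fun setT g ->
    (forall x, `|g x| <= B) -> intg mu (fun x => f x * g x).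
  move=> If mg gB; rewrite (_ : (fun x => _) = fun x => g x * f x).
    exact: intgM gB If.
  by apply/funext => x; rewrite mulrC.
pose K1 := D * \int[mu]_x `|phi' k x| + D * K.
apply: (@norm_small_eq0 _ K1) => h h0 h1.
have h1' : `|h| <= 1 by rewrite gtr0_norm.
have hN1' : `|- h| <= 1 by rewrite normrN.
have [irem remK] := HK l (- h) hN1'.
pose Fh x := F (tadd x (tdir l h)); pose phih x := phi (tadd x (tdir l (- h))).
have cFh := C11_tadd (tdir l h) cF.
have cphih := C11_tadd (tdir l (- h)) cphi.
(* The shift by h e_l goes from [F] to [phi] by translation invariance, and the derivative in
   direction k goes over by parts. *)
have E1 : \int[mu]_x (phi' k x * Fh x) = - \int[mu]_x (phih x * F' k x).
  rewrite -(Rint_by_parts k cphih (csupp_tdir l (- h) sphi) cF).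
  rewrite -(Rint_tadd leb (tdir l h)
    (f := fun x => phi' k (tadd x (tdir l (- h))) * F x)).
    by apply: eq_Rintegral => x _; rewrite tadd_dir_opp.
  by apply: (iM _ _ D) => //; exact: (intg_tadd leb).
have E2 : \int[mu]_x (phi' k x * F x) = - \int[mu]_x (phi x * F' k x).
  exact: Rint_by_parts.
pose r1 x := phi' k x * (Fh x - F x - h * F' l x).
pose r2 x := (phih x - phi x - - h * phi' l x) * F' k x.
have mFh : measurable_fun setT Fh by case: cFh.
have i1 : intg mu r1.
  apply: (iM _ _ (D * h ^+ 2)) => [||x]; [exact: ip'| |exact: HF].
  by apply: measurable_funB; [exact: measurable_funB|exact: measurable_funM].
have i2 : intg mu r2 by apply: (iM _ _ D) => //; exact: irem.
(* After [E1] and [E2] the undifferentiated terms cancel; only the Taylor remainders of [F] (step h)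
   and of [phi] (step -h) are left. *)
have E : h * (\int[mu]_x (phi' k x * F' l x) - \int[mu]_x (phi' l x * F' k x)) =
    - (\int[mu]_x r1 x) - (\int[mu]_x r2 x).
  have -> : \int[mu]_x r1 x = \int[mu]_x (phi' k x * Fh x) -
     \int[mu]_x (phi' k x * F x) - h * \int[mu]_x (phi' k x * F' l x).
    rewrite -RintZ; last exact: (iM _ _ D).
    rewrite -RintB; [|apply: (iM _ _ D) => //|exact: (iM _ _ D)]; last first.
      by move=> x; exact: FD.
    rewrite -RintB; last 2 first.
    - by apply: intgB; apply: (iM _ _ D) => // x; exact: FD.
    - by apply: intgZ; exact: (iM _ _ D).
    by apply: eq_Rintegral => x _; rewrite /r1; ring.
  have -> : \int[mu]_x r2 x = \int[mu]_x (phih x * F' k x) -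
     \int[mu]_x (phi x * F' k x) + h * \int[mu]_x (phi' l x * F' k x).
    have iph : intg mu phih by exact: (intg_tadd leb).
    rewrite -RintZ; last exact: (iM _ _ D).
    rewrite -RintB; [|exact: (iM _ _ D)|exact: (iM _ _ D)].
    rewrite -RintD; last 2 first.
    - by apply: intgB; exact: (iM _ _ D).
    - by apply: intgZ; exact: (iM _ _ D).
    by apply: eq_Rintegral => x _; rewrite /r2; ring.
  by rewrite E1 E2; ring.
have hh : h ^+ 2 = h * h by rewrite expr2.
have n1 : `|\int[mu]_x r1 x| <= (D * \int[mu]_x `|phi' k x|) * h ^+ 2.
  rewrite mulrAC -RintZ; last exact: intg_norm.
  apply: normr_Rint_le => // [|x]; first exact/intgZ/intg_norm.
  by rewrite normrM mulrC ler_wpM2r// HF.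
have n2 : `|\int[mu]_x r2 x| <= (D * K) * h ^+ 2.
  rewrite -mulrA; apply: (@le_trans _ _ (D * \int[mu]_x
      `|phih x - phi x - - h * phi' l x|)); last first.
    by rewrite ler_wpM2l// (le_trans remK)// sqrrN.
  rewrite -RintZ; last exact: intg_norm.
  apply: normr_Rint_le => // [|x]; first exact/intgZ/intg_norm.
  by rewrite normrM mulrC ler_wpM2r.
rewrite -(ler_pM2l h0) -{1}(gtr0_norm h0) -normrM E mulrCA -hh /K1 mulrDl.
by apply: le_trans (ler_normB _ _) _; rewrite normrN lerD.
Qed.

End measure.
End calculus.

(** * Convolution *)

Section tonelli_sigma_finite.
Context d (T : measurableType d) (R : realType) (mu : {measure set T -> \bar R}).
Hypothesis sf : sigma_finite setT mu.

(** [mu] is a bare measure in the theorem; the structure that Tonelli asks for is built here from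
    the exhaustion by boxes, passed in as [sf]. *)
Let smu : {sigma_finite_measure set T -> \bar R} :=
  HB.pack_for (SigmaFiniteMeasure.type T R) (Measure.sort mu)
    (isSFinite.Build _ _ _ (Measure.sort mu) (sfinite_measure_sigma_finite sf))
    (isSigmaFinite.Build _ _ _ (Measure.sort mu) sf).

Lemma tonelli_swap (f : T * T -> \bar R) : measurable_fun setT f ->
  (forall z, (0 <= f z)%E) ->
  (\int[mu]_x \int[mu]_y f (x, y) = \int[mu]_y \int[mu]_x f (x, y))%E.
Proof.
move=> mf f0; exact: (@fubini_tonelli _ _ _ _ R smu smu f mf f0).
Qed.

Lemma measurable_tonelli (f : T * T -> \bar R) : measurable_fun setT f ->
  (forall z, (0 <= f z)%E) -> measurable_fun setT (fun x => \int[mu]_y f (x, y))%E.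
Proof.
move=> mf f0; exact: (@measurable_fun_fubini_tonelli_F _ _ _ _ R smu f mf f0).
Qed.

Lemma measurable_Rint_section (f : T * T -> R) : measurable_fun setT f ->
  measurable_fun setT (fun x => \int[mu]_y f (x, y)).
Proof.
move=> mf; apply: measurableT_comp => //.
pose g := EFin \o f.
have mg : measurable_fun setT g by exact/measurable_EFinP.
rewrite (_ : (fun x => _) =
    (fun x => \int[mu]_y g^\+ (x, y) - \int[mu]_y g^\- (x, y))%E); last first.
  apply/funext => x; rewrite integralE; congr (_ - _)%E;
    by apply: eq_integral => y _; rewrite /= ?funeposE ?funenegE.
apply: emeasurable_funB; apply: measurable_tonelli => //.
- exact: measurable_funepos.
- exact: measurable_funeneg.
Qed.

End tonelli_sigma_finite.

Section convolution.
Context {R : realType} {N : nat}.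
Local Notation T := (N.-tuple R).
Context {mu : {measure set T -> \bar R}}.
Hypothesis leb : is_lebesgue mu.

Definition conv (g u : T -> R) (x : T) : R := \int[mu]_y (g (tsub x y) * u y).

Lemma intg_conv_section (g u : T -> R) (C : R) x : measurable_fun setT g ->
  (forall z, `|g z| <= C) -> intg mu u -> intg mu (fun y => g (tsub x y) * u y).
Proof.
move=> mg gC iu; apply: (@intgM _ _ _ _ _ _ C) => //.
exact: measurableT_comp (measurable_tsubl x).
Qed.

Lemma measurable_conv_kernel (g u : T -> R) : measurable_fun setT g ->
  measurable_fun setT u ->
  measurable_fun setT (fun z : T * T => g (tsub z.1 z.2) * u z.2).
Proof.
move=> mg mu'; apply: measurable_funM.
  exact: measurableT_comp measurable_tsub.
exact: measurableT_comp.
Qed.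

Lemma measurable_conv (g u : T -> R) : measurable_fun setT g -> measurable_fun setT u ->
  measurable_fun setT (conv g u).
Proof.
move=> mg mu'.
exact: (measurable_Rint_section (lebesgue_sigma_finite leb)
  (measurable_conv_kernel mg mu')).
Qed.

(** The Taylor remainder of the convolution is the convolution with the Taylor remainder of [g],
    hence at most C h^2 times the L^1 norm of [u]; no limit is exchanged with an integral. *)
Lemma C11_conv g g' u : C11 g g' -> intg mu u ->
  C11 (conv g u) (fun l => conv (g' l) u).
Proof.
move=> [mg mg' [C [C0 gC gC' H]]] iu; have mu' := intg_measurable iu.
split; [exact: measurable_conv|by move=> l; exact: measurable_conv|].
have iun := intg_norm iu.
have nu0 : 0 <= \int[mu]_x `|u x| by apply: Rintegral_ge0.
have bnd (k : T -> R) (D : R) x : measurable_fun setT k -> (forall z, `|k z| <= D) ->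
    `|conv k u x| <= D * \int[mu]_x `|u x|.
  move=> mk kD; rewrite -RintZ//; apply: normr_Rint_le.
  - exact: intg_conv_section kD iu.
  - exact: intgZ.
  - by move=> y; rewrite normrM ler_wpM2r.
exists (C * \int[mu]_x `|u x|); split=> [|x|l x|l x h h1].
- exact: mulr_ge0.
- exact: bnd.
- exact: bnd.
have ik (k : T -> R) z : measurable_fun setT k -> (forall z, `|k z| <= C) ->
    intg mu (fun y => k (tsub z y) * u y).
  by move=> mk kC; exact: intg_conv_section kC iu.
rewrite /conv -RintZ; last exact: ik.
rewrite -RintB; [|exact: ik|exact: ik].
rewrite -RintB; last 2 first.
- by apply: intgB; exact: ik.
- by apply: intgZ; exact: ik.
rewrite mulrAC -RintZ//; apply: normr_Rint_le.
- by apply: intgB; [apply: intgB; exact: ik|apply: intgZ; exact: ik].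
- exact: intgZ.
move=> y; rewrite tsub_taddl.
rewrite (_ : _ - _ = (g (tadd (tsub x y) (tdir l h)) - g (tsub x y) -
   h * g' l (tsub x y)) * u y); last ring.
by rewrite normrM ler_wpM2r// H.
Qed.

Lemma intg_tsub (g : T -> R) (x : T) : intg mu g -> intg mu (fun y => g (tsub y x)).
Proof.
move=> ig; rewrite (_ : (fun y => _) = fun y => g (tadd y (tsub (tcst 0) x))).
  exact: (intg_tadd leb).
apply/funext => y; congr g; apply: eq_from_tnth => i.
by rewrite !(tnth_tadd, tnth_tsub) tnth_mktuple sub0r.
Qed.

(** Young's inequality for L^1 by Tonelli. Boundedness of [g] makes the convolution integral
    converge at every point, not only almost everywhere. *)
Lemma conv_L1 (g u : T -> R) (C : R) : measurable_fun setT g -> (forall z, `|g z| <= C) ->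
  intg mu g -> intg mu u ->
  intg mu (conv g u) /\
  \int[mu]_x `|conv g u x| <= (\int[mu]_x `|g x|) * \int[mu]_x `|u x|.
Proof.
move=> mg gC ig iu; have mu' := intg_measurable iu.
have mk := measurable_conv_kernel mg mu'.
have mc := measurable_conv mg mu'.
have key : (\int[mu]_x `|(conv g u x)%:E| <=
    ((\int[mu]_x `|g x|) * (\int[mu]_x `|u x|))%:E)%E.
  apply: (@le_trans _ _ (\int[mu]_x \int[mu]_y `|(g (tsub x y) * u y)%:E|)%E).
    apply: ge0_le_integral => //.
    - exact/measurableT_comp/measurable_EFinP.
    - apply: (measurable_tonelli (lebesgue_sigma_finite leb)
        (f := fun z : T * T => `|(g (tsub z.1 z.2) * u z.2)%:E|%E)) => //.
      exact/measurableT_comp/measurable_EFinP.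
    - move=> x _.
      have ix := intg_conv_section x mg gC iu.
      rewrite -[leLHS]/(`|conv g u x|%:E) /conv EFin_normr_Rintegral//.
      apply: le_abse_integral => //.
      by apply/measurable_EFinP; exact: intg_measurable ix.
  rewrite (tonelli_swap (lebesgue_sigma_finite leb)
    (f := fun z : T * T => `|(g (tsub z.1 z.2) * u z.2)%:E|%E)) //=; last first.
    exact/measurable_EFinP/measurableT_comp.
  rewrite (eq_integral (fun y => (\int[mu]_x `|g x|)%:E * `|u y|%:E))%E; last first.
    move=> y _ /=.
    have ign : intg mu (fun x => `|g (tsub x y)|) by exact/intg_norm/intg_tsub.
    rewrite (eq_integral (fun x => `|u y|%:E * `|g (tsub x y)|%:E))%E; last first.
      by move=> x _; rewrite -EFinM normrM mulrC.
    rewrite integralZl// muleC; congr (_ * _)%E.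
    rewrite EFin_Rint; last exact: intg_norm.
    rewrite -(ge0_integral_tadd leb (tsub (tcst 0) y) (f := fun x => `|g x|%:E))//.
      apply: eq_integral => x _; congr (`|g _|%:E); apply: eq_from_tnth => i.
      by rewrite !(tnth_tadd, tnth_tsub) tnth_mktuple sub0r.
    exact/measurable_EFinP/measurableT_comp.
  rewrite integralZl//; last exact: intg_norm.
  by rewrite EFinM [X in (_ <= _ * X)%E](EFin_Rint (intg_norm iu)).
have ic : intg mu (conv g u).
  apply/integrableP; split; first exact/measurable_EFinP.
  exact: le_lt_trans key (ltry _).
by split=> //; rewrite -lee_fin EFin_Rint//; exact: intg_norm.
Qed.

Lemma Rint_tsub_const (g : T -> R) (C : R) x : measurable_fun setT g ->
  (forall z, `|g z| <= C) -> csupp g ->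
  \int[mu]_y g (tsub x y) = \int[mu]_y g (tsub (tcst 0) y).
Proof.
move=> mg gC [b gb].
have ig : intg mu (fun y => g (tsub x y)).
  apply: (intg_csupp leb (C := C)) => //.
    exact: measurableT_comp (measurable_tsubl x).
  exists (b + \sum_(i < N) `|tnth x i|) => y /gb H i.
  rewrite (_ : tnth y i = tnth x i - tnth (tsub x y) i); last first.
    by rewrite tnth_tsub; ring.
  rewrite [leRHS]addrC (le_trans (ler_normB _ _))// lerD//.
  by rewrite (bigD1 i)//= lerDl sumr_ge0.
rewrite -(Rint_tadd leb x (f := fun y => g (tsub x y)))//.
apply: eq_Rintegral => y _; congr g; apply: eq_from_tnth => i.
by rewrite !(tnth_tadd, tnth_tsub) tnth_mktuple; ring.
Qed.

(** The support of the kernel is one-sided: x - y in [0, t]^N puts y in [x - t, x], which the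
    half-open cube contains, boundary included. *)
Lemma conv_le_cube (g u : T -> R) (C t : R) x : 0 < t -> measurable_fun setT g ->
  (forall z, `|g z| <= C) ->
  (forall z, g z != 0 -> forall i, 0 <= tnth z i <= t) -> intg mu u ->
  `|conv g u x| <= C * \int[mu]_y (\1_(cube x t) y * `|u y|).
Proof.
move=> t0 mg gC gt iu.
have i1 : intg mu (fun y => \1_(cube x t) y * `|u y|).
  apply: (@intgM _ _ _ _ _ _ 1); last exact: intg_norm.
    by apply: measurable_indic; exact: measurable_hbox.
  by move=> y; rewrite indicE; case: (_ \in _); rewrite ?normr1 ?normr0.
rewrite -RintZ//; apply: normr_Rint_le.
- exact: intg_conv_section gC iu.
- exact: intgZ.
move=> y; rewrite normrM.
have [->|g0] := eqVneq (g (tsub x y)) 0.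
  have C0 : 0 <= C := le_trans (normr_ge0 _) (gC (tsub x y)).
  by rewrite normr0 mul0r; apply: mulr_ge0 => //; exact: mulr_ge0.
rewrite indicE mem_set; first by rewrite mul1r ler_wpM2r.
apply/cubeE => i; have := gt _ g0 i; rewrite tnth_tsub => /andP[a b].
by apply/andP; split; lra.
Qed.

Lemma conv_local (g u w : T -> R) (t : R) x : 0 < t ->
  (forall z, g z != 0 -> forall i, 0 <= tnth z i <= t) ->
  (forall y, cube x t y -> u y = w y) -> conv g u x = conv g w x.
Proof.
move=> t0 gt uw; apply: eq_Rintegral => y _.
have [->|g0] := eqVneq (g (tsub x y)) 0; first by rewrite !mul0r.
rewrite uw//; apply/cubeE => i; have := gt _ g0 i; rewrite tnth_tsub => /andP[a b].
by apply/andP; split; lra.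
Qed.

End convolution.
Arguments conv {R N} mu g u x.

(** * Approximate identities *)

Section eventually_equal.
Context d (T : measurableType d) (R : realType) (mu : {measure set T -> \bar R}).

(** Dominated convergence for pointwise eventually constant sequences, which covers both the
    exhaustion of sets and the behaviour of v_K on the union of the bad sets. *)
Lemma Rint_eventually_eq (f_ : nat -> T -> R) (f g : T -> R) :
  (forall n, measurable_fun setT (f_ n)) -> measurable_fun setT f -> intg mu g ->
  (forall n x, `|f_ n x| <= g x) ->
  (forall x, exists n0, forall n, (n0 <= n)%N -> f_ n x = f x) ->
  intg mu f /\ forall e : R, 0 < e -> exists K, forall k, (K <= k)%N ->
    \int[mu]_x `|f_ k x - f x| <= e.
Proof.
move=> mf_ mf ig fg fE.
have fgx x : `|f x| <= g x.
  by have [n0 /(_ n0 (leqnn _)) <-] := fE x.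
have iff : intg mu f by exact: intg_le fgx.
split=> // e e0.
have [||_ /= cv _] := @dominated_convergence _ T R mu setT measurableT
  (fun n x => (f_ n x)%:E) (EFin \o f) (EFin \o g)
  (fun n => (measurable_EFinP _ _).2 (mf_ n)) ((measurable_EFinP _ _).2 mf) _ ig.
- apply: aeW => x _; have [n0 H] := fE x.
  apply: cvg_near_cst; near=> n; rewrite H//; near: n; exact: nbhs_infty_ge.
- by apply: aeW => x n _ /=; rewrite lee_fin.
move/fine_cvg : cv => /cvgrPdist_le /(_ e e0)[K _ HK].
exists K => k /HK /=; rewrite sub0r normrN; apply: le_trans.
by apply: le_trans (ler_norm _); rewrite /Rintegral /=.
Unshelve. all: by end_near. Qed.

End eventually_equal.

Section approximate_identity.
Context {R : realType} {N : nat}.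
Local Notation T := (N.-tuple R).
Context {mu : {measure set T -> \bar R}}.
Hypothesis leb : is_lebesgue mu.
Variables (g : nat -> T -> R) (G t : nat -> R) (D c : R).
Hypothesis mg : forall k, measurable_fun setT (g k).
Hypothesis gG : forall k z, `|g k z| <= G k.
Hypothesis t_gt0 : forall k, 0 < t k.
Hypothesis tcvg : t @ \oo --> (0 : R).
Hypothesis gt : forall k z, g k z != 0 -> forall i, 0 < tnth z i < t k.
Hypothesis GD : forall k, G k * (2 * t k) ^+ N <= D.
Hypothesis gc : forall k x, \int[mu]_y g k (tsub x y) = c.

Let err k u := \int[mu]_x `|conv mu (g k) u x - c * u x|.

(** The functions for which the claim holds form a class stable under sums, multiples and L^1
    limits. It is shown to contain indicators of boxes, then of measurable sets, then simple
    functions, then all of L^1. *)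
Let good u := forall e : R, 0 < e -> exists K, forall k, (K <= k)%N -> err k u <= e.

Let t0 k : 0 <= t k.
Proof. exact: ltW. Qed.

Let gtW k z : g k z != 0 -> forall i, 0 <= tnth z i <= t k.
Proof. by move=> /gt H i; have /andP[/ltW -> /ltW ->] := H i. Qed.

Let G0 k : 0 <= G k.
Proof. exact: le_trans (normr_ge0 _) (gG k (tcst 0)). Qed.

Let D0 : 0 <= D.
Proof. by apply: le_trans (GD 0%N); rewrite mulr_ge0// exprn_ge0// mulr_ge0. Qed.

Let csg k : csupp (g k).
Proof.
exists (t k) => z /gt H i; have /andP[a b] := H i.
by rewrite gtr0_norm// ltW.
Qed.

Let ig k : intg mu (g k).
Proof. exact: (intg_csupp leb (mg k) (gG k) (csg k)). Qed.

Let normg k : \int[mu]_x `|g k x| <= D.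
Proof.
apply: le_trans (GD k).
have <- : fine (mu (cube (tcst 0) (t k))) = (2 * t k) ^+ N.
  by rewrite (mu_cube leb).
have mcb : measurable (cube (tcst 0) (t k) : set T) by exact: measurable_hbox.
have icb : intg mu (\1_(cube (tcst 0) (t k)) : T -> R).
  by apply: intg_indic => //; rewrite (mu_cube leb)// ltry.
rewrite -(Rint_indic mu mcb) -RintZ//.
apply: le_Rint; [exact: intg_norm|exact: intgZ|move=> x].
have [->|g0] := eqVneq (g k x) 0; first by rewrite normr0 mulr_ge0.
rewrite indicE mem_set ?mulr1//.
apply/cubeE => i; rewrite tnth_mktuple; have /andP[a b] := gt g0 i.
by rewrite sub0r add0r b andbT (le_trans _ (ltW a))// oppr_le0.
Qed.

Let convL k u : intg mu u -> intg mu (conv mu (g k) u) /\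
  \int[mu]_x `|conv mu (g k) u x| <= D * \int[mu]_x `|u x|.
Proof.
move=> iu; have [a b] := conv_L1 leb (mg k) (gG k) (ig k) iu.
split=> //; apply: le_trans b _; rewrite ler_wpM2r//.
exact: Rintegral_ge0.
Qed.

Let convD k u w x : intg mu u -> intg mu w ->
  conv mu (g k) (fun y => u y + w y) x = conv mu (g k) u x + conv mu (g k) w x.
Proof.
move=> iu iw; rewrite /conv -RintD.
- by apply: eq_Rintegral => y _; rewrite mulrDr.
- exact: intg_conv_section (gG k) iu.
- exact: intg_conv_section (gG k) iw.
Qed.

Let convZ k u (a : R) x : intg mu u ->
  conv mu (g k) (fun y => a * u y) x = a * conv mu (g k) u x.
Proof.
move=> iu; rewrite /conv -RintZ.
- by apply: eq_Rintegral => y _; rewrite mulrCA.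
- exact: intg_conv_section (gG k) iu.
Qed.

Let ierr k u : intg mu u -> intg mu (fun x => conv mu (g k) u x - c * u x).
Proof. by move=> iu; apply: intgB; [case: (convL k iu)|exact: intgZ]. Qed.

Let errD k u w : intg mu u -> intg mu w ->
  err k (fun x => u x + w x) <= err k u + err k w.
Proof.
move=> iu iw; rewrite /err -RintD; [|exact/intg_norm/ierr|exact/intg_norm/ierr].
apply: le_Rint.
- by apply/intg_norm/ierr; exact: intgD.
- by apply: intgD; exact/intg_norm/ierr.
- move=> x; rewrite convD// (_ : _ - _ = (conv mu (g k) u x - c * u x) +
    (conv mu (g k) w x - c * w x)); last ring.
  exact: ler_normD.
Qed.

Let err_norm k u : intg mu u -> err k u <= (D + `|c|) * \int[mu]_x `|u x|.
Proof.
move=> iu; have [ic cD] := convL k iu.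
apply: (@le_trans _ _ (\int[mu]_x (`|conv mu (g k) u x| + `|c| * `|u x|))).
  apply: le_Rint.
  - exact/intg_norm/ierr.
  - by apply: intgD; [exact: intg_norm|exact/intgZ/intg_norm].
  - by move=> x; rewrite -normrM ler_normB.
rewrite RintD; [|exact: intg_norm|exact/intgZ/intg_norm].
by rewrite RintZ ?mulrDl ?lerD//; exact: intg_norm.
Qed.

Let goodD u w : intg mu u -> intg mu w -> good u -> good w ->
  good (fun x => u x + w x).
Proof.
move=> iu iw gu gw e e0.
have [K1 H1] := gu (e / 2) ltac:(lra); have [K2 H2] := gw (e / 2) ltac:(lra).
exists (maxn K1 K2) => k; rewrite geq_max => /andP[k1 k2].
apply: le_trans (errD k iu iw) _.
by have := H1 k k1; have := H2 k k2; lra.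
Qed.

Let goodZ (a : R) u : intg mu u -> good u -> good (fun x => a * u x).
Proof.
move=> iu gu e e0.
have a0 : 0 < `|a| + 1 by rewrite ltr_wpDl.
have [K HK] := gu (e / (`|a| + 1)) (divr_gt0 e0 a0).
exists K => k /HK H.
have -> : err k (fun x => a * u x) = `|a| * err k u.
  rewrite /err -RintZ; last exact/intg_norm/ierr.
  by apply: eq_Rintegral => x _; rewrite convZ// -normrM; congr `|_|; ring.
apply: (@le_trans _ _ ((`|a| + 1) * (e / (`|a| + 1)))); last first.
  by rewrite mulrCA divff ?mulr1// gt_eqF.
have : 0 <= err k u by exact: Rintegral_ge0.
by move=> h0; rewrite ler_pM// lerDl.
Qed.

Let good0 : good (fun=> 0).
Proof.
move=> e e0; exists 0%N => k _.
have -> : err k (fun=> 0) = 0; last exact: ltW.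
rewrite -[RHS](Rint0 mu); apply: eq_Rintegral => x _.
rewrite mulr0 subr0 /conv (_ : Rintegral _ _ _ = 0) ?normr0//.
by rewrite -[RHS](Rint0 mu); apply: eq_Rintegral => y _; rewrite mulr0.
Qed.

Let good_lim u : intg mu u ->
  (forall e : R, 0 < e -> exists w, [/\ intg mu w, good w &
     \int[mu]_x `|w x - u x| <= e]) -> good u.
Proof.
move=> iu H e e0; pose M := D + `|c| + 1.
have M0 : 0 < M by rewrite /M ltr_wpDl// addr_ge0.
have [w [iw gw wu]] := H (e / 2 / M) ltac:(by rewrite !divr_gt0).
have [K HK] := gw (e / 2) ltac:(lra); exists K => k /HK Hk.
have iuw : intg mu (fun x => u x - w x) by exact: intgB.
have -> : u = (fun x => w x + (u x - w x)) by apply/funext => x; ring.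
apply: le_trans (errD k iw iuw) _.
rewrite (_ : e = e / 2 + e / 2); last lra.
apply: lerD => //; apply: le_trans (err_norm k iuw) _.
apply: (@le_trans _ _ (M * (e / 2 / M))); last first.
  by rewrite mulrCA divff ?mulr1// gt_eqF.
apply: ler_pM => //.
- by rewrite addr_ge0.
- exact: Rintegral_ge0.
- by rewrite /M lerDl.
- apply: le_trans wu; rewrite le_eqVlt; apply/orP; left; apply/eqP.
  by apply: eq_Rintegral => x _; rewrite distrC.
Qed.

Let mindic (A : set T) : measurable A -> measurable_fun setT (\1_A : T -> R).
Proof. exact: measurable_indic. Qed.

(** The mollified indicator is exact off the shell between the box shrunk and the box enlarged by
    t_k. On the shell the error is at most D + |c|, and the shell has vanishing measure. *)
Let good_hbox (a b : T) : good (\1_(hbox a b)).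
Proof.
have [/forallP ab|] := boolP [forall i, tnth a i < tnth b i]; last first.
  rewrite negb_forall => /existsP[i]; rewrite -leNgt => ba.
  have -> : hbox a b = set0.
    by apply/seteqP; split=> // x /(_ i) /andP[H1 H2]; lra.
  by rewrite indic0; exact: good0.
have mQ := measurable_hbox a b; set Q := hbox a b.
have iQ : intg mu (\1_Q : T -> R).
  by apply: intg_indic => //; rewrite (mu_hbox leb) ?ltry// => i; exact: ltW.
pose M := D + `|c|.
have M0 : 0 <= M by rewrite addr_ge0.
(* The outer and inner boxes have measures q(2 t_k) and q(-2 t_k), so continuity of one polynomial
   at 0 gives the measure of the shell. *)
pose q : {poly R} := \prod_(i < N) ('X + (tnth b i - tnth a i)%:P).
pose out k := hbox [tuple tnth a i - t k | i < N] [tuple tnth b i + t k | i < N].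
pose inn k := hbox [tuple tnth a i + t k | i < N] [tuple tnth b i - t k | i < N].
have muout k : mu (out k) = (q.[2 * t k])%:E.
  rewrite (mu_hbox leb); last first.
    by move=> i; rewrite !tnth_mktuple; have := ab i; have := t0 k; lra.
  congr EFin; rewrite horner_prod; apply: eq_bigr => i _.
  by rewrite hornerD hornerX hornerC !tnth_mktuple; ring.
have muinn k : (forall i, tnth a i + t k <= tnth b i - t k) ->
    mu (inn k) = (q.[- (2 * t k)])%:E.
  move=> H; rewrite (mu_hbox leb); last by move=> i; rewrite !tnth_mktuple.
  congr EFin; rewrite horner_prod; apply: eq_bigr => i _.
  by rewrite hornerD hornerX hornerC !tnth_mktuple; ring.
have iout k : intg mu (\1_(out k) : T -> R).
  by apply: intg_indic; [exact: measurable_hbox|rewrite muout ltry].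
have bound k : (forall i, tnth a i + t k <= tnth b i - t k) ->
    err k (\1_Q) <= M * (q.[2 * t k] - q.[- (2 * t k)]).
  move=> H.
  have iinn : intg mu (\1_(inn k) : T -> R).
    by apply: intg_indic; [exact: measurable_hbox|rewrite muinn// ltry].
  have -> : q.[2 * t k] - q.[- (2 * t k)] =
      \int[mu]_x (\1_(out k) x - \1_(inn k) x).
    rewrite RintB// !Rint_indic; [|exact: measurable_hbox|exact: measurable_hbox].
    by rewrite muout muinn.
  rewrite -RintZ; last exact: intgB.
  apply: le_Rint.
  - exact/intg_norm/ierr.
  - by apply/intgZ/intgB.
  move=> x.
  have cD : `|conv mu (g k) \1_Q x| <= D.
    apply: le_trans (GD k).
    apply: le_trans (conv_le_cube x (t_gt0 k) (mg k) (gG k) (@gtW k) iQ) _.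
    rewrite ler_wpM2l//.
    have <- : fine (mu (cube x (t k))) = (2 * t k) ^+ N by rewrite (mu_cube leb).
    have mcb : measurable (cube x (t k)) by exact: measurable_hbox.
    have icb : intg mu (\1_(cube x (t k)) : T -> R).
      by apply: intg_indic => //; rewrite (mu_cube leb)// ltry.
    rewrite -(Rint_indic mu mcb); apply: le_Rint => //.
      apply: (@intgM _ _ _ _ _ _ 1); [exact: mindic| |exact: intg_norm].
      by move=> y; rewrite indicE; case: (_ \in _); rewrite ?normr1 ?normr0.
    move=> y; rewrite -[leRHS]mulr1 ler_wpM2l//.
    by rewrite indicE; case: (_ \in _); rewrite ?normr1 ?normr0.
  have [xi|xi] := pselect (inn k x).
    have xQ : Q x.
      by move=> i; have := xi i; rewrite !tnth_mktuple; have := t0 k; lra.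
    have xo : out k x.
      by move=> i; have := xi i; rewrite !tnth_mktuple; have := t0 k; lra.
    rewrite !indicE !mem_set// subrr mulr0 mulr1.
    rewrite (_ : conv _ _ _ _ = c) ?subrr ?normr0//.
    rewrite /conv -(gc k x); apply: eq_Rintegral => y _.
    have [->|g0] := eqVneq (g k (tsub x y)) 0; first by rewrite mul0r.
    rewrite indicE mem_set ?mulr1// => i.
    have := gt g0 i; rewrite tnth_tsub; have := xi i; rewrite !tnth_mktuple; lra.
  have [xo|xo] := pselect (out k x).
    rewrite !indicE (mem_set xo) (memNset xi) subr0 mulr1.
    apply: le_trans (ler_normB _ _) _; apply: lerD => //.
    by rewrite normrM -[leRHS]mulr1 ler_wpM2l//; case: (_ \in _); rewrite ?normr1 ?normr0.
  have xQ : ~ Q x.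
    move=> xQ; apply: xo => i; rewrite !tnth_mktuple.
    by have := xQ i; have := t0 k; lra.
  rewrite !indicE (memNset xo) (memNset xi) (memNset xQ) !(subrr, mulr0) subr0.
  rewrite (_ : conv _ _ _ _ = 0) ?normr0//.
  rewrite /conv -[RHS](Rint0 mu); apply: eq_Rintegral => y _.
  have [->|g0] := eqVneq (g k (tsub x y)) 0; first by rewrite mul0r.
  rewrite indicE memNset ?mulr0// => Qy; apply: xo => i.
  have := gt g0 i; rewrite tnth_tsub; have := Qy i; rewrite !tnth_mktuple; lra.
have cv : (fun k => M * (q.[2 * t k] - q.[- (2 * t k)])) @ \oo --> (0 : R).
  have c2 : (fun k => 2 * t k) @ \oo --> (0 : R).
    by rewrite -[X in _ --> X](mulr0 2); apply: cvgMr.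
  have c2N : (fun k => - (2 * t k)) @ \oo --> (0 : R).
    by rewrite -[X in _ --> X]oppr0; exact: cvgN.
  rewrite -[X in _ --> X](mulr0 M); apply: cvgMr.
  rewrite -[X in _ --> X](subrr q.[0]); apply: cvgB.
    by apply: (cvg_comp _ _ c2); exact: continuous_horner.
  by apply: (cvg_comp _ _ c2N); exact: continuous_horner.
have tsm : exists K, forall k, (K <= k)%N -> forall i, tnth a i + t k <= tnth b i - t k.
  have : \forall k \near \oo, forall i, tnth a i + t k <= tnth b i - t k.
    apply: filter_forall => i.
    have h0 : 0 < (tnth b i - tnth a i) / 2 by have := ab i; lra.
    move/cvgrPdist_le : tcvg => /(_ _ h0); apply: filterS => k.
    by rewrite sub0r normrN ger0_norm//; lra.
  by move=> [K _ HK]; exists K => k /HK.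
move=> e e0; have [K1 HK1] := tsm.
move/cvgrPdist_le : cv => /(_ _ e0)[K2 _ HK2].
exists (maxn K1 K2) => k; rewrite geq_max => /andP[k1 k2].
apply: le_trans (bound k (HK1 _ k1)) _.
by have := HK2 k k2; rewrite /= sub0r normrN => /(le_trans (ler_norm _)).
Qed.

(** Dynkin induction relative to a fixed box, whose finite measure makes complements and countable
    disjoint unions integrable. *)
Let good_bounded n (A : set T) : measurable A -> good (\1_(A `&` bigbox n)).
Proof.
have mB : measurable (bigbox n : set T) by exact: measurable_hbox.
have ifin (A' : set T) : measurable A' -> intg mu (\1_(A' `&` bigbox n) : T -> R).
  move=> mA'; apply: intg_indic; first exact: measurableI.
  apply: le_lt_trans (mu_bigbox leb n); apply: le_measure; rewrite ?inE//.
  exact: measurableI.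
have iB : intg mu (\1_(bigbox n) : T -> R).
  by apply: intg_indic => //; exact: (mu_bigbox leb).
rewrite measurable_tupleE; move: A.
apply: (dynkin_induction measurable_tupleE hboxes_setI
  (P := [set A | good (\1_(A `&` bigbox n))])).
- by rewrite /= setTI; exact: good_hbox.
- move=> A HA /=; have [a [b ->]] : hboxes (A `&` bigbox n).
    by apply: hboxes_setI => //; eexists; eexists; reflexivity.
  exact: good_hbox.
- move=> A mA /= gA.
  rewrite (_ : \1_ _ = fun x => \1_(bigbox n) x + (-1) * \1_(A `&` bigbox n) x); last first.
    apply/funext => x; rewrite !indicE !in_setI in_setC.
    by case: (x \in A); case: (x \in bigbox n); rewrite /= ?mulr0 ?addr0 ?mulN1r ?subrr.
  apply: goodD; [|exact/intgZ/ifin| |].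
  - exact: iB.
  - exact: good_hbox.
  - by apply: goodZ => //; exact: ifin.
- move=> F mF tF gF /=.
  pose U m := \big[setU/set0]_(i < m) F i.
  have mU m : measurable (U m) by apply: bigsetU_measurable.
  have gU m : good (\1_(U m `&` bigbox n)).
    elim: m => [|m IH].
      by rewrite /U big_ord0 set0I indic0; exact: good0.
    rewrite (_ : \1_ _ = fun x => \1_(U m `&` bigbox n) x + \1_(F m `&` bigbox n) x).
      by apply: goodD; [exact: ifin|exact: ifin|exact: IH|exact: gF].
    apply/funext => x; rewrite /U big_ord_recr /= setIUl indicE in_setU !indicE.
    have : ~ ((\big[setU/set0]_(i < m) F i) x /\ F m x).
      rewrite -bigcup_mkord => -[[i /= im Fi] Fm].
      have E : i = m by apply: (tF i m Logic.I Logic.I); exists x.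
      by rewrite E ltnn in im.
    rewrite !in_setI.
    have [/set_mem xU|_] := boolP (x \in \big[setU/set0]_(i < m) F i);
    have [/set_mem xF|_] := boolP (x \in F m) => H //=; rewrite ?orbF ?addr0 ?add0r//.
    by exfalso; apply: H.
  apply: good_lim; first exact/ifin/bigcup_measurable.
  move=> e e0.
  have [|||||_ /(_ e e0)[K HK]] := @Rint_eventually_eq _ T R mu
    (fun m => \1_(U m `&` bigbox n)) (\1_((\bigcup_k F k) `&` bigbox n))
    (\1_(bigbox n)).
  - by move=> m; apply: mindic; exact: measurableI.
  - by apply: mindic; apply: measurableI => //; exact: bigcup_measurable.
  - exact: iB.
  - move=> m x; rewrite !indicE in_setI; case: (x \in bigbox n); rewrite ?andbF ?normr0//.
    by case: (_ \in _); rewrite ?normr1 ?normr0.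
  - move=> x; have [[i _ Fix]|nF] := pselect ((\bigcup_k F k) x).
      exists i.+1 => m im; rewrite !indicE !in_setI (mem_set (A := \bigcup_k F k)); last by exists i.
      by rewrite mem_set// /U -bigcup_mkord; exists i.
    exists 0%N => m _; rewrite !indicE !in_setI (memNset nF) memNset//.
    by rewrite /U -bigcup_mkord => -[i _ Fix]; apply: nF; exists i.
  by exists (\1_(U K `&` bigbox n)); split; [exact: ifin|exact: gU|exact: HK].
Qed.

Let good_indic (A : set T) : measurable A -> intg mu (\1_A : T -> R) ->
  good (\1_A).
Proof.
move=> mA iA; apply: good_lim => // e e0.
have mAn n : measurable (A `&` bigbox n) by apply: measurableI => //; exact: measurable_hbox.
have [|||||_ /(_ e e0)[K HK]] := @Rint_eventually_eq _ T R mu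
    (fun m => \1_(A `&` bigbox m)) (\1_A) (\1_A).
- by move=> m; apply: mindic.
- exact: mindic.
- exact: iA.
- move=> m x; rewrite !indicE in_setI.
  by case: (x \in A); case: (_ \in _); rewrite ?normr1 ?normr0.
- move=> x; have : setT x by [].
  rewrite -bigbox_cover => -[n _ /bigboxP xn]; exists n => m nm.
  rewrite !indicE in_setI (mem_set (A := bigbox m)) ?andbT//.
  apply/bigboxP => i; have := xn i; have : (n%:R <= m%:R :> R) by rewrite ler_nat.
  by lra.
exists (\1_(A `&` bigbox K)); split; last exact: HK.
  apply: intg_le iA _; first exact: mindic.
  move=> x; rewrite !indicE in_setI.
  by case: (x \in A); case: (_ \in _); rewrite ?normr1 ?normr0.
exact: good_bounded.
Qed.

Import HBSimple.

Lemma approximate_identity_L1 u : intg mu u ->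
  forall e : R, 0 < e -> exists K, forall k, (K <= k)%N ->
    \int[mu]_x `|conv mu (g k) u x - c * u x| <= e.
Proof.
move=> iu; apply: good_lim => // e e0.
have [s [is_ _ cs]] := approximation_sfun_integrable measurableT iu.
move/fine_cvg : cs => /cvgrPdist_le /(_ e e0)[K _ /(_ K (leqnn K))] /=.
rewrite sub0r normrN => HK; exists (s K); split; first exact: is_.
- have sE : (s K : T -> R) = fun x => \sum_(y <- finmap.enum_fset (fset_set (range (s K))))
      y * \1_(s K @^-1` [set y]) x.
    by apply/funext => x; rewrite fimfunE fsbig_finite.
  (* Only level sets of nonzero values are known to have finite measure; the term of the value 0 is
     the zero function and is treated apart. *)
  have iy (y : R) : y != 0 -> intg mu (\1_(s K @^-1` [set y]) : T -> R).
    move=> y0; apply: (@intg_le _ _ _ _ _ (fun x => `|y|^-1 * `|s K x|)).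
    - by apply: mindic; exact: measurable_sfunP.
    - by apply/intgZ/intg_norm; exact: is_.
    - move=> x; rewrite indicE; have [/set_mem /= ->|_] := boolP (_ \in _).
        by rewrite normr1 mulVf// normr_eq0.
      by rewrite normr0 mulr_ge0// invr_ge0.
  have gy (y : R) : intg mu (fun x => y * \1_(s K @^-1` [set y]) x) /\
      good (fun x => y * \1_(s K @^-1` [set y]) x).
    have [->|y0] := eqVneq y 0.
      rewrite (_ : (fun x => _) = fun=> 0); last by apply/funext => x; rewrite mul0r.
      by split; [exact: intg0|exact: good0].
    split; first exact/intgZ/iy.
    apply: goodZ; first exact: iy.
    by apply: good_indic; [exact: measurable_sfunP|exact: iy].
  rewrite sE; elim: (finmap.enum_fset _) => [|y r IH].
    rewrite (_ : (fun x => _) = fun x => 0 * \1_(s K @^-1` [set 0]) x).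
      by case: (gy 0).
    by apply/funext => x; rewrite big_nil mul0r.
  rewrite (_ : (fun x => _) = fun x => y * \1_(s K @^-1` [set y]) x +
     \sum_(z <- r) z * \1_(s K @^-1` [set z]) x); last first.
    by apply/funext => x; rewrite big_cons.
  apply: goodD => //; [by case: (gy y)| |by case: (gy y)].
  by apply: intg_sum => z _; case: (gy z).
- apply: le_trans HK; apply: le_trans (ler_norm _).
  rewrite /Rintegral le_eqVlt; apply/orP; left; apply/eqP; congr fine.
  by apply: eq_integral => x _; rewrite distrC.
Qed.

End approximate_identity.

(** * Test functions *)

Section grid.
Context {R : realType} {N : nat}.
Local Notation T := (N.-tuple R).

(** Index of the grid cell of side 1/a containing [x]. With a = 2^j these are the dyadic cubes of
    the stopping argument; with a = m + 1 they carry the step functions that show continuous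
    functions to be measurable. *)
Definition gcell (a : R) (x : T) : N.-tuple int := [tuple Num.floor (a * tnth x i) | i < N].

Definition dcube (a : R) (z : N.-tuple int) : set T := [set x | gcell a x = z].

Lemma dcubeE (a : R) (z : N.-tuple int) : 0 < a ->
  dcube a z = hbox [tuple (tnth z i)%:~R / a | i < N] [tuple (tnth z i + 1)%:~R / a | i < N].
Proof.
move=> a0; apply/seteqP; split=> x.
  move=> <- i; rewrite !tnth_mktuple ler_pdivrMr// ltr_pdivlMr// ![_ * a]mulrC.
  exact: floor_itv.
move=> H; apply: eq_from_tnth => i; rewrite !tnth_mktuple.
apply: floor_def; have := H i.
by rewrite !tnth_mktuple ler_pdivrMr// ltr_pdivlMr// ![_ * a]mulrC.
Qed.

Lemma measurable_dcube (a : R) z : 0 < a -> measurable (dcube a z).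
Proof. by move=> a0; rewrite dcubeE//; exact: measurable_hbox. Qed.

Lemma measurable_gcell (a : R) (f : N.-tuple int -> R) : 0 < a ->
  measurable_fun setT (fun x : T => f (gcell a x)).
Proof.
move=> a0 _ Y mY; rewrite setTI.
have -> : (fun x : T => f (gcell a x)) @^-1` Y =
    \bigcup_z (if f z \in Y then dcube a z else set0).
  apply/seteqP; split=> x /=.
    by move=> Yx; exists (gcell a x) => //; rewrite mem_set.
  by move=> [z _]; case: ifPn => // /set_mem Yz ->.
apply: countable_bigcupT_measurable; first exact: countableP.
by move=> z; case: ifP => // _; exact: measurable_dcube.
Qed.

End grid.

Section continuous_measurable.
Context {R : realType} {N : nat}.
Local Notation T := (N.-tuple R).

Definition row_of_tuple (y : T) : 'rV[R]_N := \row_i tnth y i.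

Lemma tuple_of_rowK y : tuple_of_row (row_of_tuple y) = y.
Proof. by apply: eq_from_tnth => i; rewrite tnth_mktuple mxE. Qed.

Lemma coord_le_norm (x : 'rV[R]_N) i : `|x ord0 i| <= `|x|.
Proof.
have /mapP[j Hj ->] : `|x ord0 i| \in [seq `|x k.1 k.2| | k : 'I_1 * 'I_N].
  by apply/mapP; exists (ord0, i) => //=; rewrite mem_enum.
by rewrite [leRHS]/Num.norm /= mx_normrE; apply/bigmax_geP; right => /=; exists j.
Qed.

Lemma norm_le_coord (x : 'rV[R]_N) (e : R) : 0 <= e ->
  (forall i, `|x ord0 i| <= e) -> `|x| <= e.
Proof.
move=> e0 H; rewrite [leLHS]/Num.norm /= mx_normrE; apply/bigmax_leP; split=> //.
by move=> [i j] _ /=; rewrite ord1.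
Qed.

(** Continuity is stated on row vectors, measurability on tuples. Sampling [f] at the lower corner
    of the cell of [y] gives measurable functions that converge to [f] at every point as the mesh
    1/(m + 1) shrinks. *)
Lemma measurable_continuous_row (f : 'rV[R]_N -> R) : continuous f ->
  measurable_fun setT (fun y : T => f (row_of_tuple y)).
Proof.
move=> cf.
pose rd (m : nat) (z : N.-tuple int) : 'rV[R]_N := \row_i ((tnth z i)%:~R / m.+1%:R).
apply: (measurable_fun_cvg (h := fun m y => f (rd m (gcell m.+1%:R y)))).
  by move=> m; apply: (@measurable_gcell R N _ (fun z => f (rd m z))); rewrite ltr0n.
move=> y _.
suff cv : (fun m => rd m (gcell m.+1%:R y)) @ \oo --> row_of_tuple y.
  exact: (cvg_comp _ _ cv (cf (row_of_tuple y))).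
apply/(@cvgrPdist_le R 'rV[R]_N) => e e0; near=> m.
have m0 : 0 < m.+1%:R :> R by rewrite ltr0n.
apply: norm_le_coord; first exact: ltW.
move=> i; rewrite !mxE tnth_mktuple.
have /andP[h1 h2] := floor_itv (m.+1%:R * tnth y i).
have E : tnth y i = (m.+1%:R * tnth y i) / m.+1%:R by rewrite mulrAC divff ?mul1r// gt_eqF.
rewrite {1}E -mulrBl ger0_norm; last by apply: mulr_ge0; rewrite ?invr_ge0 ?subr_ge0.
apply: (@le_trans _ _ (1 / m.+1%:R)).
  rewrite ler_pM2r ?invr_gt0//; move: h2; rewrite intrD => h2.
  by rewrite lerBlDl ltW.
rewrite div1r; apply: ltW; near: m.
exact: near_infty_natSinv_lt (PosNum e0).
Unshelve. all: by end_near. Qed.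

End continuous_measurable.

Section taylor.
Context {R : realType}.

Lemma MVT_between (g g' : R -> R) (a b : R) :
  (forall t : R, is_derive t (1 : R) g (g' t)) ->
  exists2 c, `|c - a| <= `|b - a| & g b - g a = g' c * (b - a).
Proof.
move=> dg.
have cg : continuous g.
  by move=> x; apply/differentiable_continuous/derivable1_diffP; case: (dg x).
have [ab|ba] := leP a b.
  have [|c cab E] := @MVT_segment R g g' a b ab (fun x _ => dg x).
    exact: continuous_subspaceT.
  exists c => //; move: cab; rewrite in_itv /= => /andP[h1 h2].
  by rewrite !ger0_norm ?subr_ge0// lerD2r.
have [|c cab E] := @MVT_segment R g g' b a (ltW ba) (fun x _ => dg x).
  exact: continuous_subspaceT.
exists c; last by rewrite -opprB E -mulrN opprB.
move: cab; rewrite in_itv /= => /andP[h1 h2].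
by rewrite !ler0_norm ?subr_le0 ?(ltW ba)//; lra.
Qed.

(** Mean value theorem twice; the intermediate point satisfies only |c| <= |h|, hence C instead of C
    / 2. *)
Lemma taylor_quadratic (g g' g'' : R -> R) (C : R) :
  (forall t : R, is_derive t (1 : R) g (g' t)) -> (forall t : R, is_derive t (1 : R) g' (g'' t)) ->
  (forall t, `|g'' t| <= C) ->
  forall h, `|g h - g 0 - h * g' 0| <= C * h ^+ 2.
Proof.
move=> dg dg' gC h.
have [c ch E] := MVT_between 0 h dg; have [d _ E'] := MVT_between 0 c dg'.
rewrite !subr0 in ch E E'.
have -> : g h - g 0 - h * g' 0 = g'' d * (c * h) by rewrite E [h * _]mulrC -mulrBl E' mulrA.
rewrite normrM; apply: ler_pM => //.
by rewrite normrM expr2 -[leRHS]ger0_norm ?normrM ?ler_wpM2r// -expr2 sqr_ge0.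
Qed.

End taylor.

Section test_functions.
Context {R : realType} {N : nat}.
Local Notation T := (N.-tuple R).

Lemma test_fun_csupp (phi : T -> R) : test_fun phi -> csupp phi.
Proof.
move=> [_ /compact_bounded[M [Mr HM]]]; exists (M + 1) => y phiy i.
have : `|row_of_tuple y| <= M + 1.
  apply: HM; first by rewrite ltrDl.
  by apply: subset_closure; rewrite /= tuple_of_rowK.
by apply: le_trans; apply: le_trans (coord_le_norm _ i); rewrite mxE.
Qed.

(** Off the closed support every iterated partial derivative vanishes, because the complement is
    open; on the compact support continuity gives the bound. *)
Lemma test_fun_bounded (phi : T -> R) s : test_fun phi -> exists C, 0 <= C /\
  forall x, `|foldr (@partial R N) (phi \o @tuple_of_row R N) s x| <= C.
Proof.
move=> [sm]; set f := phi \o _; set S := closure _ => cS.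
have f0 x : ~ S x -> foldr (@partial R N) f s x = 0.
  elim: s x => [|k s IH] x nS /=.
    by apply/eqP; apply: contra_notT nS => fx; exact: subset_closure.
  rewrite /partial (@near_eq_derive _ _ _ _ (fun=> 0)) ?derive_cst//.
  near=> z; apply: IH; near: z.
  have : open (~` S) by apply: closed_openC; exact: closed_closure.
  by rewrite openE => /(_ x nS).
have [cf _] := sm s.
have : compact (foldr (@partial R N) f s @` S).
  by apply: continuous_compact => //; exact: continuous_subspaceT.
move=> /compact_bounded[M [Mr HM]]; exists (`|M| + 1); split; first by rewrite addr_ge0.
move=> x; have [xS|xS] := pselect (S x).
  by apply: HM; [rewrite (le_lt_trans (ler_norm _))// ltrDl|exists x].
by rewrite f0// normr0 addr_ge0.
Unshelve. all: by end_near. Qed.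

Lemma derive_along (f : 'rV[R]_N -> R) (x v : 'rV[R]_N) (t : R) :
  derivable f (t *: v + x) v ->
  is_derive t (1 : R) (fun h : R => f (h *: v + x)) ('D_v f (t *: v + x)).
Proof.
move=> df.
have E : (fun h : R => h^-1 *: (((fun h : R => f (h *: v + x)) \o shift t) (h *: (1 : R)) -
    f (t *: v + x))) =
  (fun h : R => h^-1 *: ((f \o shift (t *: v + x)) (h *: v) - f (t *: v + x))).
  apply/funext => h /=; congr (_ *: (f _ - _)).
  by rewrite [h *: 1]mulr1 scalerDl addrA.
by apply: DeriveDef; rewrite /derivable /derive E.
Qed.

Lemma test_fun_C11 (phi : T -> R) : test_fun phi ->
  C11 phi (fun l => dpartial l phi).
Proof.
move=> tphi; have [sm _] := tphi.
have phiE : phi = fun y => (phi \o @tuple_of_row R N) (row_of_tuple y).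
  by apply/funext => y /=; rewrite tuple_of_rowK.
split.
- rewrite phiE; apply: measurable_continuous_row.
  by case: (sm [::]).
- by move=> l; apply: measurable_continuous_row; case: (sm [:: l]).
have [C0 [C00 HC0]] := test_fun_bounded [::] tphi.
have bd1 l : exists C, 0 <= C /\ forall x, `|dpartial l phi x| <= C.
  have [C [C0' HC]] := test_fun_bounded [:: l] tphi; exists C; split=> // x.
  exact: HC.
have bd2 l : exists C, 0 <= C /\ forall x h, `|phi (tadd x (tdir l h)) - phi x -
    h * dpartial l phi x| <= C * h ^+ 2.
  have [C [C0' HC]] := test_fun_bounded [:: l; l] tphi; exists C; split=> // x h.
  set f := phi \o @tuple_of_row R N.
  pose v : 'rV[R]_N := delta_mx 0 l.
  have rowE t : row_of_tuple (tadd x (tdir l t)) = t *: v + row_of_tuple x.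
    apply/rowP => i; rewrite !mxE tnth_tadd tnth_tdir addrC /=; congr (_ + _).
    by case: eqP => _; rewrite ?mulr1 ?mulr0.
  have := @taylor_quadratic R (fun t => f (t *: v + row_of_tuple x))
    (fun t => partial l f (t *: v + row_of_tuple x))
    (fun t => partial l (partial l f) (t *: v + row_of_tuple x)) C.
  move=> /(_ _ _ _ h); rewrite -rowE scale0r add0r /f /= !tuple_of_rowK; apply.
  - by move=> t; apply: derive_along; case: (sm [::]) => _; apply.
  - by move=> t; apply: derive_along; case: (sm [:: l]) => _; apply.
  - by move=> t; exact: HC.
have [D HD] := choice bd1; have [E HE] := choice bd2.
have sumge (F : 'I_N -> R) i : (forall i, 0 <= F i) -> F i <= \sum_j F j.
  by move=> F0; rewrite (bigD1 i)//= lerDl sumr_ge0.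
have D0 i : 0 <= D i by case: (HD i).
have E0 i : 0 <= E i by case: (HE i).
have sD : 0 <= \sum_i D i by exact: sumr_ge0.
have sE : 0 <= \sum_i E i by exact: sumr_ge0.
(* One constant has to serve all directions, so the finitely many directional constants are added
   up. *)
exists (C0 + \sum_i D i + \sum_i E i); split.
- by rewrite !addr_ge0.
- move=> x; apply: (@le_trans _ _ C0); last by lra.
  by rewrite phiE; exact: HC0.
- move=> l x; apply: (@le_trans _ _ (D l)); first by case: (HD l).
  by have := sumge D l D0; lra.
- move=> l x h _; apply: (@le_trans _ _ (E l * h ^+ 2)); first by case: (HE l).
  rewrite ler_wpM2r ?sqr_ge0//.
  by have := sumge E l E0; lra.
Qed.

End test_functions.

(** * Signs and weakly closed forms *)

Section signs.
Context {R : realType} {N : nat}.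
Implicit Types (A B I J K M : {set 'I_N}) (i k l m : 'I_N).

Definition inversions A B : nat := (\sum_(a in A) \sum_(b in B) (b < a))%N.

Lemma card_inversions A B :
  #|[set p : 'I_N * 'I_N | [&& p.1 \in A, p.2 \in B & (p.2 < p.1)%N]]| =
  inversions A B.
Proof.
rewrite /inversions -sum1_card.
rewrite (pair_big_dep (fun a => a \in A) (fun _ b => b \in B)
  (fun a b => nat_of_bool (b < a)%N)) /=.
rewrite [RHS]big_mkcond [LHS]big_mkcond; apply: eq_bigr => -[a b] _ /=.
rewrite unfold_in /in_set asboolb /=.
by case: (a \in A); case: (b \in B); case: (b < a)%N.
Qed.

(* dx_k ^ dx_I = ksign k I dx_(k |: I) for k \notin I. *)
Definition ksign k I : R := (-1) ^+ inversions [set k] I.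

Lemma inversionsU1l k A B : k \notin A ->
  inversions (k |: A) B = (inversions [set k] B + inversions A B)%N.
Proof. by move=> kA; rewrite /inversions big_setU1// big_set1. Qed.

Lemma inversionsU1r k A B : k \notin B ->
  inversions A (k |: B) = (inversions A [set k] + inversions A B)%N.
Proof.
move=> kB; rewrite /inversions -big_split /=; apply: eq_bigr => a _.
by rewrite big_setU1// big_set1.
Qed.

Lemma inversions1C k A : k \notin A ->
  (inversions [set k] A + inversions A [set k])%N = #|A|.
Proof.
move=> kA; rewrite /inversions big_set1 -big_split /= -sum1_card.
apply: eq_bigr => a aA; rewrite big_set1.
have : a != k by apply: contraNneq kA => <-.
by rewrite -(inj_eq val_inj) /= neq_ltn => /orP[H|H];
  rewrite H ltnNge (ltnW H).
Qed.

Lemma ksign_sqr k I : ksign k I * ksign k I = 1.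
Proof. by rewrite -expr2 sqrr_sign. Qed.

Lemma ksignU1 i l I : l \notin I ->
  ksign i (l |: I) = (-1) ^+ (l < i)%N * ksign i I.
Proof.
move=> lI; rewrite /ksign inversionsU1r// exprD; congr (_ * _).
by rewrite /inversions !big_set1.
Qed.

Lemma ksign_swap i l I : i != l -> i \notin I -> l \notin I ->
  ksign i (l |: I) * ksign l I = - (ksign l (i |: I) * ksign i I).
Proof.
move=> il iI lI; rewrite !ksignU1//.
have : (l < i)%N = ~~ (i < l)%N.
  by case: (ltngtP l i) => // /val_inj E; rewrite E eqxx in il.
by move=> ->; case: (i < l)%N; rewrite /= ?expr0 ?expr1; ring.
Qed.

(** The part of the two wedge signs that does not depend on k; being a unit common to all k, it can
    be divided out of the closedness condition. *)
Definition jsign J : R := (-1) ^+ (#|J| + inversions J (~: J)).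

Lemma wedge_sign_ksign k J : k \notin J ->
  wedge_sign R [set k] J * wedge_sign R (k |: J) (~: J :\ k) =
  jsign J * ksign k (~: J :\ k).
Proof.
move=> kJ; have kI : k \notin (~: J :\ k)%SET by rewrite !inE eqxx.
have dkJ : disjoint (mem [set k]%SET) (mem J) by rewrite disjoints1.
have dJI : disjoint (mem (k |: J)%SET) (mem (~: J :\ k)%SET).
  rewrite -setI_eq0; apply/eqP/setP => x; rewrite !inE.
  by case: eqP => //=; case: (x \in J).
rewrite /wedge_sign dkJ dJI !card_inversions.
rewrite /jsign /ksign -!exprD.
have E : (~: J = k |: (~: J :\ k))%SET by rewrite finset.setD1K// inE.
rewrite [in RHS]E [in X in _ = X](inversionsU1r _ kI) -E inversionsU1l// -(inversions1C kJ).
set a := inversions [set k] J; set b := inversions [set k] _.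
set c := inversions J _; set d := inversions J _.
rewrite (_ : (a + d + (d + c) + b)%N = (a + (b + c) + d * 2)%N); last by lia.
by rewrite [RHS]exprD exprM sqrr_sign mulr1.
Qed.

End signs.
Arguments ksign R {N} k I.

Section weakly_closed.
Context {R : realType} {N : nat}.
Local Notation T := (N.-tuple R).
Context {mu : {measure set T -> \bar R}}.
Hypothesis leb : is_lebesgue mu.
Local Open Scope set_scope.
Local Open Scope ring_scope.
Implicit Types (I K M : {set 'I_N}) (i k l m : 'I_N) (phi : T -> R).

(** Weak enough for integrable coefficients ([u], the limit [v]) and for bounded measurable ones
    (the pieces of v_K). *)
Definition admissible (f : T -> R) :=
  forall phi m, test_fun phi -> intg mu (fun x => dpartial m phi x * f x).

(* Forms are families of coefficients indexed by all subsets of 'I_N; for a form of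
   pure degree the coefficients of the other degrees vanish. *)
Definition wclosed (U : {set 'I_N} -> T -> R) :=
  (forall I, admissible (U I)) /\
  forall M phi, test_fun phi -> \sum_(m in M) ksign R m (M :\ m) *
    \int[mu]_x (dpartial m phi x * U (M :\ m) x) = 0.

Lemma admissible_intg (f : T -> R) : intg mu f -> admissible f.
Proof.
move=> If phi m /test_fun_C11[_ mp [C [_ _ pC _]]].
exact: intgM (mp m) (pC m) If.
Qed.

Lemma admissible_bounded (f : T -> R) (C : R) : measurable_fun setT f ->
  (forall x, `|f x| <= C) -> admissible f.
Proof.
move=> mf fC phi m tp; have cp := test_fun_C11 tp.
have [_ mp [D [D0 _ pD _]]] := cp.
apply: (@intg_csupp _ _ _ leb _ (D * C)).
- exact: measurable_funM.
- by move=> x; rewrite normrM ler_pM.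
- exact/csuppMl/(csupp_C11' _ cp)/test_fun_csupp.
Qed.

Lemma admissible_C11 F F' : C11 F F' -> admissible F.
Proof. by move=> [mF _ [C [_ FC _ _]]]; exact: admissible_bounded FC. Qed.

Lemma admissibleD f g : admissible f -> admissible g ->
  admissible (fun x => f x + g x).
Proof.
move=> af ag phi m tp; rewrite (_ : (fun x => _) =
  fun x => dpartial m phi x * f x + dpartial m phi x * g x).
  by apply: intgD; [exact: af|exact: ag].
by apply/funext => x; rewrite mulrDr.
Qed.

Lemma wclosedD (U V : {set 'I_N} -> T -> R) : wclosed U -> wclosed V ->
  wclosed (fun I x => U I x + V I x).
Proof.
move=> [aU cU] [aV cV]; split; first by move=> I; exact: admissibleD.
move=> M phi tp.
transitivity (\sum_(m in M) ksign R m (M :\ m) *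
    \int[mu]_x (dpartial m phi x * U (M :\ m) x) +
  \sum_(m in M) ksign R m (M :\ m) *
    \int[mu]_x (dpartial m phi x * V (M :\ m) x)); last first.
  by rewrite cU// cV// addr0.
rewrite -big_split /=; apply: eq_bigr => m _; rewrite -mulrDr -RintD; [|exact: aU|exact: aV].
by congr (_ * _); apply: eq_Rintegral => x _; rewrite mulrDr.
Qed.

Lemma wclosed0 : wclosed (fun _ _ => 0).
Proof.
split; first by move=> I; apply: admissible_intg; exact: intg0.
move=> M phi tp; apply: big1 => m _.
rewrite (_ : Rintegral _ _ _ = 0) ?mulr0//.
by rewrite -[RHS](Rint0 mu); apply: eq_Rintegral => x _; rewrite mulr0.
Qed.

Lemma wclosedZ (a : R) (U : {set 'I_N} -> T -> R) : wclosed U ->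
  wclosed (fun I x => a * U I x).
Proof.
move=> [aU cU].
split.
  move=> I phi m tp.
  rewrite (_ : (fun x => _) = fun x => a * (dpartial m phi x * U I x)).
    by apply: intgZ; exact: aU.
  by apply/funext => x; rewrite mulrCA.
move=> M phi tp; rewrite -[RHS](mulr0 a) -[X in _ = _ * X](cU M phi tp) mulr_sumr.
apply: eq_bigr => m _; rewrite [RHS]mulrCA; congr (_ * _).
rewrite -RintZ; last exact: aU.
by apply: eq_Rintegral => x _; rewrite mulrCA.
Qed.

Lemma wclosed_sum (J : Type) (s : seq J) (U : J -> {set 'I_N} -> T -> R) :
  (forall j, wclosed (U j)) -> wclosed (fun I x => \sum_(j <- s) U j I x).
Proof.
move=> H; elim: s => [|j s IH].
  rewrite (_ : (fun I x => _) = fun _ _ => 0); first exact: wclosed0.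
  by apply/funext => I; apply/funext => x; rewrite big_nil.
rewrite (_ : (fun I x => _) = fun I x => U j I x + \sum_(j <- s) U j I x).
  exact: wclosedD.
by apply/funext => I; apply/funext => x; rewrite big_cons.
Qed.

(* dW = 0 pointwise, W' I l being the l-th partial derivative of W I. *)
Definition pclosed (W' : {set 'I_N} -> 'I_N -> T -> R) :=
  forall M x, \sum_(m in M) ksign R m (M :\ m) * W' (M :\ m) m x = 0.

Lemma intg_csuppM (f g : T -> R) (C D : R) : measurable_fun setT f -> measurable_fun setT g ->
  (forall x, `|f x| <= C) -> (forall x, `|g x| <= D) -> csupp f ->
  intg mu (fun x => f x * g x).
Proof.
move=> mf mg fC gD sf; apply: (@intg_csupp _ _ _ leb _ (C * D)).
- exact: measurable_funM.
- by move=> x; rewrite normrM ler_pM.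
- exact: csuppMl.
Qed.

Lemma pclosed_wclosed W W' : (forall I, C11 (W I) (W' I)) -> pclosed W' ->
  wclosed W.
Proof.
move=> cW pW; split; first by move=> I; exact: admissible_C11 (cW I).
move=> M phi tp; have cp := test_fun_C11 tp; have sp := test_fun_csupp tp.
have [mp _ [D [_ pD _ _]]] := cp.
transitivity (\sum_(m in M) - \int[mu]_x (ksign R m (M :\ m) *
    (phi x * W' (M :\ m) m x))).
  apply: eq_bigr => m _; rewrite (Rint_by_parts leb m cp sp (cW _)) RintZ ?mulrN//.
  have [_ mW [C [_ _ WC _]]] := cW (M :\ m).
  exact: intg_csuppM pD (WC m) sp.
rewrite sumrN -Rint_sum; last first.
  move=> m _; apply: intgZ; have [_ mW [C [_ _ WC _]]] := cW (M :\ m).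
  exact: intg_csuppM pD (WC m) sp.
apply/eqP; rewrite oppr_eq0; apply/eqP.
rewrite -[RHS](Rint0 mu); apply: eq_Rintegral => x _.
rewrite -[RHS](mulr0 (phi x)) -[X in _ = _ * X](pW M x) mulr_sumr.
by apply: eq_bigr => m _; rewrite mulrCA.
Qed.

(** Coefficient [K] of the interior product of [W] with e_i: i_{e_i} (dx_i ^ dx_K) = dx_K when i is
    not in K. *)
Definition contract i (W : {set 'I_N} -> T -> R) K x : R :=
  if i \in K then 0 else ksign R i K * W (i |: K) x.

(* d(chi i_{e_i} W) when dW = 0, by Cartan's formula *)
Definition cutoff_form i (chi : T -> R) chi' W W' I x : R :=
  chi x * W' I i x +
  \sum_(l in I) ksign R l (I :\ l) * (chi' l x * contract i W (I :\ l) x).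

(** Since dW = 0, the Lie derivative along the constant field e_i, which is d_i W, equals d (i_{e_i}
    W). If i lies in I only l = i contributes; otherwise closedness at i |: I is solved for the term
    m = i. *)
Lemma cartan i W' I x : pclosed W' ->
  \sum_(l in I) ksign R l (I :\ l) * contract i (fun K => W' K l) (I :\ l) x =
  W' I i x.
Proof.
move=> pW; rewrite /contract; have [iI|iI] := boolP (i \in I).
  rewrite (bigD1 i)//= big1 ?addr0; last first.
    by move=> l /andP[lI li]; rewrite !inE eq_sym li iI mulr0.
  by rewrite !inE eqxx /= mulrA ksign_sqr mul1r finset.setD1K.
have /eqP := pW (i |: I) x.
rewrite big_setU1//= finset.setU1K// addr_eq0 => /eqP E.
rewrite -[RHS]mul1r -(ksign_sqr i I) -mulrA E mulrN mulr_sumr -sumrN.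
apply: eq_bigr => l lI.
have li : l != i by apply: contraNneq iI => <-.
have iIl : i \notin I :\ l by rewrite !inE (negbTE iI) andbF.
have lIl : l \notin I :\ l by rewrite !inE eqxx.
rewrite (negbTE iIl) !mulrA.
have -> : (i |: I) :\ l = i |: (I :\ l).
  by apply/setP => y; rewrite !inE; case: eqP => [->|_] //=; rewrite (negbTE li).
rewrite -mulNr; congr (_ * _).
have -> : ksign R i I = (-1) ^+ (l < i)%N * ksign R i (I :\ l).
  by rewrite -(ksignU1 i lIl) finset.setD1K.
rewrite ksignU1//.
(* Exactly one of l < i and i < l holds; this is the minus sign of exchanging dx_i and dx_l. *)
have pq : (-1) ^+ (l < i)%N * (-1) ^+ (i < l)%N = -1 :> R.
  case: (ltngtP l i) => [_|_|/val_inj E']; rewrite /= ?expr0 ?expr1 ?mulr1 ?mul1r//.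
  by rewrite E' eqxx in li.
set p := _ ^+ _ in pq *; set q := _ ^+ _ in pq *.
rewrite (_ : - _ = - (p * q) * (ksign R l (I :\ l) * ksign R i (I :\ l))); last ring.
by rewrite pq opprK mul1r.
Qed.

Lemma antisym_double_sum M (a : 'I_N -> 'I_N -> R) :
  (forall m l, m != l -> a m l = - a l m) ->
  \sum_(m in M) \sum_(l in M :\ m) a m l = 0.
Proof.
move=> H; set S := (X in X = _).
have E : S = \sum_(m in M) \sum_(l in M | l != m) a m l.
  apply: eq_bigr => m _; apply: eq_bigl => l; by rewrite !inE andbC.
have : S = - S.
  rewrite {1}E (exchange_big_dep (mem M)) /=; last by move=> m l mM /andP[].
  rewrite E -sumrN; apply: eq_bigr => l lM; rewrite -sumrN.
  rewrite (eq_bigl (fun m => (m \in M) && (m != l))); last first.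
    by move=> m; rewrite lM eq_sym andTb.
  by apply: eq_bigr => m /andP[_ ml]; rewrite H.
by move/eqP; rewrite -addr_eq0 -mulr2n mulrn_eq0 /= => /eqP.
Qed.

(** The form is d of [al], the contraction multiplied by [chi]. Since [al] is only [C11], d d = 0 is
    taken weakly: the integrals are symmetric by [Rint_partial_sym] and the signs antisymmetric by
    [ksign_swap]. *)
Lemma cutoff_form_wclosed i chi chi' W W' : C11 chi chi' ->
  (forall I, C11 (W I) (W' I)) -> pclosed W' ->
  wclosed (cutoff_form i chi chi' W W').
Proof.
move=> cchi cW pW.
have cI K : C11 (contract i W K) (fun l => contract i (fun K => W' K l) K).
  have [iK|iK] := boolP (i \in K); rewrite /contract; first by rewrite iK; exact: C11_cst.
  by rewrite (negbTE iK); exact: C11Z.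
pose al K x := chi x * contract i W K x.
pose al' K l x := chi' l x * contract i W K x +
  chi x * contract i (fun K => W' K l) K x.
have cal K : C11 (al K) (al' K) by exact: C11M.
have E I x : cutoff_form i chi chi' W W' I x =
    \sum_(l in I) ksign R l (I :\ l) * al' (I :\ l) l x.
  rewrite /cutoff_form -(cartan i I x pW) mulr_sumr -big_split /=.
  by apply: eq_bigr => l _; rewrite /al'; ring.
have bal K l : exists C, forall x, `|al' K l x| <= C.
  by have [_ _ [C [_ _ WC _]]] := cal K; exists C.
have mal K l : measurable_fun setT (al' K l) by case: (cal K).
split.
  move=> I phi m tp.
  have cp := test_fun_C11 tp; have [_ mp [D [_ _ pD _]]] := cp.
  rewrite (_ : (fun x => _) = fun x => \sum_(l in I)
      ksign R l (I :\ l) * (dpartial m phi x * al' (I :\ l) l x)).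
    apply: intg_sum => l lI; apply: intgZ; have [C aC] := bal (I :\ l) l.
    apply: intg_csuppM (pD m) aC _ => //.
    exact: csupp_C11' cp (test_fun_csupp tp).
  apply/funext => x; rewrite E mulr_sumr; apply: eq_bigr => l _.
  by rewrite mulrCA.
move=> M phi tp.
have cp := test_fun_C11 tp; have [_ mp [D [_ _ pD _]]] := cp.
have sp := test_fun_csupp tp.
have ial m l K : intg mu (fun x => dpartial m phi x * al' K l x).
  have [C aC] := bal K l; apply: intg_csuppM (pD m) aC _ => //.
  exact: csupp_C11' cp sp.
pose a m l := ksign R m (M :\ m) * ksign R l (M :\ m :\ l) *
  \int[mu]_x (dpartial m phi x * al' (M :\ m :\ l) l x).
transitivity (\sum_(m in M) \sum_(l in M :\ m) a m l).
  apply: eq_bigr => m mM; rewrite -[RHS]/(\sum_(l in M :\ m) _).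
  transitivity (ksign R m (M :\ m) * \int[mu]_x (\sum_(l in M :\ m)
      ksign R l (M :\ m :\ l) * (dpartial m phi x * al' (M :\ m :\ l) l x))).
    congr (_ * _); apply: eq_Rintegral => x _; rewrite E mulr_sumr.
    by apply: eq_bigr => l _; rewrite mulrCA.
  rewrite Rint_sum; last by move=> l _; exact/intgZ/ial.
  rewrite mulr_sumr; apply: eq_bigr => l _.
  by rewrite RintZ// /a mulrA.
(* The guard makes the summand antisymmetric for all pairs of indices, as [antisym_double_sum] asks,
   and not only for pairs in M. *)
rewrite (eq_bigr (fun m => \sum_(l in M :\ m)
  (if (m \in M) && (l \in M) then a m l else 0))); last first.
  move=> m mM; apply: eq_bigr => l; rewrite !inE => /andP[_ lM].
  by rewrite mM lM.
apply: antisym_double_sum => m l ml.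
rewrite andbC; case: ifP => [/andP[lM mM]|]; last by rewrite oppr0.
rewrite /a.
have EK : M :\ l :\ m = M :\ m :\ l by apply/setP => y; rewrite !inE andbCA.
have Em : M :\ m = l |: (M :\ m :\ l).
  by rewrite finset.setD1K// !inE eq_sym ml.
have El : M :\ l = m |: (M :\ m :\ l) by rewrite -EK finset.setD1K// !inE ml.
rewrite EK (Rint_partial_sym leb m l cp sp (cal _)) -mulNr; congr (_ * _).
rewrite [in ksign R m _]Em [in ksign R l (M :\ l)]El.
by apply: ksign_swap; rewrite // !inE eqxx ?andbF.
Qed.

End weakly_closed.

(** * Passage between [dclosed] and the coefficientwise [wclosed] *)

Section form_conversion.
Context {R : realType} {N r : nat}.
Local Notation T := (N.-tuple R).
Context {mu : {measure set T -> \bar R}}.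
Local Open Scope set_scope.
Local Open Scope ring_scope.
Implicit Types (I J K M : {set 'I_N}).

Definition ext (omega : T -> rform R N r) I (x : T) : R :=
  oapp (omega x) 0 (insub I : option (rset N r)).

Lemma ext_val omega (I : rset N r) x : ext omega (val I) x = omega x I.
Proof. by rewrite /ext valK. Qed.

Lemma ext_neq omega I x : #|I| != r -> ext omega I x = 0.
Proof. by move=> Ir; rewrite /ext insubN. Qed.

Lemma test_fun0 : test_fun (fun=> 0 : R) (N := N).
Proof.
have E s : foldr (@partial R N) ((fun=> 0) \o @tuple_of_row R N) s = fun=> 0.
  elim: s => [//|k s IH] /=; rewrite IH; apply/funext => x.
  by rewrite /partial derive_cst.
split.
  by move=> s; rewrite E; split=> [|k x]; [exact: cst_continuous|exact: derivable_cst].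
rewrite (_ : [set x | _]%classic = classical_sets.set0); last first.
  by apply/seteqP; split=> x //=; rewrite eqxx.
by rewrite closure0; exact: compact0.
Qed.

(** For given J and k the second wedge sign vanishes unless I is the complement of k |: J, so the
    sum over I has at most one term. *)
Lemma dwedgeE (phi : {set 'I_N} -> T -> R) (omega : T -> rform R N r) (y : T) :
  dwedge phi omega y = \sum_(J : {set 'I_N} | (#|J| + r + 1)%N == N)
    jsign J * \sum_(k in ~: J) ksign R k (~: J :\ k) *
      (dpartial k (phi J) y * ext omega (~: J :\ k) y).
Proof.
apply: eq_bigr => J /eqP cJ; rewrite mulr_sumr [RHS]big_mkcond /=.
apply: eq_bigr => k _; rewrite inE; case: ifPn => kJ; last first.
  apply: big1 => I _; rewrite /wedge_sign ifF ?mul0r//.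
  by rewrite disjoints1; apply/negbTE; rewrite negbK; move: kJ; rewrite negbK.
have cI : #|~: J :\ k| == r.
  have := cardsC J; rewrite card_ord (cardsD1 k (~: J)) inE kJ /= => cC.
  by move: cC; rewrite -[in RHS]cJ -addnA => /addnI; rewrite addnC => /addIn ->.
pose I0 : rset N r := Sub (~: J :\ k) cI.
rewrite (bigD1 I0)//= big1 ?addr0; last first.
  move=> I II0; rewrite [X in _ * X * _ * _]/wedge_sign; case: ifPn => [dJI|]; last first.
    by rewrite mulr0 !mul0r.
  case/negP: II0; rewrite -val_eqE /= eqEcard (eqP cI) (eqP (valP I)) leqnn andbT.
  apply/fintype.subsetP => x xI; have := disjointFl dJI xI.
  by rewrite !inE => /negbT; rewrite negb_or => /andP[-> ->].
rewrite wedge_sign_ksign// -(ext_val omega I0) /=.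
by rewrite -!mulrA.
Qed.

Lemma jsign_neq0 J : jsign J != 0 :> R.
Proof. by rewrite signr_eq0. Qed.

Lemma intg_dwedge (phi : {set 'I_N} -> T -> R) omega :
  (forall J, test_fun (phi J)) -> (forall I, admissible (mu := mu) (ext omega I)) ->
  intg mu (dwedge phi omega) /\
  \int[mu]_y dwedge phi omega y = \sum_(J : {set 'I_N} | (#|J| + r + 1)%N == N)
    jsign J * \sum_(k in ~: J) ksign R k (~: J :\ k) *
      \int[mu]_y (dpartial k (phi J) y * ext omega (~: J :\ k) y).
Proof.
move=> tp ao.
have i1 J k : intg mu (fun y => ksign R k (~: J :\ k) *
    (dpartial k (phi J) y * ext omega (~: J :\ k) y)).
  by apply: intgZ; exact: ao.
have i2 J : intg mu (fun y => jsign J * \sum_(k in ~: J) ksign R k (~: J :\ k) *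
    (dpartial k (phi J) y * ext omega (~: J :\ k) y)).
  by apply: intgZ; apply: intg_sum.
rewrite (funext (dwedgeE phi omega)).
split; first exact: intg_sum.
rewrite Rint_sum//; apply: eq_bigr => J _.
rewrite RintZ; last exact: intg_sum.
rewrite Rint_sum//; congr (_ * _); apply: eq_bigr => k _.
by rewrite RintZ//; exact: ao.
Qed.

Lemma dclosed_wclosed (omega : T -> rform R N r) :
  (forall I, admissible (mu := mu) (ext omega I)) ->
  dclosed mu omega -> wclosed (mu := mu) (ext omega).
Proof.
move=> ao cl; split=> // M phi tp.
have [cM|cM] := eqVneq #|M| r.+1; last first.
  apply: big1 => m mM; rewrite (_ : Rintegral _ _ _ = 0) ?mulr0//.
  rewrite -[RHS](Rint0 mu); apply: eq_Rintegral => x _; rewrite ext_neq ?mulr0//.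
  by apply: contra cM => /eqP <-; rewrite (cardsD1 m M) mM.
(* A test form with the single coefficient [phi] at the complement of M isolates the condition at
   M. *)
pose Phi J := if J == ~: M then phi else fun=> 0.
have tP J : test_fun (Phi J).
  by rewrite /Phi; case: eqP => // _; exact: test_fun0.
have [iw Ew] := intg_dwedge tP ao.
have := cl Phi tP; rewrite -EFin_Rint// Ew => -[].
have cJ : (#|~: M| + r + 1)%N == N.
  by have := cardsC M; rewrite card_ord cM addnC addnS -addn1 => ->.
rewrite (bigD1 (~: M))//= [X in _ + X]big1 ?addr0; last first.
  move=> J /andP[_ JM]; rewrite big1 ?mulr0// => k _.
  rewrite (_ : Rintegral _ _ _ = 0) ?mulr0//.
  rewrite -[RHS](Rint0 mu); apply: eq_Rintegral => x _; rewrite /Phi (negbTE JM).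
  rewrite /dpartial /partial (_ : _ \o _ = fun=> 0)//.
  by rewrite derive_cst mul0r.
rewrite /Phi eqxx finset.setCK => /eqP; rewrite mulf_eq0 (negbTE (jsign_neq0 _)) /=.
by move/eqP.
Qed.

Lemma wclosed_dclosed (omega : T -> rform R N r) :
  wclosed (mu := mu) (ext omega) -> dclosed mu omega.
Proof.
move=> [ao cl] phi tp; have [iw Ew] := intg_dwedge tp ao.
rewrite -EFin_Rint// Ew; congr EFin; apply: big1 => J _.
by rewrite cl// mulr0.
Qed.

End form_conversion.

(** * Smooth kernels *)

Section smooth_line.
Context {R : realType}.
Implicit Types f g : R -> R.

Definition has_deriv f (df : R -> R) := forall x : R, is_derive x (1 : R) f (df x).

Fixpoint Cn (n : nat) f : Prop :=
  if n is m.+1 then exists df, has_deriv f df /\ Cn m df else continuous f.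

Definition smooth1 f := forall n, Cn n f.

Lemma has_deriv_continuous f df : has_deriv f df -> continuous f.
Proof.
by move=> H x; apply/differentiable_continuous/derivable1_diffP; case: (H x).
Qed.

Lemma has_deriv_unique f df dg : has_deriv f df -> has_deriv f dg -> df = dg.
Proof.
move=> H1 H2; apply/funext => x.
by have [_ <-] := H1 x; have [_ <-] := H2 x.
Qed.

Lemma CnS n f : Cn n.+1 f -> Cn n f.
Proof.
elim: n f => [|n IH] f /= [df [H C]]; first exact: has_deriv_continuous H.
by exists df; split=> //; apply: IH.
Qed.

Lemma has_derivD f df g dg : has_deriv f df -> has_deriv g dg ->
  has_deriv (fun x => f x + g x) (fun x => df x + dg x).
Proof. by move=> Hf Hg x; have := Hf x; have := Hg x => ? ?; exact: is_deriveD. Qed.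

Lemma has_derivM f df g dg : has_deriv f df -> has_deriv g dg ->
  has_deriv (fun x => f x * g x) (fun x => df x * g x + f x * dg x).
Proof.
move=> Hf Hg x; apply: (is_derive_eq (is_deriveM (Hf x) (Hg x))).
by rewrite addrC [g x *: _]mulrC.
Qed.

Lemma has_derivV f df : (forall x, f x != 0) -> has_deriv f df ->
  has_deriv (fun x => (f x)^-1) (fun x => - df x * ((f x)^-1 * (f x)^-1)).
Proof.
move=> f0 Hf x; apply: (is_derive_eq (is_deriveV (f0 x) (Hf x))).
by rewrite -exprVn expr2 [LHS]mulNr mulNr mulrC.
Qed.

Lemma has_deriv_cst (c : R) : has_deriv (fun=> c) (fun=> 0).
Proof. by move=> x; exact: is_derive_cst. Qed.

Lemma has_deriv_affine (a b : R) f df : has_deriv f df ->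
  has_deriv (fun x => f (a * x + b)) (fun x => a * df (a * x + b)).
Proof.
move=> Hf x.
have d1 : is_derive x (1 : R) (fun x : R => a * x + b) a.
  have := has_derivD (has_derivM (has_deriv_cst a) (fun x => is_derive_id x 1))
    (has_deriv_cst b) x.
  by move=> H; apply: (is_derive_eq H); rewrite mul0r add0r mulr1 addr0.
have := @is_derive1_comp R f (fun x : R => a * x + b) x (df (a * x + b)) a (Hf _) d1.
by move=> H; apply: (is_derive_eq H); rewrite mulrC.
Qed.

Lemma CnD n f g : Cn n f -> Cn n g -> Cn n (fun x => f x + g x).
Proof.
elim: n f g => [|n IH] f g /=.
  by move=> cf cg x; apply: cvgD; [exact: cf|exact: cg].
move=> [df [Hf Cf]] [dg [Hg Cg]]; exists (fun x => df x + dg x).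
by split; [exact: has_derivD|exact: IH].
Qed.

Lemma CnM n f g : Cn n f -> Cn n g -> Cn n (fun x => f x * g x).
Proof.
elim: n f g => [|n IH] f g.
  by move=> cf cg x; apply: cvgM; [exact: cf|exact: cg].
move=> Cf Cg; have Cf' := CnS Cf; have Cg' := CnS Cg.
case: Cf => df [Hf Cf]; case: Cg => dg [Hg Cg].
exists (fun x => df x * g x + f x * dg x); split; first exact: has_derivM.
by apply: CnD; exact: IH.
Qed.

Lemma Cn_cst n (c : R) : Cn n (fun=> c).
Proof.
elim: n c => [|n IH] c /=; first exact: cst_continuous.
by exists (fun=> 0); split; [exact: has_deriv_cst|exact: IH].
Qed.

Lemma CnV n f : (forall x, f x != 0) -> Cn n f -> Cn n (fun x => (f x)^-1).
Proof.
move=> f0; elim: n => [|n IH].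
  by move=> cf x; apply: cvgV; [exact: f0|exact: cf].
move=> Cf; have Cf' := IH (CnS Cf); case: Cf => df [Hf Cf].
exists (fun x => - df x * ((f x)^-1 * (f x)^-1)); split; first exact: has_derivV.
apply: CnM; last exact: CnM.
rewrite (_ : (fun x => - df x) = fun x => -1 * df x).
  by apply: CnM => //; exact: Cn_cst.
by apply/funext => x; rewrite mulN1r.
Qed.

Lemma Cn_affine n (a b : R) f : Cn n f -> Cn n (fun x => f (a * x + b)).
Proof.
elim: n f => [|n IH] f /=.
  move=> cf x; apply: (cvg_comp (fun x => a * x + b) f); last exact: cf.
  by apply: cvgD; [apply: cvgMr; exact: cvg_id|exact: cvg_cst].
move=> [df [Hf Cf]]; exists (fun x => a * df (a * x + b)).
split; first exact: has_deriv_affine.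
by apply: CnM; [exact: Cn_cst|exact: IH].
Qed.

Lemma smooth1_deriv f df : has_deriv f df -> smooth1 f -> smooth1 df.
Proof.
move=> Hf Sf n; have [dg [Hg Cg]] := Sf n.+1.
by rewrite (has_deriv_unique Hf Hg).
Qed.

Lemma smooth1_continuous f : smooth1 f -> continuous f.
Proof. by move=> /(_ 0%N). Qed.

Lemma smooth1_has_deriv f : smooth1 f -> exists df, has_deriv f df /\ smooth1 df.
Proof.
move=> Sf; have [df [Hf _]] := Sf 1%N; exists df; split=> //.
exact: smooth1_deriv Hf Sf.
Qed.

(** The family p(1/x) e^(-1/x), extended by 0, is closed under differentiation: p is replaced by X^2
    (p - p'). Smoothness at the origin thus needs the first derivative only. *)
Definition flat (p : {poly R}) (x : R) : R :=
  if 0 < x then p.[x^-1] * expR (- x^-1) else 0.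

Definition flat_deriv (p : {poly R}) : {poly R} := 'X^2 * (p - p^`()).

Lemma horner_bound (p : {poly R}) : exists A, 0 <= A /\
  forall y, 1 <= y -> `|p.[y]| <= A * y ^+ (size p).
Proof.
exists (\sum_(i < size p) `|p`_i|); split; first exact: sumr_ge0.
move=> y y1; rewrite horner_coef (le_trans (ler_norm_sum _ _ _))// mulr_suml.
apply: ler_sum => i _; rewrite normrM ler_wpM2l// normrX ger0_norm; last lra.
by rewrite ler_weXn2l// ltnW.
Qed.

Lemma flat_bound (p : {poly R}) : exists K, 0 <= K /\
  forall h : R, `|h| <= 1 -> `|flat p h| <= K * h ^+ 2.
Proof.
have [A [A0 HA]] := horner_bound p.
(* Then n + 1 = size p + 2 in e^y >= y^(n+1) / (n+1)!: the growth y^(size p) is absorbed and h^2 is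
   left. *)
pose n := (size p).+1.
exists (A * n.+1`!%:R); split; first by rewrite mulr_ge0.
move=> h h1; rewrite /flat; case: ifP => h0; last first.
  by rewrite normr0 mulr_ge0 ?sqr_ge0// mulr_ge0.
rewrite gtr0_norm// in h1.
set y := h^-1; have y1 : 1 <= y by rewrite /y invf_ge1.
have y0 : 0 < y by lra.
rewrite normrM [X in _ * X]ger0_norm ?expR_ge0//.
have f0 : 0 < n.+1`!%:R :> R by rewrite ltr0n fact_gt0.
have e1 : y ^+ n.+1 / n.+1`!%:R <= expR y.
  by apply: le_trans (expR_ge1Dxn n (ltW y0)); rewrite lerDr.
have e2 : y ^+ (size p) * expR (- y) <= n.+1`!%:R * h ^+ 2.
  rewrite expRN -(ler_pM2r (expR_gt0 y)) mulfVK ?gt_eqF ?expR_gt0//.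
  have hy : h * y = 1 by rewrite /y divff// gt_eqF.
  have -> : y ^+ (size p) = n.+1`!%:R * h ^+ 2 * (y ^+ n.+1 / n.+1`!%:R).
    rewrite /n !exprS.
    rewrite (_ : _ * _ * _ = (h * y) ^+ 2 * (n.+1`!%:R / n.+1`!%:R) * y ^+ size p).
      by rewrite hy expr1n divff ?gt_eqF// !mul1r.
    by rewrite /n; ring.
  by rewrite ler_wpM2l// mulr_ge0 ?sqr_ge0// ltW.
apply: (@le_trans _ _ (A * (y ^+ size p * expR (- y)))).
  by rewrite mulrA ler_wpM2r ?expR_ge0// HA.
by rewrite -mulrA ler_wpM2l.
Qed.

Lemma flat_has_deriv (p : {poly R}) : has_deriv (flat p) (flat (flat_deriv p)).
Proof.
move=> x; have [x0|x0|x0] := ltgtP x 0.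
- rewrite [X in is_derive _ _ _ X]/flat ifF; last by apply/negbTE; rewrite -leNgt ltW.
  apply: (@near_eq_is_derive _ R R (fun=> 0 : R)).
  near=> z; rewrite /flat ifF//; apply/negbTE; rewrite -leNgt ltW//.
  by near: z; exact: lt_nbhsl.
- rewrite [X in is_derive _ _ _ X]/flat x0.
  apply: (@near_eq_is_derive _ R R (fun x : R => p.[x^-1] * expR (- x^-1))).
    near=> z; rewrite /flat ifT//; near: z; exact: lt_nbhsr.
  have xn0 : x != 0 by rewrite gt_eqF.
  have dV : is_derive x (1 : R) (fun y : R => y^-1) (- x ^- 2).
    apply: (is_derive_eq (is_deriveV (f := id) xn0 (is_derive_id x 1))).
    by rewrite [_ *: _]mulr1.
  have dp : is_derive (x^-1) (1 : R) (horner p) p^`().[x^-1].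
    apply: DeriveDef; first exact: derivable_horner.
    by rewrite -derive1E -derivE.
  have dpx := @is_derive1_comp R (horner p) (fun y : R => y^-1) x _ _ dp dV.
  have dNV : is_derive x (1 : R) (fun y : R => - y^-1) (x ^- 2).
    by apply: (is_derive_eq (is_deriveN dV)); rewrite opprK.
  have dex := @is_derive1_comp R (@expR R) (fun y : R => - y^-1) x _ _
    (is_derive_expR (- x^-1)) dNV.
  apply: (is_derive_eq (is_deriveM dpx dex)).
  rewrite /= /flat_deriv hornerM hornerXn hornerD hornerN.
  rewrite -!/(GRing.mul _ _) /= -[x ^- 2]exprVn.
  by rewrite ![_ *: _]mulrC; ring.
- rewrite x0 [X in is_derive _ _ _ X]/flat ltxx.
  have [K [K0 HK]] := flat_bound p.
  have cv : (fun h : R => h^-1 *: ((flat p \o shift (0 : R)) (h *: (1 : R)) - flat p 0)) @ 0^' -->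
      (0 : R).
    apply/cvgrPdist_le => e e0; near=> h.
    rewrite sub0r normrN /= addr0 [h *: 1]mulr1 {2}/flat ltxx subr0 [_ *: _]mulrC normrM.
    have hn0 : h != 0 by near: h; exact: nbhs_dnbhs_neq.
    have h1 : `|h| <= 1.
      near: h; apply: nbhs_dnbhs; apply: (@nbhs0_le _ R); exact: ltr01.
    have h2 : `|h| <= e / (K + 1).
      near: h; apply: nbhs_dnbhs; apply: (@nbhs0_le _ R); rewrite divr_gt0//; lra.
    apply: (@le_trans _ _ (K * h ^+ 2 * `|h^-1|)); first by rewrite ler_wpM2r// HK.
    rewrite -[h ^+ 2]ger0_norm ?sqr_ge0// -mulrA -normrM expr2 mulfK//.
    apply: (@le_trans _ _ (K * (e / (K + 1)))); first by rewrite ler_wpM2l.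
    have K1 : 0 < K + 1 by lra.
    apply: (@le_trans _ _ ((K + 1) * (e / (K + 1)))).
      by rewrite ler_wpM2r ?lerDl// ltW// divr_gt0.
    by rewrite mulrCA divff ?mulr1// gt_eqF.
  apply: DeriveDef; first by apply/cvg_ex; exists 0.
  exact: cvg_lim cv.
Unshelve. all: by end_near. Qed.

Lemma smooth1_flat p : smooth1 (flat p).
Proof.
move=> n; elim: n p => [|n IH] p; first exact: has_deriv_continuous (flat_has_deriv p).
by exists (flat (flat_deriv p)); split; [exact: flat_has_deriv|exact: IH].
Qed.

End smooth_line.

Section smooth_step.
Context {R : realType}.
Implicit Types x : R.

Let e := flat (1 : {poly R}).
Let de := flat (flat_deriv (1 : {poly R})).
Let den x := e x + e (-1 * x + 1).
Let dden x := de x + -1 * de (-1 * x + 1).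

Let e_ge0 x : 0 <= e x.
Proof.
by rewrite /e /flat; case: ifP => // _; rewrite hornerC mul1r expR_ge0.
Qed.

Let e_gt0 x : 0 < x -> 0 < e x.
Proof. by move=> x0; rewrite /e /flat x0 hornerC mul1r expR_gt0. Qed.

Let e_eq0 x : x <= 0 -> e x = 0.
Proof. by move=> x0; rewrite /e /flat ltNge x0. Qed.

Let de_ge0 x : 0 <= de x.
Proof.
rewrite /de /flat; case: ifP => // _.
by rewrite /flat_deriv derivC subr0 mulr1 hornerXn mulr_ge0 ?expR_ge0// sqr_ge0.
Qed.

Let de_eq0 x : x <= 0 -> de x = 0.
Proof. by move=> x0; rewrite /de /flat ltNge x0. Qed.

Let de_gt0 x : 0 < x -> 0 < de x.
Proof.
move=> x0; rewrite /de /flat x0 /flat_deriv derivC subr0 mulr1 hornerXn.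
by rewrite mulr_gt0 ?expR_gt0// exprn_gt0// invr_gt0.
Qed.

Let den_gt0 x : 0 < den x.
Proof.
rewrite /den; have [x0|x0] := ltP 0 x.
  by rewrite ltr_pwDl// e_gt0.
by rewrite ltr_wpDl// e_gt0//; lra.
Qed.

Let den_neq0 x : den x != 0.
Proof. by rewrite gt_eqF// den_gt0. Qed.

(** The smooth transition e(x) / (e(x) + e(1 - x)). The bump is defined through this explicit
    primitive so that differences of rescaled bumps have explicit compactly supported primitives. *)
Definition step x := e x * (den x)^-1.

(** Quotient rule after cancellation of the terms e e', a form in which the sign is visible. *)
Definition bump x := (de x * e (1 - x) + e x * de (1 - x)) * ((den x)^-1 * (den x)^-1).

Let dedenE : has_deriv den dden.
Proof.
apply: has_derivD; first exact: flat_has_deriv.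
exact: (has_deriv_affine (-1) 1 (flat_has_deriv _)).
Qed.

Lemma step_has_deriv : has_deriv step bump.
Proof.
move=> x; have := has_derivM (flat_has_deriv 1) (has_derivV den_neq0 dedenE) x.
move=> H; apply: (is_derive_eq H); rewrite -/e -/de /bump /dden.
have -> : 1 - x = -1 * x + 1 by ring.
have E : (den x)^-1 = den x * ((den x)^-1 * (den x)^-1).
  by rewrite mulrA divff ?mul1r.
by rewrite [X in _ * X + _]E; set w := _ * _^-1; rewrite /den; ring.
Qed.

Lemma smooth1_step : smooth1 step.
Proof.
have Se : smooth1 e := smooth1_flat 1.
move=> n; apply: CnM; first exact: Se.
apply: CnV => //; apply: CnD; first exact: Se.
exact: (Cn_affine (-1) 1 (Se n)).
Qed.

Lemma smooth1_bump : smooth1 bump.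
Proof. exact: smooth1_deriv step_has_deriv smooth1_step. Qed.

Lemma step_eq0 x : x <= 0 -> step x = 0.
Proof. by move=> x0; rewrite /step e_eq0// mul0r. Qed.

Lemma step_eq1 x : 1 <= x -> step x = 1.
Proof.
move=> x1; rewrite /step /den (@e_eq0 (-1 * x + 1)) ?addr0 ?divff//; last lra.
by rewrite gt_eqF// e_gt0//; lra.
Qed.

Lemma step_ge0 x : 0 <= step x.
Proof. by rewrite mulr_ge0// invr_ge0 ltW. Qed.

Lemma step_le1 x : step x <= 1.
Proof. by rewrite ler_pdivrMr// mul1r /den lerDl. Qed.

Lemma bump_ge0 x : 0 <= bump x.
Proof.
by apply: mulr_ge0; [rewrite addr_ge0// mulr_ge0|rewrite mulr_ge0// invr_ge0 ltW].
Qed.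

Lemma bump_gt0 x : 0 < x -> x < 1 -> 0 < bump x.
Proof.
move=> x0 x1; apply: mulr_gt0; last by rewrite mulr_gt0// invr_gt0.
by apply: addr_gt0; apply: mulr_gt0; rewrite ?e_gt0 ?de_gt0//; lra.
Qed.

Lemma bump_supp x : bump x != 0 -> 0 < x < 1.
Proof.
rewrite /bump; have [x0|x0] := ltP 0 x; last first.
  by rewrite (de_eq0 x0) (e_eq0 x0) !mul0r addr0 mul0r eqxx.
have [//|x1] := ltP x 1.
have x1' : 1 - x <= 0 by lra.
by rewrite (de_eq0 x1') (e_eq0 x1') !mulr0 addr0 mul0r eqxx.
Qed.

Lemma continuous_supp_bounded (f : R -> R) : continuous f ->
  (forall x, ~ (0 <= x <= 1) -> f x = 0) -> exists C, 0 <= C /\ forall x, `|f x| <= C.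
Proof.
move=> cf f0.
have : compact (f @` `[0, 1]%classic).
  by apply: continuous_compact; [exact: continuous_subspaceT|exact: segment_compact].
move=> /compact_bounded[M [Mr HM]]; exists (`|M| + 1); split; first by rewrite addr_ge0.
move=> x; have [x01|x01] := boolP (0 <= x <= 1).
  apply: HM; first by rewrite (le_lt_trans (ler_norm _))// ltrDl.
  by exists x => //=; rewrite in_itv.
by rewrite f0 ?normr0 ?addr_ge0//; exact/negP.
Qed.

Lemma bump_bounds : exists (C : R) (db : R -> R), [/\ 1 <= C, has_deriv bump db,
  forall x, db x != 0 -> 0 <= x <= 1, forall x, `|bump x| <= C &
  forall x, `|db x| <= C].
Proof.
have [db [Hdb Sdb]] := smooth1_has_deriv smooth1_bump.
have [C1 [C10 H1]] : exists C, 0 <= C /\ forall x, `|bump x| <= C.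
  apply: continuous_supp_bounded; first exact/smooth1_continuous/smooth1_bump.
  move=> x nx; apply/eqP; apply: contra_notT nx => /bump_supp /andP[a b].
  by apply/andP; split; lra.
have db0 x : ~ (0 <= x <= 1) -> db x = 0.
  move=> /negP; rewrite negb_and -!ltNge => nx.
  have [_ <-] := Hdb x.
  rewrite (@near_eq_derive _ R R bump (fun=> 0 : R)) ?derive_cst//.
  case/orP : nx => nx; near=> z; apply/eqP; apply/negPn/negP => /bump_supp /andP[a b].
    by have : z < 0 by [near: z; exact: lt_nbhsl]; lra.
  by have : 1 < z by [near: z; exact: lt_nbhsr]; lra.
have [C2 [C20 H2]] : exists C, 0 <= C /\ forall x, `|db x| <= C.
  by apply: continuous_supp_bounded => //; exact: smooth1_continuous.
exists (C1 + C2 + 1), db; split=> // [|x|x|x]; first lra.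
- by apply: contraNT => /negP /db0 ->.
- by have := H1 x; lra.
- by have := H2 x; lra.
Unshelve. all: by end_near. Qed.

Lemma bump_lower : exists h0 s : R, [/\ 0 < h0, 0 < s, s <= 1 &
  forall x, 2^-1 - s <= x <= 2^-1 + s -> h0 <= bump x].
Proof.
have b0 : 0 < bump 2^-1 by apply: bump_gt0; lra.
have cb : continuous bump := smooth1_continuous smooth1_bump.
have h0 : 0 < bump 2^-1 / 2 by lra.
have := cb 2^-1; move=> /cvgrPdist_le /(_ _ h0) /nbhs_ballP[s /= s0 Hs].
exists (bump 2^-1 / 2), (Num.min 1 (s / 2)); split=> //.
- by rewrite lt_min ltr01 /=; lra.
- by rewrite ge_min lexx.
- move=> x /andP[x1 x2].
  have m2 : Num.min 1 (s / 2) <= s / 2 by rewrite ge_min lexx orbT.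
  have : `|bump 2^-1 - bump x| <= bump 2^-1 / 2.
    apply: Hs; rewrite /ball /=; rewrite ltr_norml; apply/andP; split; lra.
  by rewrite ler_norml => /andP[? ?]; lra.
Qed.

End smooth_step.

(** * Product kernels, their reflections and their bounds *)

Section tensor.
Context {R : realType} {N : nat}.
Local Notation T := (N.-tuple R).

Definition tens (G : 'I_N -> R -> R) (z : T) : R := \prod_i G i (tnth z i).

Definition upd (G : 'I_N -> R -> R) (l : 'I_N) (g : R -> R) (i : 'I_N) : R -> R :=
  if i == l then g else G i.

Lemma is_derive_line (f : 'rV[R]_N -> R) (x v : 'rV[R]_N) (d : R) :
  is_derive (0 : R) (1 : R) (fun h : R => f (h *: v + x)) d -> is_derive x v f d.
Proof.
have E : (fun h : R => h^-1 *: (((fun h : R => f (h *: v + x)) \o shift (0 : R)) (h *: (1 : R)) -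
    f (0 *: v + x))) =
  (fun h : R => h^-1 *: ((f \o shift x) (h *: v) - f x)).
  apply/funext => h /=; rewrite scale0r add0r; congr (_ *: (f _ - _)).
  by rewrite [h *: 1]mulr1 addr0.
by move=> [d1 d2]; apply: DeriveDef; rewrite -?d2 /derivable /derive -E.
Qed.

Lemma prod_upd (G : 'I_N -> R -> R) l g (a : 'I_N -> R) :
  \prod_i upd G l g i (a i) = g (a l) * \prod_(i | i != l) G i (a i).
Proof.
rewrite (bigD1 l)//= /upd eqxx; congr (_ * _).
by apply: eq_bigr => i /negbTE ->.
Qed.

Lemma upd_id G l : upd G l (G l) = G.
Proof. by apply/funext => i; rewrite /upd; case: eqP => // ->. Qed.

Definition tensr (G : 'I_N -> R -> R) (x : 'rV[R]_N) : R := \prod_i G i (x ord0 i).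

Lemma tens_rowE G : tens G \o @tuple_of_row R N = tensr G.
Proof. by apply/funext => x; apply: eq_bigr => i _; rewrite tnth_mktuple. Qed.

Lemma tensr_is_derive G l dG (x : 'rV[R]_N) : has_deriv (G l) dG ->
  is_derive x (delta_mx 0 l) (tensr G) (tensr (upd G l dG) x).
Proof.
move=> HG; apply: is_derive_line.
pose c := \prod_(i | i != l) G i (x ord0 i).
rewrite (_ : (fun h : R => _) = fun h : R => G l (1 * h + x ord0 l) * c); last first.
  apply/funext => h; rewrite /tensr -{1}(upd_id G l) prod_upd; congr (G l _ * _).
    by rewrite !mxE !eqxx mulr1 mul1r.
  apply: eq_bigr => i il; rewrite !mxE eqxx (negbTE il) /= mulr0 add0r//.
have := has_derivM (has_deriv_affine 1 (x ord0 l) HG) (has_deriv_cst c) (0 : R).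
move=> H; apply: (is_derive_eq H).
by rewrite /= !mulr0 add0r addr0 mul1r /tensr prod_upd.
Qed.

Lemma tensr_continuous G : (forall i, continuous (G i)) -> continuous (tensr G).
Proof.
move=> cG; rewrite /tensr; elim: (index_enum _) => [|i s IH].
  rewrite (_ : (fun x => _) = fun=> 1); first exact: cst_continuous.
  by apply/funext => x; rewrite big_nil.
rewrite (_ : (fun x => _) = fun x : 'rV[R]_N => G i (x ord0 i) * \prod_(j <- s) G j (x ord0 j)).
  move=> x; apply: cvgM; [exact: (nbhs_filter x)| |exact: IH].
  apply: (@continuous_comp _ _ _ (fun y : 'rV[R]_N => y ord0 i) (G i)); last exact: cG.
  exact: coord_continuous.
by apply/funext => x; rewrite big_cons.
Qed.

Lemma tens_test_fun (G : 'I_N -> R -> R) (b : R) : (forall i, smooth1 (G i)) ->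
  (forall i x, G i x != 0 -> `|x| <= b) -> test_fun (tens G).
Proof.
move=> SG Gb.
(* A partial derivative of a product function is again one, with a single factor differentiated, so
   all iterated partials are handled by induction on [s]. *)
have E s : exists G', (forall i, smooth1 (G' i)) /\
    foldr (@partial R N) (tens G \o @tuple_of_row R N) s = tensr G'.
  elim: s => [|k s [G' [SG' IH]]] /=; first by exists G; rewrite tens_rowE.
  rewrite IH.
  have [dG [HdG SdG]] := smooth1_has_deriv (SG' k).
  exists (upd G' k dG); split.
    by move=> i; rewrite /upd; case: eqP.
  apply/funext => x; rewrite /partial.
  by have [_ ->] := tensr_is_derive x HdG.
split.
  move=> s; have [G' [SG' ->]] := E s; split.
    by apply: tensr_continuous => i; exact: smooth1_continuous.
  move=> k x; have [dG [HdG _]] := smooth1_has_deriv (SG' k).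
  by have [] := tensr_is_derive x HdG.
rewrite tens_rowE.
pose b' := `|b|.
have sub : [set x | tensr G x != 0] `<=` [set x : 'rV[R]_N | `|x| <= b'].
  move=> x /= /prodf_neq0 H; apply: norm_le_coord => [|i].
    exact: normr_ge0.
  by apply: le_trans (ler_norm b); exact: Gb (H i isT).
have cl : closed [set x : 'rV[R]_N | `|x| <= b'].
  rewrite (_ : [set x | _] = Num.norm @^-1` [set y : R | y <= b'])//.
  apply: preimage_closed; first by move=> x _; exact: norm_continuous.
  exact: closed_le.
apply: bounded_closed_compact; last exact: closed_closure.
exists b'; split; first exact: num_real.
move=> M bM x /= xc; apply: (@le_trans _ _ b'); last exact: ltW.
by move: xc => /(closure_subset sub); rewrite -(closure_id _).1.
Qed.

Lemma dpartial_tens G l dG (z : T) : has_deriv (G l) dG ->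
  dpartial l (tens G) z = tens (upd G l dG) z.
Proof.
move=> HG; rewrite /dpartial tens_rowE /partial.
have [_ ->] := tensr_is_derive (\row_i tnth z i) HG.
by apply: eq_bigr => i _; rewrite mxE.
Qed.

End tensor.

Section tensor_reflection.
Context {R : realType} {N : nat}.
Local Notation T := (N.-tuple R).

Definition reflect_at (x : T) (G : 'I_N -> R -> R) (i : 'I_N) (w : R) : R :=
  G i (-1 * w + tnth x i).

(** The kernel y |-> g(x - y) of a convolution is itself a product, hence a test function that may
    be inserted into the closedness of [u]. *)
Lemma tens_reflect G (x y : T) : tens G (tsub x y) = tens (reflect_at x G) y.
Proof.
apply: eq_bigr => i _; rewrite /reflect_at tnth_tsub; congr (G i _); ring.
Qed.

Lemma reflect_test_fun G (x : T) (b : R) : (forall i, smooth1 (G i)) ->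
  (forall i w, G i w != 0 -> `|w| <= b) -> test_fun (fun y => tens G (tsub x y)).
Proof.
move=> SG Gb; rewrite (funext (tens_reflect G x)).
apply: (@tens_test_fun _ _ _ (b + \sum_i `|tnth x i|)).
  by move=> i n; exact: (Cn_affine (-1) (tnth x i) (SG i n)).
move=> i w /Gb H; rewrite (_ : w = tnth x i - (-1 * w + tnth x i)); last ring.
rewrite [leRHS]addrC (le_trans (ler_normB _ _))// lerD//.
by rewrite (bigD1 i)//= lerDl sumr_ge0.
Qed.

Lemma dpartial_reflect G (x y : T) l : smooth1 (G l) ->
  dpartial l (fun y => tens G (tsub x y)) y = - dpartial l (tens G) (tsub x y).
Proof.
move=> /smooth1_has_deriv[dG [HG _]].
rewrite (funext (tens_reflect G x)) (dpartial_tens _ HG) tens_reflect.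
rewrite (dpartial_tens _ (has_deriv_affine (-1) (tnth x l) HG)).
have -> : reflect_at x (upd G l dG) =
    upd (reflect_at x G) l (fun w => dG (-1 * w + tnth x l)).
  apply/funext => i; apply/funext => w; rewrite /reflect_at /upd.
  by case: eqP => // ->.
by rewrite /tens !prod_upd -mulNr; congr (_ * _); exact: mulN1r.
Qed.

End tensor_reflection.

Section kernels.
Context {R : realType} {N : nat}.
Local Notation T := (N.-tuple R).

Definition scale (k : nat) : R := 2 ^+ k.

Lemma scale_gt0 k : 0 < scale k. Proof. by rewrite exprn_gt0. Qed.

Lemma scale_ge1 k : 1 <= scale k. Proof. by rewrite exprn_ege1// ler1n. Qed.

Lemma scaleS k : scale k.+1 = 2 * scale k. Proof. exact: exprS. Qed.

Definition bumpk k (x : R) : R := scale k * bump (scale k * x).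

(** Compactly supported because both steps are 0 on the left and 1 on the right. *)
Definition stepdiff k (x : R) : R := step (scale k.+1 * x) - step (scale k * x).

Let step_scale k : has_deriv (fun x : R => step (scale k * x)) (bumpk k).
Proof.
have := has_deriv_affine (scale k) 0 (@step_has_deriv R).
rewrite (_ : (fun x => step (scale k * x + 0)) = fun x => step (scale k * x)).
  by move=> H x; apply: (is_derive_eq (H x)); rewrite addr0.
by apply/funext => x; rewrite addr0.
Qed.

Lemma stepdiff_has_deriv k : has_deriv (stepdiff k) (fun x => bumpk k.+1 x - bumpk k x).
Proof.
have H := has_derivD (step_scale k.+1)
  (has_derivM (has_deriv_cst (-1)) (step_scale k)).
rewrite (_ : stepdiff k = fun x => step (scale k.+1 * x) + -1 * step (scale k * x)).
  by move=> x; apply: (is_derive_eq (H x)); ring.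
by apply/funext => x; rewrite /stepdiff mulN1r.
Qed.

Lemma smooth1_bumpk k : smooth1 (bumpk k).
Proof.
move=> n; apply: CnM; first exact: Cn_cst.
have := Cn_affine (scale k) 0 (@smooth1_bump R n).
by under eq_fun do rewrite addr0.
Qed.

Lemma smooth1_stepdiff k : smooth1 (stepdiff k).
Proof.
have S m n : Cn n (fun x : R => step (scale m * x)).
  have := Cn_affine (scale m) 0 (@smooth1_step R n).
  by under eq_fun do rewrite addr0.
move=> n; rewrite (_ : stepdiff k = fun x => step (scale k.+1 * x) + -1 * step (scale k * x)).
  by apply: CnD => //; apply: CnM => //; exact: Cn_cst.
by apply/funext => x; rewrite /stepdiff mulN1r.
Qed.

Lemma bumpk_supp k x : bumpk k x != 0 -> 0 < x < (scale k)^-1.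
Proof.
rewrite mulf_eq0 negb_or => /andP[_ /bump_supp /andP[a b]].
by rewrite pmulr_rgt0 ?scale_gt0// in a; rewrite a -[ltRHS]mul1r ltr_pdivlMr ?scale_gt0// mulrC.
Qed.

Lemma bumpk_suppS k x : bumpk k.+1 x != 0 -> 0 < x < (scale k)^-1.
Proof.
move=> /bumpk_supp /andP[-> H]; apply: lt_le_trans H _.
by rewrite lef_pV2 ?posrE ?scale_gt0// scaleS ler_peMl ?ler1n// ltW// scale_gt0.
Qed.

Lemma stepdiff_supp k x : stepdiff k x != 0 -> 0 < x < (scale k)^-1.
Proof.
rewrite /stepdiff; have [x0|x0] := ltP 0 x; last first.
  by rewrite !step_eq0 ?subrr ?eqxx// mulr_ge0_le0// ltW// scale_gt0.
have [//|x1] := ltP x (scale k)^-1.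
have : 1 <= scale k * x by rewrite mulrC -ler_pdivrMr ?scale_gt0// div1r.
move=> H; rewrite !step_eq1 ?subrr ?eqxx// scaleS -mulrA.
by rewrite (le_trans H)// ler_peMl ?ler1n// (le_trans _ H).
Qed.

Lemma stepdiff_le1 k x : `|stepdiff k x| <= 1.
Proof.
rewrite /stepdiff; move: (step_ge0 (scale k.+1 * x)) (step_le1 (scale k.+1 * x))
  (step_ge0 (scale k * x)) (step_le1 (scale k * x)) => ? ? ? ?.
by rewrite ler_norml; apply/andP; split; lra.
Qed.

Definition eta (k : nat) : T -> R := tens (fun=> bumpk k).

(** Factors of the i-th hybrid: those before i are already at scale k+1, those after i still at
    scale k, and the i-th is the primitive of the exchanged difference. *)
Definition mix (k : nat) (i j : 'I_N) : R -> R :=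
  if (j < i)%N then bumpk k.+1 else if j == i then stepdiff k else bumpk k.

Definition pot (k : nat) (i : 'I_N) : T -> R := tens (mix k i).

Lemma smooth1_mix k i j : smooth1 (mix k i j).
Proof.
rewrite /mix; case: ifP => _; first exact: smooth1_bumpk.
by case: ifP => _; [exact: smooth1_stepdiff|exact: smooth1_bumpk].
Qed.

Lemma mix_supp k i j x : mix k i j x != 0 -> 0 < x < (scale k)^-1.
Proof.
rewrite /mix; case: ifP => _; first exact: bumpk_suppS.
by case: ifP => _; [exact: stepdiff_supp|exact: bumpk_supp].
Qed.

Let supp_norm k (g : R -> R) : (forall x, g x != 0 -> 0 < x < (scale k)^-1) ->
  forall x, g x != 0 -> `|x| <= (scale k)^-1.
Proof. by move=> H x /H /andP[a b]; rewrite gtr0_norm// ltW. Qed.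

Lemma tens_supp (G : 'I_N -> R -> R) (t : R) :
  (forall i x, G i x != 0 -> 0 < x < t) ->
  forall z, tens G z != 0 -> forall i, 0 < tnth z i < t.
Proof. by move=> H z /prodf_neq0 Hz i; exact: H (Hz i isT). Qed.

Lemma eta_supp k z : eta k z != 0 -> forall i, 0 < tnth z i < (scale k)^-1.
Proof. by apply: tens_supp => i x; exact: bumpk_supp. Qed.

Lemma pot_supp k i z : pot k i z != 0 -> forall j, 0 < tnth z j < (scale k)^-1.
Proof. by apply: tens_supp => j x; exact: mix_supp. Qed.

Lemma eta_test_fun k : test_fun (eta k).
Proof.
apply: (@tens_test_fun _ _ _ (scale k)^-1) => [i|i x].
  exact: smooth1_bumpk.
exact: (supp_norm (@bumpk_supp k)).
Qed.

Lemma pot_test_fun k i : test_fun (pot k i).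
Proof.
apply: (@tens_test_fun _ _ _ (scale k)^-1) => [j|j x].
  exact: smooth1_mix.
exact: (supp_norm (@mix_supp k i j)).
Qed.

Lemma pot_reflect_test_fun k i (x : T) : test_fun (fun y => pot k i (tsub x y)).
Proof.
apply: (@reflect_test_fun _ _ _ _ (scale k)^-1) => [j|j w].
  exact: smooth1_mix.
exact: (supp_norm (@mix_supp k i j)).
Qed.

Lemma eta_reflect_test_fun k (x : T) : test_fun (fun y => eta k (tsub x y)).
Proof.
apply: (@reflect_test_fun _ _ _ _ (scale k)^-1) => [j|j w].
  exact: smooth1_bumpk.
exact: (supp_norm (@bumpk_supp k)).
Qed.

(** The i-th derivative turns [stepdiff] into a difference of bumps, that is, into the difference of
    two consecutive hybrid products [E]; these telescope from [eta k] to [eta k.+1]. *)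
Lemma sum_dpot k (z : T) : \sum_i dpartial i (pot k i) z = eta k.+1 z - eta k z.
Proof.
pose E m := \prod_(j < N) (if (j < m)%N then bumpk k.+1 else bumpk k) (tnth z j).
have EN : eta k.+1 z = E N.
  by apply: eq_bigr => j _; rewrite ltn_ord.
have E0 : eta k z = E 0%N by [].
rewrite EN E0 -(telescope_sumr E (leq0n N)) big_mkord; apply: eq_bigr => i _.
have mi : mix k i i = stepdiff k by rewrite /mix ltnn eqxx.
have Hd : has_deriv (mix k i i) (fun x => bumpk k.+1 x - bumpk k x).
  by rewrite mi; exact: stepdiff_has_deriv.
have EE m : E m = (if (i < m)%N then bumpk k.+1 else bumpk k) (tnth z i) *
    \prod_(j < N | j != i) (if (j < m)%N then bumpk k.+1 else bumpk k) (tnth z j).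
  by rewrite /E (bigD1 i).
rewrite (dpartial_tens _ Hd) /tens prod_upd !EE ltnSn ltnn mulrBl.
congr (_ * _ - _ * _); apply: eq_bigr => j ji; rewrite /mix (negbTE ji) ?ltnS.
  by rewrite [(j <= i)%N]leq_eqVlt -[(j == i :> nat)]/(j == i) (negbTE ji).
by [].
Qed.

Lemma tens_le (G : 'I_N -> R -> R) (K : 'I_N -> R) z :
  (forall i x, `|G i x| <= K i) -> `|tens G z| <= \prod_i K i.
Proof.
by move=> H; rewrite normr_prod; apply: ler_prod => i _; rewrite normr_ge0 H.
Qed.

Lemma kernel_bounds : exists D : R, 0 < D /\ forall k,
  [/\ forall z, `|eta k z| <= D * scale k ^+ N,
      forall l z, `|dpartial l (eta k) z| <= scale k * (D * scale k ^+ N),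
      forall l z, dpartial l (eta k) z != 0 ->
        forall i, 0 <= tnth z i <= (scale k)^-1 &
      forall i z, scale k * `|pot k i z| <= D * scale k ^+ N].
Proof.
have [C [db [C1 Hdb sdb bC dC]]] := @bump_bounds R.
(* 2 C and not C, because factors at scale k+1 are to be bounded in terms of scale k. *)
exists ((2 * C) ^+ N); split; first by rewrite exprn_gt0//; lra.
move=> k; have a1 := scale_ge1 k; have a0 := scale_gt0 k.
have bk m x : `|bumpk m x| <= C * scale m.
  rewrite /bumpk normrM gtr0_norm ?scale_gt0// mulrC ler_wpM2r//.
  by rewrite ltW// scale_gt0.
have Ca0 : 0 < C * scale k by rewrite mulr_gt0//; lra.
have pC : \prod_(i < N) (2 * C * scale k) = (2 * C) ^+ N * scale k ^+ N.
  by rewrite prodr_const card_ord exprMn.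
pose A := 2 * C * scale k.
have pD1 l : \prod_(i < N) A = A * \prod_(i < N | i != l) A by rewrite (bigD1 l).
have pD l (x : R) : \prod_(i < N) (if i == l then x else A) =
    x * \prod_(i < N | i != l) A.
  by rewrite (bigD1 l)//= eqxx; congr (_ * _); apply: eq_bigr => i /negbTE ->.
have CC : C * scale k <= 2 * C * scale k by rewrite -mulrA ler_peMl ?ler1n// ltW.
have Hb : has_deriv (bumpk k) (fun x => scale k * (scale k * db (scale k * x))).
  move=> x; have := has_derivM (has_deriv_cst (scale k))
    (has_deriv_affine (scale k) 0 Hdb) x.
  rewrite (_ : (fun x => scale k * _) = bumpk k); last first.
    by apply/funext => y; rewrite /bumpk addr0.
  by move=> H; apply: (is_derive_eq H); rewrite mul0r add0r addr0.
split.
- move=> z; rewrite -pC; apply: tens_le => i x; exact: le_trans (bk k x) CC.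
- move=> l z; rewrite (dpartial_tens _ Hb).
  apply: (le_trans (tens_le (K := fun i => if i == l then scale k * (2 * C * scale k)
     else 2 * C * scale k) _ _)).
    move=> i x; rewrite /upd; case: eqP => _; last exact: le_trans (bk k x) CC.
    rewrite normrM gtr0_norm// ler_wpM2l// ?(ltW a0)// normrM gtr0_norm// mulrC.
    apply: le_trans CC; rewrite ler_wpM2r// ltW//.
  by rewrite (pD l (scale k * (2 * C * scale k))) -pC (pD1 l) [leRHS]mulrA.
- move=> l z; rewrite (dpartial_tens _ Hb) => /prodf_neq0 Hz i.
  have := Hz i isT; rewrite /upd; case: (eqVneq i l) => _.
    rewrite /= !mulf_eq0 !negb_or => /andP[_ /andP[_ /sdb]].
    rewrite pmulr_rge0// => /andP[-> H] /=.
    by rewrite -[leRHS]mul1r ler_pdivlMr// mulrC.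
  by move=> /bumpk_supp /andP[/ltW -> /ltW ->].
- move=> i z.
  have := tens_le (K := fun j => if j == i then 1 else 2 * C * scale k)
    (G := mix k i) z.
  have H0 : forall j x, `|mix k i j x| <= (if j == i then 1 else 2 * C * scale k).
    move=> j x; rewrite /mix; case: ltngtP => [ji|ji|/val_inj ->].
    - rewrite ifF; last by apply/negbTE; rewrite -[j == i]/(j == i :> nat) neq_ltn ji.
      by apply: le_trans (bk _ _) _; rewrite scaleS mulrCA mulrA.
    - rewrite ifF; last by apply/negbTE; rewrite -[j == i]/(j == i :> nat) neq_ltn ji orbT.
      rewrite ifF; last by apply/negbTE; rewrite -[j == i]/(j == i :> nat) neq_ltn ji orbT.
      exact: le_trans (bk k x) CC.
    - by rewrite !eqxx; exact: stepdiff_le1.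
  move=> /(_ H0); rewrite (pD i 1) mul1r -pC (pD1 i) => H1.
  apply: ler_pM => //; first exact: ltW.
  by rewrite ler_peMl// ?(ltW a0)//; lra.
Qed.

Context {mu : {measure set T -> \bar R}}.
Hypothesis leb : is_lebesgue mu.

Definition eta_mass : R := \int[mu]_y eta 0 (tsub (tcst 0) y).

Let csupp_reflect k (x : T) : csupp (fun y => eta k (tsub x y)).
Proof. exact/test_fun_csupp/eta_reflect_test_fun. Qed.

Lemma intg_eta_reflect k (x : T) : intg mu (fun y => eta k (tsub x y)).
Proof.
have [m _ [C [_ b _ _]]] := test_fun_C11 (eta_reflect_test_fun k x).
exact: (intg_csupp leb m b (csupp_reflect k x)).
Qed.

(** No change of variables: consecutive mollifiers differ by derivatives of compactly supported
    functions, whose integrals vanish. *)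
Lemma Rint_eta k (x : T) : \int[mu]_y eta k (tsub x y) = eta_mass.
Proof.
have [m _ [C [_ b _ _]]] := test_fun_C11 (eta_test_fun k).
rewrite (Rint_tsub_const leb x m b (test_fun_csupp (eta_test_fun k))).
rewrite /eta_mass; elim: k {m b} => [//|k IH].
rewrite -IH; apply/eqP; rewrite -subr_eq0 -RintB; [|exact: intg_eta_reflect..].
have E i y : dpartial i (pot k i) (tsub (tcst 0) y) =
    - dpartial i (fun y => pot k i (tsub (tcst 0) y)) y.
  by rewrite /pot dpartial_reflect ?opprK//; exact: smooth1_mix.
have cP i := test_fun_C11 (pot_reflect_test_fun k i (tcst 0)).
have sP i := test_fun_csupp (pot_reflect_test_fun k i (tcst 0)).
have i1 i : intg mu (fun y => dpartial i (fun y => pot k i (tsub (tcst 0) y)) y).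
  have [_ m' [C' [_ _ b' _]]] := cP i.
  exact: (intg_csupp leb (m' i) (b' i) (csupp_C11' i (cP i) (sP i))).
have -> : \int[mu]_y (eta k.+1 (tsub (tcst 0) y) - eta k (tsub (tcst 0) y)) =
    \int[mu]_y (\sum_i - dpartial i (fun y => pot k i (tsub (tcst 0) y)) y).
  apply: eq_Rintegral => y _; rewrite -sum_dpot.
  by apply: eq_bigr => i _; rewrite E.
rewrite Rint_sum; last by move=> i _; exact: intgN.
rewrite big1// => i _; rewrite RintN// (Rint_partial0 leb i (cP i) (sP i)).
by rewrite oppr0.
Qed.

End kernels.
Arguments eta_mass {R N} mu.

(** Only the volume of one cube enters, so the bound is the same for all admissible [mu]. The cube
    is centred at -1/2 since the kernel is evaluated at -y. *)
Lemma eta_mass_lower (R : realType) (N : nat) : exists c0 : R, 0 < c0 /\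
  forall mu : {measure set (N.-tuple R) -> \bar R}, is_lebesgue mu ->
  c0 <= eta_mass mu.
Proof.
have [h0 [s [h00 s0 s1 Hh]]] := @bump_lower R.
exists (h0 ^+ N * (2 * s) ^+ N); split.
  by rewrite mulr_gt0// exprn_gt0// mulr_gt0.
move=> mu leb.
pose Q : set (N.-tuple R) := cube (tcst (- 2^-1)) s.
have mQ : measurable Q by exact: measurable_hbox.
have iQ : intg mu (\1_Q : N.-tuple R -> R).
  by apply: intg_indic => //; rewrite (mu_cube leb) ?ltry// ltW.
have -> : (2 * s) ^+ N = \int[mu]_y (\1_Q y : R).
  by rewrite Rint_indic// (mu_cube leb)// ltW.
rewrite -RintZ//; apply: le_Rint; first exact: intgZ.
  exact: intg_eta_reflect.
move=> y; have b0 (z : N.-tuple R) : 0 <= eta 0 z.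
  by apply: prodr_ge0 => i _; rewrite /bumpk mulr_ge0 ?bump_ge0// ltW// scale_gt0.
rewrite indicE; have [/set_mem /cubeE yQ|_] := boolP (y \in Q); last by rewrite mulr0.
rewrite mulr1 /eta /tens -[N in h0 ^+ N]card_ord -prodr_const.
apply: ler_prod => i _; rewrite (ltW h00) /= /bumpk /scale expr0 !mul1r.
apply: Hh; rewrite tnth_tsub tnth_mktuple; have := yQ i; rewrite tnth_mktuple.
by move=> /andP[? ?]; apply/andP; split; lra.
Qed.

Section closed_convolution.
Context {R : realType} {N : nat}.
Local Notation T := (N.-tuple R).
Context {mu : {measure set T -> \bar R}}.
Hypothesis leb : is_lebesgue mu.
Local Open Scope set_scope.
Local Open Scope ring_scope.

(** Weak closedness is tested against the reflected kernel y |-> g(x - y); the minus sign of the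
    reflection is common to all terms. *)
Lemma conv_pclosed (G : 'I_N -> R -> R) (b : R) (U : {set 'I_N} -> T -> R) :
  (forall i, smooth1 (G i)) -> (forall i x, G i x != 0 -> `|x| <= b) ->
  wclosed (mu := mu) U ->
  pclosed (fun I l => conv mu (dpartial l (tens G)) (U I)).
Proof.
move=> SG Gb [aU cU] M x.
have tp := reflect_test_fun x SG Gb.
rewrite -[RHS]oppr0 -[X in _ = - X](cU M _ tp) -sumrN; apply: eq_bigr => m _.
rewrite -mulrN; congr (_ * _); rewrite /conv -RintN; last exact: aU.
by apply: eq_Rintegral => y _; rewrite dpartial_reflect// mulNr opprK.
Qed.

End closed_convolution.

(** * Stopping cubes *)

Section stopping_cubes.
Context {R : realType} {N : nat}.
Local Notation T := (N.-tuple R).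
Context {mu : {measure set T -> \bar R}}.
Hypothesis leb : is_lebesgue mu.
Variables (f : T -> R) (L : R).
Hypotheses (L0 : 0 < L) (f0 : forall x, 0 <= f x) (intf : intg mu f).
Local Notation cell j := (@gcell R N (scale j)).

Definition ancestor (j j' : nat) (z : N.-tuple int) : N.-tuple int :=
  [tuple Num.floor ((tnth z i)%:~R / scale (j - j') : R) | i < N].

(** floor(w / m) = floor(floor(w) / m), valid because m = 2^(j - j') is a positive integer. *)
Lemma gcell_ancestor j j' x : (j' <= j)%N -> cell j' x = ancestor j j' (cell j x).
Proof.
move=> jj'; apply: eq_from_tnth => i; rewrite !tnth_mktuple.
set m := scale (j - j'); have m0 : 0 < m := scale_gt0 _.
set w := scale j * tnth x i.
have -> : scale j' * tnth x i = w / m.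
  have sj : scale j = m * scale j' by rewrite /m /scale -exprD subnK.
  by rewrite /w sj [RHS]mulrC !mulrA mulVf ?mul1r ?gt_eqF.
set z := Num.floor w; set q := Num.floor _.
have /andP[z1 z2] := floor_itv w; have /andP[q1 q2] := floor_itv (z%:~R / m).
apply: floor_def; apply/andP; split.
  by apply: le_trans q1 _; rewrite ler_pM2r ?invr_gt0.
rewrite ltr_pdivrMr//; apply: lt_le_trans z2 _.
have mE : m = (Posz (2 ^ (j - j')))%:~R by rewrite /m /scale -pmulrn natrX.
by move: q2; rewrite ltr_pdivrMr// mE -!intrM ltr_int ler_int lezD1.
Qed.

Definition cube_mass j z : R := \int[mu]_x (\1_(dcube (scale j) z) x * f x).

Definition heavy j z : bool := L * (scale j)^-1 ^+ N < cube_mass j z.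

Definition stopping j z : bool :=
  heavy j z && [forall j' : 'I_j, ~~ heavy j' (ancestor j j' z)].

Definition inflate (j : nat) (z : N.-tuple int) (t : R) : set T :=
  hbox [tuple (tnth z i)%:~R / scale j - t | i < N]
       [tuple (tnth z i + 1)%:~R / scale j + t | i < N].

(** Grows from 4 2^-j at k = j towards 8 2^-j; the increment from k to k+1 is exactly 2 2^-k, as
    [bad_nbhs] needs. *)
Definition radius (j k : nat) : R := 8 * (scale j)^-1 - 4 * (scale k)^-1.

Definition bad (k : nat) : set T :=
  [set x | exists jz : nat * N.-tuple int,
    [/\ (jz.1 <= k)%N, stopping jz.1 jz.2 & inflate jz.1 jz.2 (radius jz.1 k) x]].

Definition badoo : set T := \bigcup_k bad k.

Lemma measurable_bad k : measurable (bad k).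
Proof.
have -> : bad k = \bigcup_(jz : nat * N.-tuple int)
    (if (jz.1 <= k)%N && stopping jz.1 jz.2 then inflate jz.1 jz.2 (radius jz.1 k)
     else set0).
  apply/seteqP; split=> x /=.
    by move=> [jz [a b c]]; exists jz => //; rewrite a b.
  by move=> [jz _]; case: ifP => // /andP[a b] c; exists jz.
apply: countable_bigcupT_measurable; first exact: countableP.
by move=> jz; case: ifP => // _; exact: measurable_hbox.
Qed.

Lemma measurable_badoo : measurable badoo.
Proof. by apply: bigcup_measurable => k _; exact: measurable_bad. Qed.

Lemma bad_nbhs k x y : bad k x ->
  (forall i, `|tnth y i - tnth x i| <= 2 * (scale k)^-1) -> bad k.+1 y.
Proof.
move=> [jz [a b c]] xy; exists jz; split=> //; first exact: leqW.
move=> i; have := c i; rewrite !tnth_mktuple /radius scaleS invfM.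
by have := xy i; rewrite ler_norml => /andP[? ?] /andP[? ?]; apply/andP; split; lra.
Qed.

Lemma badS k x : bad k x -> bad k.+1 x.
Proof.
move=> /bad_nbhs; apply => i; rewrite subrr normr0.
by rewrite mulr_ge0// invr_ge0 ltW// scale_gt0.
Qed.

Lemma bad_le k m x : (k <= m)%N -> bad k x -> bad m x.
Proof.
elim: m => [|m IH]; first by rewrite leqn0 => /eqP ->.
by rewrite leq_eqVlt => /predU1P[->//|km] /(IH km); exact: badS.
Qed.

Lemma dcube_intg j z : intg mu (fun x => \1_(dcube (scale j) z) x * f x).
Proof.
apply: (@intgM _ _ _ _ _ _ 1) => //.
  by apply: measurable_indic; apply: measurable_dcube; exact: scale_gt0.
by move=> x; rewrite indicE; case: (_ \in _); rewrite ?normr1 ?normr0.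
Qed.

(** Takes the least generation at which the cube around [x] is heavy; generations start at 0, so it
    exists. *)
Lemma stopping_heavy j x : heavy j (cell j x) ->
  exists j', (j' <= j)%N /\ stopping j' (cell j' x).
Proof.
move=> hj; have ex : exists j', heavy j' (cell j' x) by exists j.
pose m := ex_minn ex; exists m.
have [hm mm] : heavy m (cell m x) /\ (forall n, heavy n (cell n x) -> (m <= n)%N).
  by rewrite /m; case: ex_minnP.
split; first exact: mm.
apply/andP; split=> //; apply/forallP => j'.
rewrite -gcell_ancestor; last exact: ltnW.
by apply/negP => /mm; rewrite leqNgt ltn_ord.
Qed.

(** The cube has side 2^-k, so its points lie in cells at index distance at most 1 from that of [x]:
    at most 3^N cells, and those that are met are not heavy. *)
Lemma cube_mass_good k x : ~ bad k x ->
  \int[mu]_y (\1_(cube x (scale k.+1)^-1) y * f y) <= 3 ^+ N * (L * (scale k)^-1 ^+ N).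
Proof.
move=> nb.
pose nbr (d : {ffun 'I_N -> 'I_3}) : N.-tuple int :=
  [tuple tnth (cell k x) i + (d i : nat)%:Z - 1 | i < N].
(* Heavy neighbours may be dropped, because by [nh] below they do not meet the cube. *)
pose term d y := if heavy k (nbr d) then 0 else \1_(dcube (scale k) (nbr d)) y * f y.
have iterm d : intg mu (term d).
  have [h|/negbTE h] := boolP (heavy k (nbr d)); rewrite /term h; first exact: intg0.
  exact: dcube_intg.
have a0 : 0 < scale k :> R := scale_gt0 k.
apply: (@le_trans _ _ (\int[mu]_y (\sum_d term d y))).
  apply: le_Rint.
  - apply: (@intgM _ _ _ _ _ _ 1) => //.
      by apply: measurable_indic; exact: measurable_hbox.
    by move=> y; rewrite indicE; case: (_ \in _); rewrite ?normr1 ?normr0.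
  - by apply: intg_sum => d _; exact: iterm.
  move=> y.
  have term0 d : 0 <= term d y by rewrite /term; case: ifP => // _; exact: mulr_ge0.
  rewrite [in leLHS]indicE; have [/set_mem /cubeE yx|_] := boolP (_ \in _); last first.
    by rewrite mul0r sumr_ge0.
  have dist i : `|tnth x i - tnth y i| <= (scale k)^-1 / 2.
    have /andP[h1 h2] := yx i; rewrite scaleS invfM in h1 h2.
    by rewrite ler_norml; apply/andP; split; lra.
  (* Otherwise a stopping cube of generation j' <= k contains [y], and its inflation by at least 4
     2^-j' reaches [x], at distance at most 2^-k / 2. *)
  have nh : ~~ heavy k (cell k y).
    apply/negP => /stopping_heavy[j' [j'k sj']]; apply: nb.
    exists (j', cell j' y); split=> //= i.
    have : dcube (scale j') (cell j' y) y by [].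
    rewrite dcubeE ?scale_gt0// => /(_ i); rewrite !tnth_mktuple /radius.
    have : (scale k)^-1 <= (scale j')^-1 :> R.
      by rewrite lef_pV2 ?posrE ?scale_gt0// /scale ler_weXn2l// ler1n.
    have : 0 < (scale k)^-1 :> R by rewrite invr_gt0.
    have := dist i; rewrite ler_norml => /andP[? ?] ? ? /andP[? ?].
    by apply/andP; split; lra.
  have fl i : (tnth (cell k x) i - 1 <= tnth (cell k y) i <= tnth (cell k x) i + 1)%R.
    rewrite !tnth_mktuple; have := dist i; rewrite ler_norml => /andP[d1 d2].
    have /andP[x1 x2] := floor_itv (scale k * tnth x i).
    have /andP[y1 y2] := floor_itv (scale k * tnth y i).
    have e1 : scale k * tnth x i <= scale k * tnth y i + 1 / 2.
      rewrite -lerBlDl -mulrBr; apply: (@le_trans _ _ (scale k * ((scale k)^-1 / 2))).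
        by rewrite ler_pM2l.
      by rewrite mulrA divff ?gt_eqF.
    have e2 : scale k * tnth y i <= scale k * tnth x i + 1 / 2.
      rewrite -lerBlDl -mulrBr; apply: (@le_trans _ _ (scale k * ((scale k)^-1 / 2))).
        by rewrite ler_pM2l// -[leLHS]opprB; lra.
      by rewrite mulrA divff ?gt_eqF.
    set p := Num.floor _ in x1 x2 *; set q := Num.floor _ in y1 y2 *.
    rewrite !intrD in x2 y2.
    have l1 : p%:~R < (q + 2)%:~R :> R by rewrite intrD; lra.
    have l2 : q%:~R < (p + 2)%:~R :> R by rewrite intrD; lra.
    rewrite !ltr_int in l1 l2; apply/andP; split; lia.
  pose d0 : {ffun 'I_N -> 'I_3} :=
    [ffun i => inord (absz (tnth (cell k y) i - tnth (cell k x) i + 1))].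
  have nd0 : nbr d0 = cell k y.
    apply: eq_from_tnth => i; rewrite tnth_mktuple ffunE.
    by rewrite inordK; have /andP[] := fl i; lia.
  rewrite (bigD1 d0)//= -[leLHS]addr0 lerD ?sumr_ge0//.
  by rewrite /term nd0 (negbTE nh) indicE mem_set.
rewrite Rint_sum//.
apply: (@le_trans _ _ (\sum_(d : {ffun 'I_N -> 'I_3}) L * (scale k)^-1 ^+ N)).
  apply: ler_sum => d _; have [h|h] := boolP (heavy k (nbr d)); last first.
    by rewrite /term (negbTE h); move: h; rewrite -leNgt.
  by rewrite /term h Rint0 mulr_ge0 ?(ltW L0)// exprn_ge0// invr_ge0 ltW.
rewrite sumr_const.
have -> : #|{: {ffun 'I_N -> 'I_3}}| = (3 ^ N)%N by rewrite card_ffun !card_ord.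
by rewrite -[leLHS]mulr_natl natrX.
Qed.

Let pinv (n : nat) : option (nat * N.-tuple int) := pickle_inv n.

Let pinvK jz : pinv (pickle jz) = Some jz.
Proof. exact: pickleK_inv. Qed.

Let pinv_some n jz : pinv n = Some jz -> pickle jz = n.
Proof.
by move=> E; have := @pickle_invK (nat * N.-tuple int)%type n; rewrite -/(pinv n) E.
Qed.

Let sc (n : nat) : set T :=
  if pinv n is Some jz then
    (if stopping jz.1 jz.2 then dcube (scale jz.1) jz.2 else set0) else set0.

Let bc (n : nat) : set T :=
  if pinv n is Some jz then
    (if stopping jz.1 jz.2 then inflate jz.1 jz.2 (8 * (scale jz.1)^-1) else set0)
  else set0.

Let msc n : measurable (sc n).
Proof.
rewrite /sc; case: (pinv _) => // jz; case: ifP => // _.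
by apply: measurable_dcube; exact: scale_gt0.
Qed.

Let mbc n : measurable (bc n).
Proof. by rewrite /bc; case: (pinv _) => // jz; case: ifP => // _; exact: measurable_hbox. Qed.

(** Two stopping cubes with a common point are nested, and the smaller one would have a heavy
    ancestor unless the generations agree. *)
Let sc_inj n m x : sc n x -> sc m x -> n = m.
Proof.
rewrite /sc; case En : (pinv n) => [[j z]|//]; case: ifP => // sz Ez; rewrite /dcube /= in Ez; subst z.
case Em : (pinv m) => [[j' z']|//]; case: ifP => // sz' E'; rewrite /dcube /= in E'.
have Ej : j = j'.
  have aux i i' : stopping i (cell i x) -> heavy i' (cell i' x) -> (i <= i')%N.
    move=> /andP[_ /forallP H] h; rewrite leqNgt; apply/negP => ii'.
    by have := H (Ordinal ii'); rewrite -gcell_ancestor ?h//= ltnW.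
  apply/eqP; rewrite eqn_leq; apply/andP; split.
    apply: aux; first by move: sz => /=.
    by rewrite E'; case/andP: sz'.
  apply: aux; first by rewrite E'.
  by case/andP: sz.
by rewrite -(pinv_some En) -(pinv_some Em) -E' -Ej.
Qed.

Let sum_mass m : \sum_(n < m) \int[mu]_x (\1_(sc n) x * f x) <= \int[mu]_x f x.
Proof.
have i1 n : intg mu (fun x => \1_(sc n) x * f x).
  apply: (@intgM _ _ _ _ _ _ 1) => //.
  by move=> x; rewrite indicE; case: (_ \in _); rewrite ?normr1 ?normr0.
rewrite -Rint_sum//; apply: le_Rint => //; first exact: intg_sum.
move=> x; rewrite -mulr_suml -[leRHS]mul1r ler_wpM2r//.
have [[n0 Hn0]|H] := pselect (exists n0 : 'I_m, sc n0 x).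
  rewrite (bigD1 n0)//= big1 ?addr0; last first.
    move=> n nn0; rewrite indicE memNset// => xn; case/negP: nn0.
    by apply/eqP/val_inj; exact: sc_inj xn Hn0.
  by rewrite indicE; case: (_ \in _).
by rewrite big1// => n _; rewrite indicE memNset// => xn; apply: H; exists n.
Qed.

(** 17 = 1 + 2 * 8: a stopping cube with its largest inflation has 17^N times its volume, its volume
    is below its mass over L, and by disjointness the masses add up to at most the integral of
    [f]. *)
Lemma mu_badoo : (mu badoo <= (17 ^+ N / L * \int[mu]_x f x)%:E)%E.
Proof.
pose K := 17 ^+ N / L; have K0 : 0 <= K by rewrite mulr_ge0// invr_ge0 ltW.
have sub : badoo `<=` \bigcup_n bc n.
  move=> x [k _ [jz [jk sjz xb]]]; exists (pickle jz) => //.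
  rewrite /bc pinvK sjz => i; have := xb i; rewrite !tnth_mktuple /radius.
  have : 0 < (scale k)^-1 :> R by rewrite invr_gt0 scale_gt0.
  by move=> ? /andP[? ?]; apply/andP; split; lra.
apply: le_trans (measure_sigma_subadditive mu mbc measurable_badoo sub) _.
have bcE n : (mu (bc n) <= (K * \int[mu]_x (\1_(sc n) x * f x))%:E)%E.
  rewrite /bc /sc; case: (pinv _) => [[j z]|]; last first.
    rewrite measure0 lee_fin mulr_ge0//; apply: Rintegral_ge0 => x _; exact: mulr_ge0.
  case: ifPn => /= [/andP[hz _]|_]; last first.
    rewrite measure0 lee_fin mulr_ge0//; apply: Rintegral_ge0 => x _; exact: mulr_ge0.
  have a0 : 0 < (scale j)^-1 :> R by rewrite invr_gt0 scale_gt0.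
  rewrite (mu_hbox leb); last first.
    by move=> i; rewrite !tnth_mktuple intrD mulrDl; lra.
  rewrite lee_fin (eq_bigr (fun=> 17 * (scale j)^-1)); last first.
    by move=> i _; rewrite !tnth_mktuple intrD mulrDl; ring.
  rewrite prodr_const card_ord exprMn.
  apply: (@le_trans _ _ (K * (L * (scale j)^-1 ^+ N))).
    by rewrite mulrA /K divfK ?gt_eqF.
  by rewrite ler_wpM2l// ltW.
apply: lime_le.
  by apply: is_cvg_nneseries => n _ _; exact: measure_ge0.
near=> m.
apply: (@le_trans _ _ (\sum_(0 <= n < m) (K * \int[mu]_x (\1_(sc n) x * f x))%:E)%E).
  by apply: lee_sum => n _; exact: bcE.
rewrite sumEFin lee_fin big_mkord -mulr_sumr.
by rewrite ler_wpM2l// sum_mass.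
Unshelve. all: by end_near. Qed.

End stopping_cubes.

(** * Truncation *)

(** The summands bound u_k0, then chi (u_(k0+1) - u_k0), then the N^2 terms with a derivative of
    chi. [E] comes from [mass_good]: 2^N from the part |u| <= L and 6^N from [f]. *)
Definition trunc_const {R : realType} (N : nat) (D c0 : R) : R :=
  let q := c0^-1 in let E := 2 ^+ N + 6 ^+ N in
  q * (D * E) + ((1 + q * (D * 2 ^+ N)) * (q * (D * 2 ^+ N * E) + q * (D * E)) +
    N%:R * (N%:R * (q * (q * (D * 2 ^+ N) * (D * E))))).

Section truncation.
Context {R : realType} {N : nat}.
Local Notation T := (N.-tuple R).
Context {mu : {measure set T -> \bar R}}.
Hypothesis leb : is_lebesgue mu.
Variables (D c0 : R).
Hypothesis D0 : 0 < D.
Hypothesis eta_le : forall k (z : T), `|eta k z| <= D * scale k ^+ N.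
Hypothesis deta_le : forall k l (z : T),
  `|dpartial l (eta k) z| <= scale k * (D * scale k ^+ N).
Hypothesis deta_supp : forall k l (z : T), dpartial l (eta k) z != 0 ->
  forall i, 0 <= tnth z i <= (scale k)^-1.
Hypothesis pot_le : forall k i (z : T), scale k * `|pot k i z| <= D * scale k ^+ N.
Hypotheses (c00 : 0 < c0) (cc0 : c0 <= eta_mass mu).
Variables (U : {set 'I_N} -> T -> R) (f : T -> R) (L : R).
Hypotheses (iU : forall I, intg mu (U I)) (cU : wclosed (mu := mu) U).
Hypotheses (L0 : 0 < L) (f0 : forall x, 0 <= f x) (intf : intg mu f).
Hypotheses (Uf : forall I x, `|U I x| <= L + f x) (fL : \int[mu]_x f x <= L).
Implicit Types (I J : {set 'I_N}) (k K : nat) (x y : T).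

Let ci := (eta_mass mu)^-1.
Let q := c0^-1.
Let E : R := 2 ^+ N + 6 ^+ N.
Let B := bad (mu := mu) f L.
Let Boo := badoo (mu := mu) f L.

Let c_gt0 : 0 < eta_mass mu. Proof. exact: lt_le_trans cc0. Qed.
Let ci_gt0 : 0 < ci. Proof. by rewrite invr_gt0. Qed.
Let ciq : ci <= q. Proof. by rewrite lef_pV2 ?posrE. Qed.
Let q_gt0 : 0 < q. Proof. by rewrite invr_gt0. Qed.
Let E_ge0 : 0 <= E. Proof. by rewrite addr_ge0// exprn_ge0. Qed.
Let t_gt0 k : 0 < (scale k)^-1 :> R. Proof. by rewrite invr_gt0 scale_gt0. Qed.

Let mB k : measurable (B k). Proof. exact: measurable_bad. Qed.

Let mu_Boo : (mu Boo < +oo)%E.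
Proof. exact: le_lt_trans (mu_badoo leb L0 f0 intf) (ltry _). Qed.

Let iB k : intg mu (\1_(B k) : T -> R).
Proof.
apply: intg_indic => //; apply: le_lt_trans mu_Boo; apply: le_measure; rewrite ?inE//.
- exact: measurable_badoo.
- by move=> x Bx; exists k.
Qed.

Definition uk k I x : R := ci * conv mu (eta k) (U I) x.
Definition chi k x : R := 1 + (- ci) * conv mu (eta k) (\1_(B k)) x.
Definition dchi k l x : R := 0 + (- ci) * conv mu (dpartial l (eta k)) (\1_(B k)) x.
Definition pw k i I x : R := conv mu (pot k i) (U I) x.
Definition dpw k i I l x : R := conv mu (dpartial l (pot k i)) (U I) x.
Definition layer k I x : R :=
  \sum_i ci * cutoff_form i (chi k) (dchi k) (pw k i) (dpw k i) I x.
Definition vK K I x : R := uk 0 I x + \sum_(k <- iota 0 K) layer k I x.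

Let C11_eta k I : C11 (conv mu (eta k) (U I)) (fun l => conv mu (dpartial l (eta k)) (U I)).
Proof. exact: (C11_conv leb (test_fun_C11 (eta_test_fun k)) (iU I)). Qed.

Let C11_pw k i I : C11 (pw k i I) (dpw k i I).
Proof. exact: (C11_conv leb (test_fun_C11 (pot_test_fun k i)) (iU I)). Qed.

Let C11_chi k : C11 (chi k) (dchi k).
Proof.
exact: (C11D (C11_cst 1) (C11Z (- ci)
  (C11_conv leb (test_fun_C11 (eta_test_fun k)) (iB k)))).
Qed.

Let pclosed_pw k i : pclosed (dpw k i).
Proof.
apply: (conv_pclosed (b := (scale k)^-1)) => // [j|j x].
  exact: smooth1_mix.
by move=> /mix_supp /andP[a b]; rewrite gtr0_norm// ltW.
Qed.

Lemma vK_wclosed K : wclosed (mu := mu) (vK K).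
Proof.
apply: wclosedD.
  apply: wclosedZ; apply: (pclosed_wclosed leb (C11_eta 0)).
  apply: (conv_pclosed (b := (scale 0)^-1)) => // [j|j x].
    exact: smooth1_bumpk.
  by move=> /bumpk_supp /andP[a b]; rewrite gtr0_norm// ltW.
apply: wclosed_sum => k; apply: wclosed_sum => i; apply: wclosedZ.
exact: (cutoff_form_wclosed leb).
Qed.

Let meta k : measurable_fun setT (eta k : T -> R).
Proof. by have [] := test_fun_C11 (@eta_test_fun R N k). Qed.

Let mdeta k l : measurable_fun setT (dpartial l (eta k) : T -> R).
Proof. by have [_ + _] := test_fun_C11 (@eta_test_fun R N k); apply. Qed.

Let mpot k i : measurable_fun setT (pot k i : T -> R).
Proof. by have [] := test_fun_C11 (@pot_test_fun R N k i). Qed.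

Let eta_suppW k (z : T) : eta k z != 0 -> forall i, 0 <= tnth z i <= (scale k)^-1.
Proof. by move=> /eta_supp H i; have /andP[/ltW -> /ltW ->] := H i. Qed.

Let eta_suppS k (z : T) : eta k.+1 z != 0 -> forall i, 0 <= tnth z i <= (scale k)^-1.
Proof.
move=> /eta_suppW H i; have /andP[-> h] /= := H i; apply: le_trans h _.
by rewrite lef_pV2 ?posrE ?scale_gt0// scaleS ler_peMl ?ler1n// ltW// scale_gt0.
Qed.

Let pot_suppW k i (z : T) : pot k i z != 0 -> forall j, 0 <= tnth z j <= (scale k)^-1.
Proof. by move=> /pot_supp H j; have /andP[/ltW -> /ltW ->] := H j. Qed.

(** The undifferentiated part of the layer sums to chi (u_(k+1) - u_k) by [sum_dpot]; this is what
    makes v_K telescope. *)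
Lemma layerE k I x : layer k I x = chi k x * (uk k.+1 I x - uk k I x) +
  \sum_i \sum_(l in I) ci * (ksign R l (I :\ l)%SET *
    (dchi k l x * contract i (pw k i) (I :\ l)%SET x)).
Proof.
rewrite /layer /cutoff_form; under eq_bigr do rewrite mulrDr mulr_sumr.
rewrite big_split /=; congr (_ + _).
have -> : uk k.+1 I x - uk k I x = ci * \sum_i dpw k i I i x.
  rewrite /uk -mulrBr; congr (_ * _); rewrite /dpw /conv.
  have bd m : intg mu (fun y => eta m (tsub x y) * U I y).
    by apply: intg_conv_section (eta_le m) _.
  rewrite -RintB//.
  have ib i : intg mu (fun y => dpartial i (pot k i) (tsub x y) * U I y).
    have [_ m' [C [_ _ bC _]]] := test_fun_C11 (@pot_test_fun R N k i).
    exact: intg_conv_section (m' i) (bC i) (iU I).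
  rewrite -Rint_sum//; apply: eq_Rintegral => y _.
  by rewrite -mulrBl -sum_dpot mulr_suml.
rewrite mulrA mulr_sumr; apply: eq_bigr => i _.
by rewrite mulrCA mulrA.
Qed.

Lemma chi_far k x : (forall y, cube x (scale k)^-1 y -> ~ B k y) ->
  chi k x = 1 /\ forall l, dchi k l x = 0.
Proof.
move=> H.
have H0 (g : T -> R) : (forall z, g z != 0 -> forall i, 0 <= tnth z i <= (scale k)^-1) ->
    conv mu g (\1_(B k)) x = 0.
  move=> gs; rewrite (conv_local (w := fun=> 0) (t_gt0 k) gs).
    by rewrite -[RHS](Rint0 mu); apply: eq_Rintegral => y _; rewrite mulr0.
  by move=> y /H nB; rewrite indicE memNset.
split=> [|l]; rewrite /chi /dchi H0 ?mulr0 ?addr0//.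
- exact: eta_suppW.
- exact: deta_supp.
Qed.

(** The mollified indicator is the full mass of the kernel, which the factor [ci] normalises to 1,
    and the derivative of the kernel has integral zero. *)
Lemma chi_inside k x : (forall y, cube x (scale k)^-1 y -> B k y) ->
  chi k x = 0 /\ forall l, dchi k l x = 0.
Proof.
move=> H.
have H0 (g : T -> R) : (forall z, g z != 0 -> forall i, 0 <= tnth z i <= (scale k)^-1) ->
    conv mu g (\1_(B k)) x = \int[mu]_y g (tsub x y).
  move=> gs; rewrite (conv_local (w := fun=> 1) (t_gt0 k) gs).
    by apply: eq_Rintegral => y _; rewrite mulr1.
  by move=> y /H nB; rewrite indicE mem_set.
split=> [|l]; rewrite /chi /dchi H0.
- by rewrite (Rint_eta leb) /ci mulNr mulVf ?subrr// gt_eqF.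
- exact: eta_suppW.
- rewrite add0r (_ : Rintegral _ _ _ = 0) ?mulr0//.
  have tp := eta_reflect_test_fun k x.
  rewrite -[RHS]oppr0 -[X in _ = - X](Rint_partial0 leb l (test_fun_C11 tp) (test_fun_csupp tp)).
  rewrite -RintN.
    apply: eq_Rintegral => y _; rewrite dpartial_reflect ?opprK//.
    exact: smooth1_bumpk.
  have [_ m' [C [_ _ bC _]]] := test_fun_C11 tp.
  apply: (intg_csupp leb (m' l) (bC l)).
  exact: csupp_C11' (test_fun_C11 tp) (test_fun_csupp tp).
- exact: deta_supp.
Qed.

Definition touch k x := exists2 y, cube x (scale k)^-1 y & B k y.

Lemma layer_far k I x : ~ touch k x -> layer k I x = uk k.+1 I x - uk k I x.
Proof.
move=> nt; have [|c1 d0] := @chi_far k x.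
  by move=> y xy By; apply: nt; exists y.
rewrite layerE c1 mul1r big1 ?addr0// => i _; apply: big1 => l _.
by rewrite d0 mul0r !mulr0.
Qed.

Lemma layer_inside k m I x : touch k x -> (k < m)%N -> layer m I x = 0.
Proof.
move=> [y0 y0x By0] km.
have [|c1 d0] := @chi_inside m x.
  (* [y] is within 2^-m + 2^-k <= 2 2^-k of a point of [bad k], hence in [bad k.+1], which [bad m]
     contains. *)
  move=> y /cubeE yx; apply: (bad_le km); apply: (bad_nbhs By0) => i.
  move/cubeE : y0x => /(_ i) /andP[h1 h2]; have /andP[h3 h4] := yx i.
  have : (scale m)^-1 <= (scale k)^-1 :> R.
    by rewrite lef_pV2 ?posrE ?scale_gt0// /scale ler_weXn2l ?ler1n// ltnW.
  by move=> h5; rewrite ler_norml; apply/andP; split; lra.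
rewrite layerE c1 mul0r add0r big1// => i _; apply: big1 => l _.
by rewrite d0 mul0r !mulr0.
Qed.

Lemma vK_far K I x : (forall k, (k < K)%N -> ~ touch k x) -> vK K I x = uk K I x.
Proof.
elim: K => [|K IH] H; first by rewrite /vK big_nil addr0.
have {}IH := IH (fun k kK => H k (leqW kK)).
rewrite /vK -addn1 iotaD big_cat /= big_seq1 add0n addrA -/(vK K I x) IH layer_far.
  by rewrite addrC subrK addn1.
exact: H.
Qed.

Lemma vK_stop k0 K I x : (forall k, (k < k0)%N -> ~ touch k x) -> touch k0 x ->
  (k0 < K)%N -> vK K I x = uk k0 I x + layer k0 I x.
Proof.
move=> H tk kK; rewrite -(vK_far I H) /vK -(subnKC kK) iotaD big_cat.
rewrite [X in _ + (_ + X)]big_seq [X in _ + (_ + X)]big1 ?addr0; last first.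
  by move=> m; rewrite mem_iota add0n => /andP[km _]; exact: layer_inside tk km.
by rewrite -addn1 iotaD big_cat /= big_seq1 add0n addrA.
Qed.

Let good k x := k = 0%N \/ ~ B k.-1 x.

Let icube (w : T -> R) k x : intg mu w ->
  intg mu (fun y => \1_(cube x (scale k)^-1) y * w y).
Proof.
move=> iw; apply: (@intgM _ _ _ _ _ _ 1) => //.
  by apply: measurable_indic; exact: measurable_hbox.
by move=> y; rewrite indicE; case: (_ \in _); rewrite ?normr1 ?normr0.
Qed.

Let cube_vol k x : \int[mu]_y (\1_(cube x (scale k)^-1) y : R) =
  2 ^+ N * (scale k)^-1 ^+ N.
Proof.
rewrite Rint_indic; last exact: measurable_hbox.
by rewrite (mu_cube leb) ?exprMn// ltW.
Qed.

(** The integrand is at most L + f, and L contributes L times the volume of the cube. For [f] the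
    previous scale is used: 3^N 2^(-kN) = 6^N 2^(-(k+1)N). *)
Let mass_good k x I : good k x ->
  \int[mu]_y (\1_(cube x (scale k)^-1) y * `|U I y|) <= E * L * (scale k)^-1 ^+ N.
Proof.
move=> gk.
have i1 : intg mu (\1_(cube x (scale k)^-1) : T -> R).
  apply: intg_indic; first exact: measurable_hbox.
  by rewrite (mu_cube leb) ?ltry// ltW.
apply: (@le_trans _ _ (\int[mu]_y (L * \1_(cube x (scale k)^-1) y +
    \1_(cube x (scale k)^-1) y * f y))).
  apply: le_Rint; [exact/icube/intg_norm|by apply: intgD; [exact: intgZ|exact: icube]|].
  by move=> y; rewrite [L * _]mulrC -mulrDr ler_wpM2l.
rewrite RintD; [|exact: intgZ|exact: icube].
rewrite RintZ// cube_vol /E mulrDl mulrDl [L * _]mulrCA mulrA; apply: lerD => //.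
(* At scale 0 there is no previous scale; the total mass of [f] is at most L. *)
case: k gk i1 => [|k] gk i1.
  apply: (@le_trans _ _ (\int[mu]_y f y)).
    apply: le_Rint => //; first exact: icube.
    by move=> y; rewrite ler_piMl// indicE; case: (_ \in _).
  apply: le_trans fL _; rewrite /scale expr0 invr1 expr1n mulr1 ler_peMl ?(ltW L0)//.
  by rewrite exprn_ege1// ler1n.
have nb : ~ B k x by case: gk.
apply: le_trans (cube_mass_good L0 f0 intf nb) _.
rewrite scaleS invfM exprMn.
rewrite (_ : 6 = 3 * 2 :> R); last by ring.
rewrite exprMn (_ : 3 ^+ N * 2 ^+ N * L * _ =
  3 ^+ N * (L * (scale k)^-1 ^+ N) * (2 ^+ N * 2^-1 ^+ N)); last by ring.
by rewrite -[2 ^+ N * _]exprMn divff ?expr1n ?mulr1.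
Qed.

Let conv_good k x I (g : T -> R) (C : R) : good k x -> measurable_fun setT g ->
  (forall z, `|g z| <= C * scale k ^+ N) ->
  (forall z, g z != 0 -> forall i, 0 <= tnth z i <= (scale k)^-1) ->
  `|conv mu g (U I) x| <= C * E * L.
Proof.
move=> gk mg gC gs.
have aN : 0 < scale k ^+ N :> R by rewrite exprn_gt0// scale_gt0.
have C0 : 0 <= C.
  have := le_trans (normr_ge0 _) (gC (tcst 0)).
  by rewrite pmulr_lge0.
apply: le_trans (conv_le_cube x (t_gt0 k) mg gC gs (iU I)) _.
apply: le_trans (ler_wpM2l _ (mass_good I gk)) _; first by rewrite mulr_ge0// ltW.
have : scale k ^+ N * (scale k)^-1 ^+ N = 1 :> R.
  by rewrite -exprMn divff ?expr1n// gt_eqF// scale_gt0.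
set P := scale k ^+ N; set Q := (scale k)^-1 ^+ N => PQ.
by rewrite mulrACA PQ mulr1 mulrA.
Qed.

Let uk_good k x I : good k x -> `|uk k I x| <= q * (D * E) * L.
Proof.
move=> gk; rewrite /uk normrM gtr0_norm// -mulrA.
apply: ler_pM => //; first exact: ltW.
exact: conv_good gk (meta k) (eta_le k) (@eta_suppW k).
Qed.

(** The finer mollifier is supported in the coarser cube and is larger by at most 2^N, so goodness
    at scale k is enough. *)
Let ukS_good k x I : good k x -> `|uk k.+1 I x| <= q * (D * 2 ^+ N * E) * L.
Proof.
move=> gk; rewrite /uk normrM gtr0_norm// -mulrA.
apply: ler_pM => //; first exact: ltW.
apply: (conv_good I gk (meta k.+1)); last exact: eta_suppS.
by move=> z; rewrite -mulrA -exprMn -scaleS; exact: eta_le.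
Qed.

Let pw_good k i x I : good k x -> scale k * `|pw k i I x| <= D * E * L.
Proof.
move=> gk.
have a0 := scale_gt0 (R := R) k.
rewrite mulrC -ler_pdivlMr// (_ : _ / _ = D / scale k * E * L); last by ring.
apply: (conv_good I gk (mpot k i)); last exact: pot_suppW.
move=> z; rewrite mulrAC ler_pdivlMr// mulrC; exact: pot_le.
Qed.

Let conv_bad (g : T -> R) (C : R) k x : measurable_fun setT g ->
  (forall z, `|g z| <= C * scale k ^+ N) ->
  (forall z, g z != 0 -> forall i, 0 <= tnth z i <= (scale k)^-1) ->
  `|conv mu g (\1_(B k)) x| <= C * 2 ^+ N.
Proof.
move=> mg gC gs.
have aN : 0 < scale k ^+ N :> R by rewrite exprn_gt0// scale_gt0.
have C0 : 0 <= C.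
  have := le_trans (normr_ge0 _) (gC (tcst 0)).
  by rewrite pmulr_lge0.
apply: le_trans (conv_le_cube x (t_gt0 k) mg gC gs (iB k)) _.
have : \int[mu]_y (\1_(cube x (scale k)^-1) y * `|\1_(B k) y : R|) <=
    2 ^+ N * (scale k)^-1 ^+ N.
  rewrite -(cube_vol k x); apply: le_Rint.
  - exact/icube/intg_norm.
  - apply: intg_indic; first exact: measurable_hbox.
    by rewrite (mu_cube leb) ?ltry// ltW.
  - move=> y; rewrite ler_piMr// [in X in X <= _]indicE.
    by case: (_ \in _); rewrite ?normr1 ?normr0.
move=> /(ler_wpM2l (mulr_ge0 C0 (ltW aN))) /le_trans; apply.
have : scale k ^+ N * (scale k)^-1 ^+ N = 1 :> R.
  by rewrite -exprMn divff ?expr1n// gt_eqF// scale_gt0.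
set P := scale k ^+ N; set Q := (scale k)^-1 ^+ N => PQ.
by rewrite mulrACA PQ mulr1.
Qed.

Let chi_le k x : `|chi k x| <= 1 + q * (D * 2 ^+ N).
Proof.
apply: le_trans (ler_normD _ _) _; rewrite normr1 lerD2l normrM normrN [`|ci|]gtr0_norm//.
apply: ler_pM => //; first exact: ltW.
exact: conv_bad (meta k) (eta_le k) (@eta_suppW k).
Qed.

Let dchi_le k l x : `|dchi k l x| <= scale k * (q * (D * 2 ^+ N)).
Proof.
rewrite /dchi add0r normrM normrN [`|ci|]gtr0_norm// mulrCA.
apply: ler_pM => //; first exact: ltW.
rewrite mulrA; apply: (conv_bad x (mdeta k l)); last exact: deta_supp.
by move=> z; rewrite -mulrA; exact: deta_le.
Qed.

Let contract_good k i x I : good k x ->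
  scale k * `|contract i (pw k i) I x| <= D * E * L.
Proof.
move=> gk; rewrite /contract; case: ifP => _.
  by rewrite normr0 mulr0 !mulr_ge0// ltW.
by rewrite normrM normr_sign mul1r; exact: pw_good.
Qed.

Let sum_const_le (P : pred 'I_N) (F : 'I_N -> R) (C : R) : 0 <= C ->
  (forall i, `|F i| <= C) -> `|\sum_(i | P i) F i| <= N%:R * C.
Proof.
move=> C0' H; apply: le_trans (ler_norm_sum _ _ _) _.
apply: (@le_trans _ _ (\sum_(i < N) C)).
  rewrite big_mkcond /=; apply: ler_sum => i _; case: ifP => // _; exact: H.
by rewrite sumr_const card_ord mulr_natl.
Qed.

(** The factor 2^k of [dchi] cancels against the factor 2^-k gained in [pot], so the bound does not
    depend on k. *)
Let layer_good k x I : good k x -> `|layer k I x| <=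
  ((1 + q * (D * 2 ^+ N)) * (q * (D * 2 ^+ N * E) + q * (D * E)) +
    N%:R * (N%:R * (q * (q * (D * 2 ^+ N) * (D * E))))) * L.
Proof.
move=> gk; rewrite layerE; apply: le_trans (ler_normD _ _) _; rewrite [leRHS]mulrDl.
have a0 := scale_gt0 (R := R) k.
apply: lerD.
  rewrite normrM -mulrA; apply: ler_pM => //.
  apply: le_trans (ler_normB _ _) _; rewrite mulrDl; apply: lerD.
    exact: ukS_good.
  exact: uk_good.
have q0 := ltW q_gt0.
have G0 : 0 <= q * (q * (D * 2 ^+ N) * (D * E)) * L.
  by rewrite !mulr_ge0 ?exprn_ge0 ?(ltW D0) ?(ltW L0).
have G1 : 0 <= N%:R * (q * (q * (D * 2 ^+ N) * (D * E))) * L by rewrite -mulrA mulr_ge0.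
rewrite -[leRHS]mulrA; apply: sum_const_le => // i.
rewrite -[leRHS]mulrA; apply: sum_const_le => // l.
rewrite !normrM normr_sign mul1r [`|ci|]gtr0_norm// -[leRHS]mulrA; apply: ler_pM => //.
  exact: ltW.
rewrite -[leRHS]mulrA.
have := contract_good i (I :\ l)%SET gk; have := dchi_le k l x.
set p := `|dchi _ _ _|; set r := `|contract _ _ _ _| => hp hr.
rewrite -(ler_pM2l a0); apply: (@le_trans _ _ (p * (D * E * L))).
  by rewrite mulrCA; apply: ler_wpM2l => //; exact: normr_ge0.
by rewrite [leRHS]mulrA; apply: ler_wpM2r => //; rewrite !mulr_ge0// ltW.
Qed.

Let good_notouch k x : (forall j, (j < k)%N -> ~ touch j x) -> good k x.
Proof.
case: k => [|k] H; first by left.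
right=> /= Bx; apply: (H k (ltnSn k)); exists x => //.
by apply/cubeE => i; have := t_gt0 k; move=> ?; apply/andP; split; lra.
Qed.

(** At the first touched scale k0 < K all earlier scales are untouched, so [x] is good at k0 and v_K
    consists of u_k0 and one layer. If there is none, v_K = u_K at a good scale. *)
Lemma vK_bound K I x : `|vK K I x| <= trunc_const N D c0 * L.
Proof.
have C1 : 0 <= ((1 + q * (D * 2 ^+ N)) * (q * (D * 2 ^+ N * E) + q * (D * E)) +
    N%:R * (N%:R * (q * (q * (D * 2 ^+ N) * (D * E))))) * L.
  rewrite mulr_ge0 ?(ltW L0)// addr_ge0//; last first.
    by rewrite !mulr_ge0 ?exprn_ge0 ?(ltW q_gt0) ?(ltW D0).
  by rewrite mulr_ge0// addr_ge0// !mulr_ge0 ?exprn_ge0 ?(ltW q_gt0) ?(ltW D0).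
have [[k0 [k0K tk0 mk0]]|H] := pselect (exists k0, [/\ (k0 < K)%N, touch k0 x &
    forall k, (k < k0)%N -> ~ touch k x]).
  rewrite (vK_stop I mk0 tk0 k0K); apply: le_trans (ler_normD _ _) _.
  have gk := good_notouch mk0.
  by rewrite /trunc_const mulrDl; apply: lerD; [exact: uk_good|exact: layer_good].
have nt k : (k < K)%N -> ~ touch k x.
  elim/ltn_ind: k => k IH kK tk; apply: H; exists k; split=> // j jk.
  by apply: IH => //; exact: ltn_trans kK.
rewrite (vK_far I nt); have gk := good_notouch nt.
rewrite /trunc_const mulrDl; apply: le_trans (uk_good I gk) _.
by rewrite lerDl.
Qed.

Lemma touch_notbad x : ~ Boo x -> forall k, ~ touch k x.
Proof.
move=> nB k [y /cubeE yx By]; apply: nB; exists k.+1 => //.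
apply: (bad_nbhs By) => i; have /andP[h1 h2] := yx i; have := t_gt0 k => ?.
by rewrite ler_norml; apply/andP; split; lra.
Qed.

Lemma vK_off K I x : ~ Boo x -> vK K I x = uk K I x.
Proof. by move=> nB; apply: vK_far => k _; exact: touch_notbad. Qed.

Lemma vK_stable I x : Boo x -> exists n0, forall n, (n0 <= n)%N -> vK n I x = vK n0 I x.
Proof.
move=> [k _ Bx].
have tk : touch k x.
  by exists x => //; apply/cubeE => i; have := t_gt0 k; move=> ?; apply/andP; split; lra.
exists k.+1 => n kn; rewrite /vK -{1}(subnKC kn) iotaD big_cat.
rewrite [X in _ + (_ + X)]big_seq [X in _ + (_ + X)]big1 ?addr0//.
by move=> m; rewrite mem_iota add0n => /andP[km _]; exact: layer_inside tk km.
Qed.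

Let intg_conv_eta k I : intg mu (conv mu (eta k) (U I)).
Proof.
have ie : intg mu (eta k).
  exact: (intg_csupp leb (meta k) (eta_le k) (test_fun_csupp (eta_test_fun k))).
by have [] := conv_L1 leb (meta k) (eta_le k) ie (iU I).
Qed.

Lemma uk_cvg I (e : R) : 0 < e -> exists K0, forall K, (K0 <= K)%N ->
  \int[mu]_x `|uk K I x - U I x| <= e.
Proof.
move=> e0.
have ec : 0 < e / ci by rewrite divr_gt0.
have [||K0 HK] := @approximate_identity_L1 R N mu leb (@eta R N)
  (fun k => D * scale k ^+ N) (fun k => (scale k)^-1) (D * 2 ^+ N) (eta_mass mu)
  meta eta_le t_gt0 _ (@eta_supp R N) _ (fun k x => Rint_eta leb k x) (U I) (iU I) _ ec.
- rewrite (_ : (fun k => (scale k)^-1) = (fun k => 2^-1 ^+ k)); last first.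
    by apply/funext => k; rewrite /scale exprVn.
  by apply: cvg_expr; rewrite ger0_norm//; lra.
- move=> k; have : scale k ^+ N * (scale k)^-1 ^+ N = 1 :> R.
    by rewrite -exprMn divff ?expr1n// gt_eqF// scale_gt0.
  rewrite exprMn; set P := scale k ^+ N; set Q := (scale k)^-1 ^+ N => PQ.
  by rewrite mulrACA PQ mulr1.
exists K0 => K /HK H.
have iuk : intg mu (fun x => conv mu (eta K) (U I) x - eta_mass mu * U I x).
  apply: intgB; last exact: intgZ.
  exact: intg_conv_eta.
rewrite (_ : \int[mu]_x _ = ci * \int[mu]_x `|conv mu (eta K) (U I) x - eta_mass mu * U I x|).
  by rewrite mulrC -ler_pdivlMr.
rewrite -(RintZ ci (intg_norm iuk)).
apply: eq_Rintegral => x _; rewrite -{1}[ci]gtr0_norm// -normrM /uk mulrBr mulrA.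
by rewrite [ci * eta_mass mu]mulVf ?mul1r// gt_eqF.
Qed.

Let measurable_vK K I : measurable_fun setT (vK K I).
Proof.
have muk k J : measurable_fun setT (uk k J).
  by apply: measurable_funM => //; case: (C11_eta k J).
apply: measurable_funD => //; apply: measurable_sum => k.
rewrite (funext (layerE k I)); apply: measurable_funD.
  apply: measurable_funM; first by case: (C11_chi k).
  exact: measurable_funB.
apply: measurable_sum => i.
rewrite (_ : (fun x => _) = fun x => \sum_l (if l \in I then
    ci * (ksign R l (I :\ l)%SET * (dchi k l x * contract i (pw k i) (I :\ l)%SET x))
    else 0)); last by apply/funext => x; rewrite -big_mkcond.
apply: measurable_sum => l; case: (l \in I) => //.
apply: measurable_funM => //; apply: measurable_funM => //; apply: measurable_funM.
  by case: (C11_chi k).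
rewrite /contract; case: (i \in (I :\ l)%SET) => //.
by apply: measurable_funM => //; case: (C11_pw k i (i |: (I :\ l))%SET).
Qed.

(** The bound is everywhere on the union of the bad sets, where v_K becomes stationary, but only
    almost everywhere off it, where u_K converges merely in L^1. *)
Lemma truncation_exists : exists w : {set 'I_N} -> T -> R,
  [/\ forall I, intg mu (w I), wclosed (mu := mu) w,
      forall I x, ~ badoo (mu := mu) f L x -> w I x = U I x &
      forall I, {ae mu, forall x, `|w I x| <= trunc_const N D c0 * L}].
Proof.
pose C := trunc_const N D c0 * L.
have C0 : 0 <= C := le_trans (normr_ge0 _) (vK_bound 0 finset.set0 (tcst 0)).
have mBoo : measurable Boo by exact: measurable_badoo.
have iBoo : intg mu (\1_Boo : T -> R) by exact: intg_indic.
have m1 : measurable_fun setT (\1_Boo : T -> R) by exact: measurable_indic.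
have st I x : exists n0, Boo x -> forall n, (n0 <= n)%N -> vK n I x = vK n0 I x.
  have [/(vK_stable I)[n0 H]|nB] := pselect (Boo x); last by exists 0%N.
  by exists n0.
pose n0 I x := sval (cid (st I x)).
pose w I x := if x \in Boo then vK (n0 I x) I x else U I x.
have wB I x : Boo x -> w I x = vK (n0 I x) I x by move=> Bx; rewrite /w mem_set.
have wU I x : ~ Boo x -> w I x = U I x by move=> nB; rewrite /w memNset.
have evt I x : Boo x -> forall n, (n0 I x <= n)%N -> vK n I x = w I x.
  by move=> Bx n nn; rewrite wB//; exact: (svalP (cid (st I x)) Bx n nn).
have mw I : measurable_fun setT (w I).
  apply: (measurable_fun_cvg (h := fun K x => \1_Boo x * vK K I x + (1 - \1_Boo x) * U I x)).
    move=> K; apply: measurable_funD; apply: measurable_funM => //.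
      exact: measurable_funB.
    exact: intg_measurable (iU I).
  move=> x _; apply: cvg_near_cst; near=> K.
  have [Bx|nB] := pselect (Boo x).
    rewrite indicE mem_set// subrr mul1r mul0r addr0 (evt _ _ Bx)//.
    near: K; exact: nbhs_infty_ge.
  by rewrite indicE memNset// subr0 mul1r mul0r add0r wU.
have iw I : intg mu (w I).
  apply: (@intg_le _ _ _ _ _ (fun x => C * \1_Boo x + `|U I x|)) => //.
    by apply: intgD; [exact: intgZ|exact: intg_norm].
  move=> x; have [Bx|nB] := pselect (Boo x).
    by rewrite wB// indicE mem_set// mulr1 (le_trans (vK_bound _ _ _))// lerDl.
  by rewrite wU// indicE memNset// mulr0 add0r.
(* On the bad union, of finite measure, domination by the constant C applies; off it v_K = u_K, and
   the approximate identity takes over. *)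
have dvw I (e : R) : 0 < e -> exists K0, forall K, (K0 <= K)%N ->
    intg mu (fun x => vK K I x - w I x) /\ \int[mu]_x `|vK K I x - w I x| <= e.
  move=> e0; have e2 : 0 < e / 2 by lra.
  have [K1 HK1] := uk_cvg I e2.
  have iuk K : intg mu (fun x => uk K I x - U I x).
    apply: intgB => //; apply: intgZ.
    exact: intg_conv_eta.
  have [|||||i1w /(_ _ e2)[K2 HK2]] := @Rint_eventually_eq _ T R mu
    (fun K x => \1_Boo x * vK K I x) (fun x => \1_Boo x * w I x) (fun x => C * \1_Boo x).
  - by move=> K; exact: measurable_funM.
  - exact: measurable_funM.
  - exact: intgZ.
  - move=> K x; rewrite normrM mulrC [`|\1_Boo x|]ger0_norm// ler_wpM2r//.
    exact: vK_bound.
  - move=> x; exists (n0 I x) => n nn.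
    have [Bx|nB] := pselect (Boo x); first by rewrite evt.
    by rewrite indicE memNset// !mul0r.
  have i1v K : intg mu (fun x => \1_Boo x * vK K I x - \1_Boo x * w I x).
    apply: intgB => //; apply: (@intg_le _ _ _ _ _ (fun x => C * \1_Boo x)).
    - exact: measurable_funM.
    - exact: intgZ.
    - move=> x; rewrite normrM mulrC [`|\1_Boo x|]ger0_norm// ler_wpM2r//.
      exact: vK_bound.
  have ptw K x : `|vK K I x - w I x| <= `|\1_Boo x * vK K I x - \1_Boo x * w I x| +
      `|uk K I x - U I x|.
    have [Bx|nB] := pselect (Boo x).
      by rewrite indicE mem_set// !mul1r lerDl.
    by rewrite indicE memNset// !mul0r subrr normr0 add0r wU// vK_off.
  have isum K : intg mu (fun x => `|\1_Boo x * vK K I x - \1_Boo x * w I x| +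
      `|uk K I x - U I x|).
    by apply: intgD; exact: intg_norm.
  have idv K : intg mu (fun x => vK K I x - w I x).
    by apply: (intg_le _ (isum K)) => //; exact: measurable_funB.
  exists (maxn K1 K2) => K; rewrite geq_max => /andP[k1 k2]; split=> //.
  apply: (@le_trans _ _ (\int[mu]_x (`|\1_Boo x * vK K I x - \1_Boo x * w I x| +
      `|uk K I x - U I x|))).
    by apply: le_Rint => //; exact: intg_norm.
  rewrite RintD; [|exact: intg_norm|exact: intg_norm].
  by have := HK1 K k1; have := HK2 K k2; lra.
exists w; split=> //.
- split; first by move=> I; exact: admissible_intg.
  move=> M phi tp.
  have [_ mp [P [P0 _ pP _]]] := test_fun_C11 tp.
  apply: (@norm_small_eq0 _ _ (N%:R * P)) => h h0 h1.
  have [K HK] : exists K, forall I, intg mu (fun x => vK K I x - w I x) /\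
      \int[mu]_x `|vK K I x - w I x| <= h.
    have ex I := dvw I h h0.
    pose k0 I := sval (cid (ex I)).
    (* One K serves all coefficients, as there are finitely many subsets I. *)
    exists (\max_I k0 I) => I; apply: (svalP (cid (ex I))).
    exact: (leq_bigmax (F := k0)).
  have [av cv] := vK_wclosed K.
  have := cv M phi tp => S0.
  rewrite -[X in `|X|]subr0 -[X in `|_ - X|]S0 -sumrB -mulrA; apply: sum_const_le.
    by rewrite mulr_ge0// ltW.
  move=> m; rewrite -mulrBr normrM normr_sign mul1r.
  rewrite -RintB; [|exact: admissible_intg|exact: av].
  have [iv vh] := HK (M :\ m)%SET.
  apply: (@le_trans _ _ (\int[mu]_x (P * `|vK K (M :\ m)%SET x - w (M :\ m)%SET x|))).
    apply: normr_Rint_le.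
    - by apply: intgB; [exact: admissible_intg|exact: av].
    - exact/intgZ/intg_norm.
    - by move=> x; rewrite -mulrBr normrM distrC ler_wpM2r.
  by rewrite RintZ ?ler_wpM2l//; exact: intg_norm.
- move=> I.
  (* Excess of |U| over C off the bad union. There |u_K| <= C, so its integral is at most the L^1
     distance of u_K to U, which is arbitrarily small. *)
  pose p x := (1 - \1_Boo x) * Num.max 0 (`|U I x| - C).
  have p0 x : 0 <= p x.
    apply: mulr_ge0; last by rewrite le_max lexx.
    by rewrite indicE; case: (_ \in _); rewrite ?subrr ?subr0.
  have mp : measurable_fun setT p.
    apply: measurable_funM; first exact: measurable_funB.
    apply: measurable_maxr => //; apply: measurable_funB => //.
    by apply: measurableT_comp => //; exact: intg_measurable (iU I).
  have pU x : `|p x| <= `|U I x|.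
    rewrite ger0_norm// /p -[leRHS]mul1r; apply: ler_pM.
    - by rewrite indicE; case: (_ \in _); rewrite ?subrr ?subr0.
    - by rewrite le_max lexx.
    - by rewrite lerBlDr lerDl.
    - by rewrite ge_max normr_ge0 /= lerBlDr lerDl.
  have ip : intg mu p by exact: intg_le (intg_norm (iU I)) pU.
  have p00 : \int[mu]_x p x = 0.
    apply: (@norm_small_eq0 _ _ 1) => h h0 h1; rewrite mul1r.
    have [K0 /(_ K0 (leqnn _)) HK] := uk_cvg I h0.
    rewrite ger0_norm; last exact: Rintegral_ge0.
    apply: le_trans HK; apply: le_Rint => //.
      apply: intg_norm; apply: intgB => //; apply: intgZ.
      exact: intg_conv_eta.
    move=> x; rewrite /p; have [Bx|nB] := pselect (Boo x).
      by rewrite indicE mem_set// subrr mul0r.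
    rewrite indicE memNset// subr0 mul1r ge_max normr_ge0 /=.
    rewrite -(vK_off K0 I nB) distrC.
    apply: (@le_trans _ _ (`|U I x| - `|vK K0 I x|)); first by rewrite lerD2l lerN2 vK_bound.
    by apply: le_trans (ler_norm _) _; exact: ler_dist_dist.
  have : (\int[mu]_x `|(p x)%:E| = 0)%E.
    rewrite (eq_integral (fun x => (p x)%:E)); first by rewrite -EFin_Rint// p00.
    by move=> x _; rewrite gee0_abs// lee_fin.
  move=> /(ae_eq_integral_abs mu measurableT ((measurable_EFinP _ _).2 mp)).
  apply: filterS => x /(_ Logic.I) [] px.
  have [Bx|nB] := pselect (Boo x); first by rewrite wB//; exact: vK_bound.
  rewrite wU// leNgt; apply/negP => Uc; move: px; rewrite /p indicE memNset// subr0 mul1r.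
  move/eqP; apply/negP; rewrite gt_eqF// lt_max; apply/orP; right.
  by rewrite subr_gt0.
Unshelve. all: by end_near. Qed.

End truncation.

(** * From coefficients to forms, and from one form to the sequence *)

Section form_norm.
Context {R : realType} {N r : nat}.
Implicit Types w : rform R N r.

Lemma norm_le_fnorm w J : `|w J| <= fnorm w.
Proof.
rewrite -sqrtr_sqr ler_sqrt; last by apply: sumr_ge0 => I _; exact: sqr_ge0.
by rewrite (bigD1 J)//= lerDl sumr_ge0// => I _; exact: sqr_ge0.
Qed.

Lemma fnorm_le_sum w : fnorm w <= \sum_J `|w J|.
Proof.
have S0 : 0 <= \sum_J `|w J| by exact: sumr_ge0.
rewrite -[leRHS]ger0_norm// -sqrtr_sqr ler_sqrt ?sqr_ge0// expr2 mulr_sumr.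
apply: ler_sum => J _; rewrite -[w J ^+ 2]ger0_norm ?sqr_ge0// [w J ^+ 2]expr2 normrM ler_wpM2r//.
by rewrite (bigD1 J)//= lerDl sumr_ge0.
Qed.

Lemma fnorm_le (C : R) w : (forall J, `|w J| <= C) ->
  fnorm w <= #|{: rset N r}|%:R * C.
Proof.
move=> H; apply: le_trans (fnorm_le_sum w) _.
apply: le_trans (ler_sum _ (fun J _ => H J)) _.
by rewrite sumr_const mulr_natl.
Qed.

End form_norm.

Section single_form.
Context {R : realType} {N r : nat}.
Local Notation T := (N.-tuple R).
Local Notation m := (#|{: rset N r}|%:R : R).

(** The condition at M involves only coefficients of degree #|M| - 1, so keeping a single degree
    preserves closedness. *)
Lemma wclosed_restrict (mu : {measure set T -> \bar R}) (w : {set 'I_N} -> T -> R) :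
  wclosed (mu := mu) w ->
  wclosed (mu := mu) (ext (fun x (J : rset N r) => w (val J) x)).
Proof.
move=> [aw cw].
have E (I : {set 'I_N}) : #|I| = r ->
    ext (fun x (J : rset N r) => w (val J) x) I = w I.
  move=> /eqP cI; apply/funext => x.
  by rewrite -[I in LHS](SubK (rset N r) cI) ext_val SubK.
split=> [I|M phi tp].
  have [/eqP/E ->//|cI] := boolP (#|I| == r).
  rewrite (_ : ext _ I = fun=> 0); last by apply/funext => x; exact: ext_neq.
  by apply: admissible_intg; exact: intg0.
have [cM|cM] := boolP (#|M| == r.+1).
  rewrite -[RHS](cw M phi tp); apply: eq_bigr => l lM.
  by rewrite E//; move/eqP : cM; rewrite (cardsD1 l M) lM => -[].
apply: big1 => l lM; rewrite (_ : Rintegral _ _ _ = 0) ?mulr0//.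
rewrite -[RHS](Rint0 mu); apply: eq_Rintegral => x _; rewrite ext_neq ?mulr0//.
by apply: contra cM => /eqP <-; rewrite (cardsD1 l M) lM.
Qed.

(** Quantitative version for one form: the measure of the changed set and the L^1 error are bounded
    linearly in the mass above level L, provided that mass is at most L. *)
Lemma truncation_form : exists C2 : R, 0 <= C2 /\
  forall (mu : {measure set T -> \bar R}), is_lebesgue mu ->
  forall (u : T -> rform R N r) (L : R), 0 < L ->
    form_measurable u -> mu.-integrable setT (fun y => (fnorm (u y))%:E) ->
    dclosed mu u ->
    (\int[mu]_(y in [set y | (L < fnorm (u y))%R]) (fnorm (u y))%:E <= L%:E)%E ->
  exists (v : T -> rform R N r) (F : set T),
    [/\ form_measurable v, dclosed mu v,
      {ae mu, forall x J, `|v x J| <= C2 * L},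
      measurable F /\ (forall x, ~ F x -> forall J, v x J = u x J) &
      (mu F <= (17 ^+ N / L *
        fine (\int[mu]_(y in [set y | (L < fnorm (u y))%R]) (fnorm (u y))%:E))%:E)%E /\
      (Lnorm mu 1%:E (fun y => (fnorm (fun J => v y J - u y J))%:E) <=
        (((m * (C2 * L) + m * L) * (17 ^+ N / L) + m) *
        fine (\int[mu]_(y in [set y | (L < fnorm (u y))%R]) (fnorm (u y))%:E))%:E)%E].
Proof.
have [D [D0 HD]] := @kernel_bounds R N.
have [c0 [c00 Hc0]] := eta_mass_lower R N.
set C2 := trunc_const N D c0.
have C2_ge0 : 0 <= C2.
  rewrite /C2 /trunc_const; have q0 : 0 <= c0^-1 by rewrite invr_ge0 ltW.
  have := ltW D0 => D0'.
  by rewrite !(addr_ge0, mulr_ge0)// ?addr_ge0 ?mulr_ge0 ?exprn_ge0.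
exists C2; split=> //.
move=> mu leb u L L0 mu_ iu cu small.
have ifn : intg mu (fun y => fnorm (u y)) := iu.
have mfn := intg_measurable ifn.
pose f (x : T) : R := if L < fnorm (u x) then fnorm (u x) else 0.
have f0 x : 0 <= f x by rewrite /f; case: ifP => // _; exact: sqrtr_ge0.
have mf : measurable_fun setT f.
  apply: measurable_fun_ifT => //; exact: measurable_fun_ltr.
have intf : intg mu f.
  apply: (intg_le mf ifn) => x; rewrite /f; case: ifP => _.
    by rewrite ger0_norm// sqrtr_ge0.
  by rewrite normr0 sqrtr_ge0.
have fE : \int[mu]_x f x =
    fine (\int[mu]_(y in [set y | (L < fnorm (u y))%R]) (fnorm (u y))%:E)%E.
  rewrite /Rintegral [in RHS]integral_mkcond; congr fine; apply: eq_integral => x _.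
  rewrite /f patchE; case: ifP => H; first by rewrite mem_set.
  by rewrite memNset// /= H.
have fL : \int[mu]_x f x <= L.
  rewrite -lee_fin EFin_Rint//; apply: (le_trans _ small).
  rewrite -[leLHS]EFin_Rint// fE fineK//.
  rewrite ge0_fin_numE; first exact: le_lt_trans small (ltry _).
  by apply: integral_ge0 => x _; rewrite lee_fin sqrtr_ge0.
rewrite -fE.
have mext I : measurable_fun setT (ext u I).
  rewrite /ext; case: insubP => [J _ _|_]; [exact: mu_|exact: measurable_cst].
have extn I x : `|ext u I x| <= fnorm (u x).
  rewrite /ext; case: insubP => [J _ _ /=|_ /=]; first exact: norm_le_fnorm.
  by rewrite normr0 sqrtr_ge0.
have iext I : intg mu (ext u I) by exact: intg_le (extn I).
have ufn x : fnorm (u x) <= L + f x.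
  by rewrite /f; case: ltP => H; [rewrite lerDr ltW|rewrite addr0].
have cext : wclosed (mu := mu) (ext u).
  by apply: dclosed_wclosed => // I; exact: admissible_intg.
have [w [iw cw wu wb]] := truncation_exists leb D0
  (fun k => let: And4 h _ _ _ := HD k in h)
  (fun k => let: And4 _ h _ _ := HD k in h)
  (fun k => let: And4 _ _ h _ := HD k in h)
  (fun k => let: And4 _ _ _ h := HD k in h) c00 (Hc0 mu leb) iext cext L0 f0 intf
  (fun I x => le_trans (extn I x) (ufn x)) fL.
pose F := badoo (mu := mu) f L.
have mF : measurable F by exact: measurable_badoo.
pose v (x : T) (J : rset N r) := w (val J) x.
have muF := mu_badoo leb L0 f0 intf.
have vu x : ~ F x -> forall J, v x J = u x J.
  by move=> nF J; rewrite /v wu// ext_val.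
have vb : {ae mu, forall x J, `|v x J| <= C2 * L}.
  by apply: filter_forall => J; exact: wb.
have mv : form_measurable v by move=> J; exact: intg_measurable (iw (val J)).
exists v, F; split=> //.
  exact/wclosed_dclosed/wclosed_restrict.
split=> //; rewrite Lnorm1.
have m0 : 0 <= m by [].
have iF : intg mu (\1_F : T -> R).
  by apply: intg_indic => //; exact: le_lt_trans muF (ltry _).
have C20 : 0 <= C2 * L by rewrite mulr_ge0 ?(ltW L0).
(* On F each coefficient of v - u is at most C2 L + L + f; off F the difference is zero. Integrating
   and using the bound on the measure of F leaves a multiple of the integral of [f]. *)
pose g x := (m * (C2 * L) + m * L) * \1_F x + m * f x.
have ig : intg mu g by apply: intgD; exact: intgZ.
have g0 x : 0 <= g x.
  by rewrite addr_ge0 ?mulr_ge0// addr_ge0// mulr_ge0// ltW.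
have mdiff : measurable_fun setT (fun y => fnorm (fun J => v y J - u y J)).
  apply: measurableT_comp.
    by apply: continuous_measurable_fun; exact: sqrt_continuous.
  apply: measurable_sum => J.
  by apply: measurable_funX; apply: measurable_funB; [exact: mv|exact: mu_].
apply: (@le_trans _ _ (\int[mu]_x (g x)%:E)%E).
  apply: ae_ge0_le_integral => //.
  - apply: measurableT_comp => //; exact/measurable_EFinP.
  - by move=> x _; rewrite lee_fin.
  - by apply/measurable_EFinP; exact: intg_measurable ig.
  apply: filterS vb => x vbx _.
  rewrite gee0_abs ?lee_fin ?sqrtr_ge0//.
  have [Fx|nF] := pselect (F x); last first.
    rewrite (_ : fnorm _ = 0)//.
    apply/eqP; rewrite sqrtr_eq0 big1// => J _.
    by rewrite vu// subrr expr0n.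
  rewrite /g indicE mem_set// mulr1 -addrA -!mulrDr.
  apply: fnorm_le => J; apply: le_trans (ler_normB _ _) _.
  apply: lerD => //; exact: le_trans (norm_le_fnorm _ _) (ufn x).
rewrite -EFin_Rint// lee_fin /g RintD; [|exact: intgZ|exact: intgZ].
rewrite RintZ// RintZ// [leRHS]mulrDl lerD2r -[leRHS]mulrA ler_wpM2l//.
  by rewrite addr_ge0// mulr_ge0// ltW.
rewrite Rint_indic// -lee_fin fineK//.
by rewrite ge0_fin_numE// (le_lt_trans muF)// ltry.
Qed.

End single_form.

Theorem theorem1p1 (R : realType) (N r : nat) :
  (1 <= N)%N -> (r <= N)%N ->
  exists C1 : R, 0 < C1 /\
  forall (mu : {measure set (N.-tuple R) -> \bar R}), is_lebesgue mu ->
  forall (u : nat -> N.-tuple R -> rform R N r) (L : R), 0 < L ->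
    (forall n, form_measurable (u n)) ->
    (forall n, mu.-integrable setT (fun y => (fnorm (u n y))%:E)) ->
    (forall n, dclosed mu (u n)) ->
    (fun n => (\int[mu]_(y in [set y | (L < fnorm (u n y))%R]) (fnorm (u n y))%:E)%E)
      @ \oo --> 0%E ->
    exists v : nat -> N.-tuple R -> rform R N r,
      (forall n, form_measurable (v n)) /\
      (forall n, dclosed mu (v n)) /\
      (forall n, (Lnorm mu (+oo)%E (fun y => (fnorm (v n y))%:E) <= (C1 * L)%:E)%E) /\
      (fun n => Lnorm mu 1%:E (fun y => (fnorm (fun I => v n y I - u n y I))%:E))
        @ \oo --> 0%E /\
      (fun n => mu [set y | exists I, v n y I != u n y I]) @ \oo --> 0%E.
Proof.
move=> _ _; have [C2 [C20 HC2]] := @truncation_form R N r.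
pose m : R := #|{: rset N r}|%:R.
(* [m] passes from coefficients to the Euclidean norm; the + 1 secures strict positivity. *)
exists (m * C2 + 1); split; first by rewrite ltr_wpDl// mulr_ge0.
move=> mu leb u L L0 mu_ iu cu small.
set eps := (fun n => _) in small.
have small_fin := fine_cvg small.
have [n0 Hn0] : exists n0, forall n, (n0 <= n)%N -> (eps n <= L%:E)%E.
  move/fine_cvgP : small => [[n1 _ fin1] /cvgrPdist_le /(_ _ L0)[n2 _ H2]].
  exists (maxn n1 n2) => n; rewrite geq_max => /andP[h1 h2].
  rewrite -[eps n]fineK; last exact: fin1.
  rewrite lee_fin; have := H2 n h2; rewrite /= sub0r normrN.
  exact: le_trans (ler_norm _).
pose K1 : R := 17 ^+ N / L.
pose K2 : R := (m * (C2 * L) + m * L) * (17 ^+ N / L) + m.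
have ex n : exists vn : N.-tuple R -> rform R N r,
    [/\ form_measurable vn, dclosed mu vn,
      {ae mu, forall x J, `|vn x J| <= C2 * L} &
      (n0 <= n)%N -> (mu [set y | exists J, vn y J != u n y J] <=
          (K1 * fine (eps n))%:E)%E /\
        (Lnorm mu 1%:E (fun y => (fnorm (fun J => vn y J - u n y J))%:E) <=
          (K2 * fine (eps n))%:E)%E].
  (* For n < n0 the mass above L may exceed L; the zero form is closed and bounded there, and the
     limits do not see finitely many terms. *)
  have [nn|nn] := leqP n0 n; last first.
    exists (fun _ _ => 0); split=> //.
    - move=> phi tp; rewrite (eq_integral (fun=> 0%E)) ?integral0// => x _.
      rewrite /dwedge big1// => J _; rewrite big1// => k _; rewrite big1// => I _.
      by rewrite mulr0.
    - by apply: aeW => x J; rewrite normr0 mulr_ge0// ltW.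
  have [vn [F [mv cv vb [mF vu] [muF vL]]]] :=
    HC2 mu leb (u n) L L0 (mu_ n) (iu n) (cu n) (Hn0 n nn).
  exists vn; split=> // _; split; last exact: vL.
  apply: le_trans muF; apply: le_measure; rewrite ?inE//.
    rewrite (_ : [set y | _] = \bigcup_(J : rset N r)
      ((fun y => vn y J - u n y J) @^-1` (~` [set 0]))).
      apply: countable_bigcupT_measurable; first exact: countableP.
      move=> J; rewrite -[X in measurable X]setTI.
      apply: measurable_funB => //; first exact: mu_.
      by apply: measurableC; exact: measurable_set1.
    apply/seteqP; split=> y /=.
      by move=> [J /eqP H]; exists J => //= /eqP; rewrite subr_eq0 => /eqP.
    move=> [J _ H]; exists J; apply/eqP => E; apply: H.
    by rewrite /= E subrr.
  move=> y [J] /eqP H; apply: contrapT => nF; apply: H.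
  exact: vu.
have [v Hv] := choice ex.
exists v; split; first by move=> n; case: (Hv n).
split; first by move=> n; case: (Hv n).
have sq (K : R) (a : nat -> \bar R) : (forall n, (0 <= a n)%E) ->
    (forall n, (n0 <= n)%N -> (a n <= (K * fine (eps n))%:E)%E) -> a @ \oo --> 0%E.
  move=> a0 aK.
  apply: (squeeze_cvge (f := fun=> 0%E) (h := fun n => (K * fine (eps n))%:E)).
  - near=> n; rewrite a0 aK//; near: n; exact: nbhs_infty_ge.
  - exact: cvg_cst.
  - apply: cvg_EFin; first by near=> n.
    rewrite -(mulr0 K); apply: cvgMr; exact: small_fin.
split.
  move=> n; have [_ _ vb _] := Hv n.
  (* Essential supremum in one branch; in the other the norm is 0 and only nonnegativity of the
     bound is to be checked. *)
  rewrite unlock; case: ifP => _; last first.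
    by rewrite lee_fin mulr_ge0 ?(ltW L0)// addr_ge0// mulr_ge0.
  apply/ess_supP; apply: filterS vb => x H /=; rewrite lee_fin ger0_norm ?sqrtr_ge0//.
  apply: le_trans (fnorm_le H) _.
  by rewrite mulrDl mulrA lerDl mul1r ltW.
split.
  apply: (sq K2) => n; first exact: Lnorm_ge0.
  by move=> nn; have [_ _ _ /(_ nn)[]] := Hv n.
apply: (sq K1) => n; first exact: measure_ge0.
by move=> nn; have [_ _ _ /(_ nn)[]] := Hv n.
Unshelve. all: by end_near. Qed.
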